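(* Let $B\subset\mathbb R^d$ be a compact convex set containing a neighbourhood of $0$. Let $Z=N$ and $\tilde Z=\tilde N$ be Gauss-Poisson point processes in $\mathbb R^d$ having the same distribution $V$ of the secondary point. Assume that $N$ and $\tilde N$ have the same intensity and that the probabilities $p$ and $\tilde p$ for having a secondary point satisfy $p\le\tilde p$. Then $Z<_{h-B}\tilde Z$, i.e. the directed $B$-relative empty space hazards satisfy $r_B(t,C)\ge\tilde r_B(t,C)$ for all $t\ge0$ and all Borel sets $C\subset\mathbb R^d$.
   Context: Distances. $B^*:=\{-x:x\in B\}$. For $x\in\mathbb R^d$ and $K\subset\mathbb R^d$, $d_B(x,K):=\inf\{t\ge 0:(x+tB)\cap K\ne\emptyset\}$ (with $\inf\emptyset=\infty$). If $0<d_B(x,K)<\infty$ and $(x+d_B(x,K)B)\cap K=\{y\}$ is a single point, then $u_B(K,x):=(x-y)/d_B(x,K)\in\partial B^*$. Empty space hazard. For a stationary random closed set $Z$ for which $u_B(Z,0)$ is a.s. well defined on $\{0<d_B(0,Z)<\infty\}$ (this holds here), put $u_B(Z,0):=u_0$ for a fixed $u_0\in\partial B^*$ if $0\in Z$ or $d_B(0,Z)=\infty$, and let $F_B(t,C):=P(d_B(0,Z)\le t,\ u_B(Z,0)\in C)$, $F_B(t):=F_B(t,\mathbb R^d)$. $F_B(\cdot,C)$ is absolutely continuous on $(0,\infty)$; $f_B(\cdot,C)$ denotes its density, taken in the right-continuous version on $[0,\infty)$ (the right-hand derivative of $F_B(\cdot,C)$). The hazard is $r_B(t,C):=f_B(t,C)/(1-F_B(t))$,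 with $a/0:=0$; $\tilde r_B$ is the hazard of $\tilde Z$. Poisson cluster point process. $N=\bigcup_{x\in\Pi}(L_x+x)$, where $\Pi$ is a stationary Poisson process with intensity $\lambda_\Pi\in(0,\infty)$ and, given $\Pi$, the $L_x$ are i.i.d. finite random point sets distributed as the typical cluster $L_0$; $\gamma:=E\,\mathrm{card}\,L_0\in(0,\infty)$; $N$ has intensity $\lambda_\Pi\gamma$. For both processes the measure $E\big[\sum_{x,y\in L_0,\,x\ne y}\mathbf 1\{x-y\in\cdot\}\big]$ is assumed absolutely continuous with respect to Lebesgue measure. Gauss-Poisson process. A Poisson cluster process with $L_0=\{0\}$ if $\eta=1$ and $L_0=\{0,Y\}$ if $\eta=2$, where $\eta$ is $\{1,2\}$-valued, $p:=P(\eta=2)$, and the secondary point $Y$ is a random vector in $\mathbb R^d$ with distribution $V$, independent of $\eta$; the mean cluster size is $1+p$. The underlying Poisson intensities of $N$ and $\tilde N$ may differ. *)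

(* Defs.v *)
From HB Require Import structures.
From mathcomp Require Import all_boot all_order all_algebra.
From mathcomp Require Import all_classical all_reals all_analysis.

Set Implicit Arguments.
Unset Strict Implicit.
Unset Printing Implicit Defensive.
Import Order.TTheory GRing.Theory Num.Theory.
Import numFieldNormedType.Exports.

Local Open Scope classical_set_scope.
Local Open Scope ring_scope.

(** * Borel sigma-algebra and Lebesgue measure on R^d *)

HB.instance Definition _ (R : realType) (m n : nat) :=
  @isMeasurable.Build (sigma_display (@open 'M[R]_(m, n))) 'M[R]_(m, n)
    <<s @open 'M[R]_(m, n) >>
    (@sigma_algebra0 _ setT (@open 'M[R]_(m, n)))
    (@sigma_algebraC _ (@open 'M[R]_(m, n)))
    (@sigma_algebra_bigcup _ setT (@open 'M[R]_(m, n))).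

(* Iterated integration over the coordinates; on Borel sets this is, by
   Tonelli, the d-fold product of the one-dimensional Lebesgue measure. *)
Fixpoint lebesgue_rV (R : realType) (d : nat) : set 'rV[R]_d -> \bar R :=
  match d with
  | 0 => fun A => \d_(0 : 'rV[R]_0) A
  | n.+1 => fun A : set 'rV[R]_(1 + n) =>
      (\int[lebesgue_measure]_x
         lebesgue_rV [set v : 'rV[R]_n | A (row_mx (x%:M) v)])%E
  end.

Definition unit_cube (R : realType) (d : nat) : set 'rV[R]_d :=
  [set x | forall i, 0 <= x ord0 i <= 1].

(** * B-relative distance and direction *)

Section Distance.
Context {R : realType} {d : nat}.
Implicit Types (B K : set 'rV[R]_d) (x : 'rV[R]_d).

Definition reflection B : set 'rV[R]_d := [set - b | b in B].

Definition frontier B : set 'rV[R]_d := closure B `\` interior B.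

(* x + t B *)
Definition translate_scale x (t : R) B : set 'rV[R]_d :=
  [set x + t *: b | b in B].

Definition dist_rel B x K : \bar R :=
  ereal_inf [set t%:E | t in
    [set t : R | 0 <= t /\ translate_scale x t B `&` K !=set0]].

(* (x + d_B(x, K) B) `&` K *)
Definition contact B K x : set 'rV[R]_d :=
  translate_scale x (fine (dist_rel B x K)) B `&` K.

(* [u0] is also the value when the contact point is not unique. *)
Definition dir_rel B (u0 : 'rV[R]_d) K x : 'rV[R]_d :=
  if `[< (0 < dist_rel B x K < +oo)%E /\ exists y, contact B K x = [set y] >]
  then (fine (dist_rel B x K))^-1 *: (x - xget x (contact B K x))
  else u0.

End Distance.

(** * Directed empty space function and hazard *)

Section Hazard.
Context {R : realType} {d : nat} {disp : measure_display}.
Context {Omega : measurableType disp} (P : probability Omega R).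
Variables (B : set 'rV[R]_d) (u0 : 'rV[R]_d) (Z : Omega -> set 'rV[R]_d).

Definition empty_space (t : R) (C : set 'rV[R]_d) : R :=
  fine (P [set w | (dist_rel B 0 (Z w) <= t%:E)%E /\
                   C (dir_rel B u0 (Z w) 0)]).

Definition empty_space_density (t : R) (C : set 'rV[R]_d) : R :=
  lim ((fun h : R => h^-1 * (empty_space (t + h) C - empty_space t C))
         @ (0 : R)^'+).

(* [a / 0 = 0] holds in the field [R]. *)
Definition hazard (t : R) (C : set 'rV[R]_d) : R :=
  empty_space_density t C / (1 - empty_space t setT).

End Hazard.

(* Z <_{h-B} Z' *)
Definition hazard_smaller (R : realType) (d : nat)
    (disp disp' : measure_display)
    (Omega : measurableType disp) (Omega' : measurableType disp')
    (P : probability Omega R) (P' : probability Omega' R)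
    (B : set 'rV[R]_d) (u0 : 'rV[R]_d)
    (Z : Omega -> set 'rV[R]_d) (Z' : Omega' -> set 'rV[R]_d) : Prop :=
  forall (t : R) (C : set 'rV[R]_d), 0 <= t -> measurable C ->
    hazard P' B u0 Z' t C <= hazard P B u0 Z t C.

(** * Point processes *)

(* Generators, for the sigma-algebra on point configurations, fixing the number
   of points in a Borel set. *)
Definition count_events (R : realType) (d : nat) : set (set (set 'rV[R]_d)) :=
  [set H | exists (A : set 'rV[R]_d) (k : nat), measurable A /\
     H = [set S | counting (S `&` A) = (k%:R)%:E :> \bar R]].

Notation configuration R d := (g_sigma_algebraType (@count_events R d)).

Section PointProcess.
Context {R : realType} {d : nat} {disp : measure_display}.
Context {Omega : measurableType disp} (P : probability Omega R).

Definition random_point_set (N : Omega -> set 'rV[R]_d) : Prop :=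
  measurable_fun [set: Omega] (N : Omega -> configuration R d).

Definition intensity (N : Omega -> set 'rV[R]_d) : \bar R :=
  (\int[P]_w counting (N w `&` @unit_cube R d))%E.

(* The second argument of [poisson_prob] is a dummy. *)
Record stationary_poisson_process (lambda : R)
    (Pi : Omega -> set 'rV[R]_d) : Prop := {
  poisson_random : random_point_set Pi ;
  poisson_counts : forall (A : set 'rV[R]_d) (k : nat), measurable A ->
    (lebesgue_rV A < +oo)%E ->
    P [set w | counting (Pi w `&` A) = (k%:R)%:E :> \bar R]
      = poisson_prob (lambda * fine (lebesgue_rV A)) 0 [set k] ;
  poisson_indep : forall (n : nat) (A : 'I_n -> set 'rV[R]_d) (k : 'I_n -> nat),
    (forall i, measurable (A i)) -> trivIset [set: 'I_n] A ->
    P [set w | forall i, counting (Pi w `&` A i) = ((k i)%:R)%:E :> \bar R]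
      = (\prod_(i < n)
          fine (P [set w | counting (Pi w `&` A i)
                             = ((k i)%:R)%:E :> \bar R]))%:E }.

Definition independent_family (I : eqType) (F : I -> set (set Omega)) : Prop :=
  forall (J : seq I) (E : I -> set Omega), uniq J ->
    (forall i, i \in J -> F i (E i)) ->
    P (\bigcap_(i in [set` J]) E i) = (\prod_(i <- J) fine (P (E i)))%:E.

Definition sigma_of_points (X : nat -> Omega -> 'rV[R]_d) : set (set Omega) :=
  <<s \bigcup_n preimage_set_system setT (X n) measurable >>.

Definition sigma_of_config (L : Omega -> set 'rV[R]_d) : set (set Omega) :=
  preimage_set_system setT (L : Omega -> configuration R d) measurable.

Definition same_law (L L' : Omega -> set 'rV[R]_d) : Prop :=
  forall H : set (configuration R d), measurable H ->
    P (L @^-1` H) = P (L' @^-1` H).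

(* E[ sum_{x, y in L, x <> y} 1{x - y \in D} ] *)
Definition pair_difference_measure (L : Omega -> set 'rV[R]_d)
    (D : set 'rV[R]_d) : \bar R :=
  (\int[P]_w counting [set z : 'rV[R]_d * 'rV[R]_d |
      [/\ L w z.1, L w z.2, z.1 <> z.2 & D (z.1 - z.2)%R]])%E.

(* The points of the parent process Pi are enumerated as [X 0, X 1, ...]; the
   cluster [L n] belongs to the point [X n].  [L0] is the typical cluster.
   The index [None] below stands for the parents, [Some n] for the nth
   cluster. *)
Record poisson_cluster_process (lambda : R) (L0 : Omega -> set 'rV[R]_d)
    (N : Omega -> set 'rV[R]_d) : Prop := {
  cluster_lambda_gt0 : 0 < lambda ;
  cluster_random : random_point_set L0 ;
  cluster_finite : forall w, finite_set (L0 w) ;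
  cluster_mean : (0 < \int[P]_w (counting (L0 w) : \bar R) < +oo)%E ;
  cluster_ac : pair_difference_measure L0 `<< @lebesgue_rV R d ;
  cluster_construction :
    exists (X : nat -> {RV P >-> 'rV[R]_d}) (L : nat -> Omega -> set 'rV[R]_d),
    [/\ {ae P, forall w, injective (fun n => X n w)},
        stationary_poisson_process lambda (fun w => range (fun n => X n w)),
        (forall n, [/\ random_point_set (L n), forall w, finite_set (L n w)
                     & same_law (L n) L0]),
        independent_family (fun i : option nat =>
          if i is Some n then sigma_of_config (L n) else sigma_of_points X)
      & forall w, N w = \bigcup_n [set l + X n w | l in L n w]] }.

(* [eta] is the number of points of the cluster. *)
Definition gauss_poisson_cluster (eta : Omega -> nat) (Y : Omega -> 'rV[R]_d)
    (w : Omega) : set 'rV[R]_d :=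
  if eta w == 2%N then [set 0; Y w] else [set 0].

Definition gauss_poisson_process (V : probability 'rV[R]_d R) (p : R)
    (N : Omega -> set 'rV[R]_d) : Prop :=
  exists (lambda : R) (eta : {RV P >-> nat}) (Y : {RV P >-> 'rV[R]_d}),
  [/\ (forall w, eta w = 1%N \/ eta w = 2%N),
      P [set w | eta w = 2%N] = p%:E,
      (forall A, measurable A -> P (Y @^-1` A) = V A),
      (forall (k : nat) A, measurable A ->
         P ([set w | eta w = k] `&` Y @^-1` A)
           = (P [set w | eta w = k] * P (Y @^-1` A))%E)
    & poisson_cluster_process lambda (gauss_poisson_cluster eta Y) N].

End PointProcess.

(* Main.v *)
(* Forget the clusters: almost surely N consists of the points X_n and X_n + Y_n,
   where (X_n) is a Poisson process of intensity lam and the marks Y_n (0 if there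
   is no secondary point) are i.i.d. with law Q, Q = p V outside of 0. The
   probability that no pair (X_n, Y_n) lies in a set T is exp(- lam (mu x Q)(T)),
   mu being the Lebesgue measure.

   Fix t and C, and let S_h be the set of points at distance in (t, t + h] with
   direction in C. Up to an event of probability o(h), that two points of N lie in
   a shell of width 2h (by absolute continuity for two points of one cluster, by
   the Poisson second moment otherwise), the distance of N is in (t, t + h] with
   direction in C iff no point of N is in t B and some pair of
     T_h = {(x, y) | x and x + y are not in t B, one of them is in S_h}
   occurs. Hence the hazard is the limit of lam (mu x Q)(T_h) / h. By translation
   invariance, with v = V({0}^c),
     lam (mu x Q)(T_h) = lam (1 + p v) mu(S_h) - lam p J_h,
   where J_h >= 0 depends on V only. The first factor is the intensity of N, common
   to both processes; this and p <= p' force lam p <= lam' p', which gives the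
   inequality already before taking the limit. *)
From HB Require Import structures.
Require Import Defs.
From mathcomp Require Import all_boot all_order all_algebra finmap.
From mathcomp Require Import all_classical all_reals all_analysis.
From mathcomp Require Import measurable_realfun ring lra.
Import Order.TTheory GRing.Theory Num.Theory.
Import numFieldNormedType.Exports.

Set Implicit Arguments.
Unset Strict Implicit.
Unset Printing Implicit Defensive.

Local Open Scope classical_set_scope.
Local Open Scope ring_scope.

(** The density is a [lim], with no meaning if the quotient diverges, so the inequality before the
    limit helps only once the limit of lam (mu x Q)(T_h) / h is known to exist. The delicate part is
    the overlap: one point of a pair in S_h, the other in t B. On a ray from the origin, convexity
    of B turns the condition on the other point into an interval of radii; up to a vanishing error
    the overlap is a cone cut by the shell, and by scaling a cone contributes a constant times (t +
    h)^d - t^d.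

    The void probability exp(- lam (mu x Q)(T)) is not among the assumptions, which give the parent
    counts and the independence of clusters and parents. It comes from the Laplace functional along
    the enumeration X_n, with the marks integrated out one at a time.

    The width 2h leaves room beyond t + h: if at most one point lies in the wider shell, a distance
    in (t, t + h] is attained, although infima over arbitrary sets need not be.

    The formula for the intensity is proved as well, by counting the cells of a fine grid that N
    meets; this avoids the measurability of the number of points of N. *)

(** * Borel sets of row vectors *)

Section borel_rV.
Context {R : realType}.

Lemma open_measurable_mx m n (A : set 'M[R]_(m, n)) : open A -> measurable A.
Proof. exact: sub_sigma_algebra. Qed.

Lemma closed_measurable_mx m n (A : set 'M[R]_(m, n)) :
  closed A -> measurable A.
Proof.
move=> cA; rewrite -(setCK A); apply: measurableC.
by apply: open_measurable_mx; exact: closed_openC.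
Qed.

Lemma measurable_coord d (i : 'I_d) :
  measurable_fun setT (fun x : 'rV[R]_d => x ord0 i).
Proof.
apply: (measurability _ (RGenOInfty.measurableE R)) => _ [_ [a ->] <-].
rewrite setTI; apply: open_measurable_mx.
by apply: open_comp; [move=> x _; exact: coord_continuous | exact: rray_open].
Qed.

(** An open set is the union of the countably many boxes with rational centre and half-side 1/(n+1)
    that it contains, and the preimage of a box only involves coordinates. *)
Lemma measurable_fun_rV disp (T : measurableType disp) d (f : T -> 'rV[R]_d) :
  (forall i, measurable_fun setT (fun w => f w ord0 i)) ->
  measurable_fun setT f.
Proof.
move=> mf; apply: (@measurability _ _ T 'rV[R]_d setT f (@open 'rV[R]_d)) => //.
move=> _ [U oU <-]; rewrite setTI.
pose bx (c : 'rV[rat]_d * nat) : set 'rV[R]_d :=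
  [set x | forall i, `|x ord0 i - ratr (c.1 ord0 i)| < c.2.+1%:R^-1].
have -> : f @^-1` U =
    \bigcup_(c in [set c | bx c `<=` U]) (f @^-1` bx c).
  apply/seteqP; split=> w /=; last by case=> c /= cU; exact: cU.
  move=> Uw; have /nbhs_ballP[e /= e0 eU] : nbhs (f w) U by exact: open_nbhs_nbhs.
  (* Two points of one box differ by less than 2/(n+1) in each coordinate, so a box around [f w]
     stays in the ball of radius [e]. *)
  pose n := Num.truncn (2 / e).
  have ne : 2 * n.+1%:R^-1 < e.
    by rewrite ltr_pdivrMr// mulrC -ltr_pdivrMr// truncnS_gt.
  have ex i : exists q : rat, `|f w ord0 i - ratr q| < n.+1%:R^-1.
    have [|q] := @rat_in_itvoo R (f w ord0 i - n.+1%:R^-1) (f w ord0 i + n.+1%:R^-1).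
      by rewrite ltrBlDr -addrA ltrDl addr_gt0.
    by rewrite in_itv/= => qi; exists q; rewrite distrC ltr_distl.
  pose c : 'rV[rat]_d := \row_i xget 0 [set q : rat | `|f w ord0 i - ratr q| < n.+1%:R^-1].
  have cP i : `|f w ord0 i - ratr (c ord0 i)| < n.+1%:R^-1.
    by rewrite mxE; exact: (xgetPex 0 (ex i)).
  exists (c, n) => //= x bxx; apply: eU; split => // j i.
  rewrite (ord1 j) /ball/=; apply: le_lt_trans ne.
  have := ler_normD (f w ord0 i - ratr (c ord0 i)) (ratr (c ord0 i) - x ord0 i).
  rewrite addrA subrK => /le_trans; apply; rewrite mulrC mulr_natr mulr2n lerD//.
    exact/ltW/cP.
  by rewrite distrC; exact/ltW/bxx.
rewrite bigcup_mkcond; apply: countable_bigcupT_measurable => // c.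
case: ifPn => // _.
have -> : f @^-1` bx c = \bigcap_(i in [set: 'I_d])
    [set w | `|f w ord0 i - ratr (c.1 ord0 i)| < c.2.+1%:R^-1].
  by apply/seteqP; split=> w /= H i; [move=> _; exact: H | exact: H].
apply: fin_bigcap_measurable; first exact: finite_finset.
move=> i _.
have m1 : measurable_fun setT (fun w => `|f w ord0 i - ratr (c.1 ord0 i)|).
  by apply: measurableT_comp => //; apply: measurable_funB.
rewrite -[X in measurable X]setTI.
exact: (measurable_fun_ltr m1 (@measurable_cst _ _ _ _ setT (c.2.+1%:R^-1 : R)) measurableT (Y:=[set true])).
Qed.

End borel_rV.

Lemma measurable_preimage d1 d2 (T1 : measurableType d1)
    (T2 : measurableType d2) (f : T1 -> T2) (A : set T2) :
  measurable_fun setT f -> measurable A -> measurable (f @^-1` A).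
Proof. by move=> mf mA; rewrite -[X in measurable X]setTI; exact: mf. Qed.

Lemma pushforward_measure d1 d2 (T1 : measurableType d1)
    (T2 : measurableType d2) (R : realType) (m : {measure set T1 -> \bar R})
    (f : T1 -> T2) : measurable_fun setT f ->
  exists M : {measure set T2 -> \bar R},
    (M : set T2 -> \bar R) = pushforward m f.
Proof.
by move=> mf; pose M : {measure set T2 -> \bar R} := pushforward m f; exists (M mf).
Qed.

Lemma sigma_finite_measure_of d (T : measurableType d) (R : realType)
    (m : {measure set T -> \bar R}) : sigma_finite setT m ->
  exists M : {sigma_finite_measure set T -> \bar R}, forall A, M A = m A.
Proof.
move=> sfm; pose f := fun A => m A.
have f0 : f set0 = 0%E by rewrite /f measure0.
have fge0 A : (0 <= f A)%E by rewrite /f measure_ge0.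
have fsa : semi_sigma_additive f by exact: (@measure_semi_sigma_additive _ _ _ m).
pose i1 := isMeasure.Build _ _ _ f f0 fge0 fsa.
pose i2 := isSFinite.Build _ _ _ f (sfinite_measure_sigma_finite sfm).
pose i3 := isSigmaFinite.Build _ _ _ f sfm.
by pose M : {sigma_finite_measure set T -> \bar R} := HB.pack f i1 i2 i3; exists M.
Qed.

(** * Lebesgue measure on R^d: translation, scaling, boxes *)

Section lebesgue_rV_theory.
Context {R : realType}.
Local Open Scope ereal_scope.

Definition consrV n (z : R * 'rV[R]_n) : 'rV[R]_(1 + n) := row_mx (z.1%:M) z.2.

Lemma measurable_consrV n :
  measurable_fun setT (@consrV n : measurableTypeR R * 'rV[R]_n -> 'rV[R]_(1 + n)).
Proof.
apply: measurable_fun_rV => i; rewrite /consrV.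
have [j -> | j ->] := split_ordP i.
  rewrite (_ : (fun _ => _) = fst); first exact: measurable_fst.
  by apply/funext => z; rewrite row_mxEl mxE (ord1 j) eqxx mulr1n.
rewrite (_ : (fun _ => _) = (fun v : 'rV[R]_n => v ord0 j) \o snd); last first.
  by apply/funext => z; rewrite row_mxEr.
by apply: measurableT_comp; [exact: measurable_coord | exact: measurable_snd].
Qed.

(** [lebesgue_rV] is a bare function on all sets. On Borel sets it is the image of a product measure
    under [consrV]; the inverse [f] of [consrV] transports sigma-finiteness. From here on [mu]
    stands for it. *)
Lemma lebesgue_rV_measure d : exists mu : {sigma_finite_measure set 'rV[R]_d -> \bar R},
  forall A, measurable A -> mu A = lebesgue_rV A.
Proof.
elim: d => [|n [mu muE]].
  by exists (dirac (0%R : 'rV[R]_0)).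
pose m := pushforward (@lebesgue_measure R \x mu) (@consrV n).
have mE A : measurable A -> m A = lebesgue_rV (A : set 'rV[R]_(n.+1)).
  move=> mA; apply: eq_integral => x _ /=.
  transitivity (lebesgue_rV (xsection (@consrV n @^-1` A) x)).
    apply: muE; apply: measurable_xsection; rewrite -[X in measurable X]setTI.
    exact: measurable_consrV.
  change (lebesgue_rV (xsection (@consrV n @^-1` A) x) =
          lebesgue_rV [set v : 'rV[R]_n | A (row_mx x%:M v)]).
  congr lebesgue_rV.
  by apply/seteqP; split => v; rewrite /xsection/= inE.
have sfm : sigma_finite setT m.
  have /sigma_finiteP[F [TF ndF Foo]] := sigma_finiteT (@lebesgue_measure R).
  have /sigma_finiteP[G [TG ndG Goo]] := sigma_finiteT mu.
  pose f (x : 'rV[R]_(1 + n)) : measurableTypeR R * 'rV[R]_n :=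
    (x ord0 (lshift n ord0), rsubmx x).
  have fK z : f (consrV z) = z.
    by case: z => x v; rewrite /f /consrV/= row_mxEl mxE eqxx mulr1n row_mxKr.
  have mf : measurable_fun setT f.
    apply/measurable_fun_pairP; split; first exact: measurable_coord.
    apply: measurable_fun_rV => i /=.
    rewrite (_ : (fun _ => _) =
        (fun x : 'rV[R]_(1 + n) => x ord0 (rshift 1 i))).
      exact: measurable_coord.
    by apply/funext => x; rewrite /f/= mxE.
  exists (fun k => f @^-1` (F k `*` G k)).
    rewrite -preimage_bigcup (_ : \bigcup_k _ = setT) ?preimage_setT//.
    apply/seteqP; split => // -[x v] _.
    have [i _ Fi] : (\bigcup_i F i) x by rewrite -TF.
    have [j _ Gj] : (\bigcup_i G i) v by rewrite -TG.
    exists (maxn i j) => //; split.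
      by move: x Fi; exact/subsetPset/ndF/leq_maxl.
    by move: v Gj; exact/subsetPset/ndG/leq_maxr.
  move=> k; have [mF Fk] := Foo k; have [mG Gk] := Goo k; split.
    by rewrite -[X in measurable X]setTI; apply: mf => //; exact: measurableX.
  rewrite /m /pushforward (_ : _ @^-1` _ = F k `*` G k); last first.
    by rewrite -comp_preimage (_ : f \o _ = id) ?preimage_id//; exact/funext.
  by rewrite product_measure1E// lte_mul_pinfty// ge0_fin_numE.
have [M MmE] := pushforward_measure (@lebesgue_measure R \x mu) (@measurable_consrV n).
have sfM : sigma_finite setT (M : set _ -> \bar R) by rewrite MmE.
have [MM MME] := sigma_finite_measure_of sfM.
by exists MM => A mA; rewrite MME MmE; exact: mE.
Qed.

Lemma lebesgue_rVS n (A : set 'rV[R]_(1 + n)) :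
  @lebesgue_rV R n.+1 A =
  \int[lebesgue_measure]_x lebesgue_rV [set v : 'rV[R]_n | A (row_mx (x%:M) v)].
Proof. by []. Qed.

Lemma measurable_lebesgue_rV_section n (A : set 'rV[R]_(1 + n)) : measurable A ->
  measurable_fun (setT : set (measurableTypeR R)) (fun x =>
    lebesgue_rV [set v : 'rV[R]_n | A (row_mx (x%:M) v)]).
Proof.
move=> mA; have [mu muE] := lebesgue_rV_measure n.
have mC : measurable (@consrV n @^-1` A : set (measurableTypeR R * 'rV[R]_n)).
  by rewrite -[X in measurable X]setTI; exact: measurable_consrV.
apply: (eq_measurable_fun (mu \o xsection (@consrV n @^-1` A))).
  move=> x _ /=; rewrite muE; last exact: measurable_xsection.
  by congr lebesgue_rV; apply/seteqP; split => v; rewrite /xsection/= inE.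
exact: measurable_fun_xsection.
Qed.

Lemma lebesgue_rV_ge0 d (A : set 'rV[R]_d) : 0 <= lebesgue_rV A.
Proof.
elim: d A => [|n IH] A; first exact: measure_ge0.
by apply: integral_ge0 => x _; exact: IH.
Qed.

(** The image of Lebesgue measure under the shift has the same values on half-open intervals, which
    determine Lebesgue measure. The scaling lemma below uses the same argument. *)
Lemma integral_lebesgue_shift (a : R) (g : measurableTypeR R -> \bar R) :
  measurable_fun setT g -> (forall x, 0 <= g x) ->
  \int[lebesgue_measure]_x g (x + a)%R = \int[lebesgue_measure]_x g x.
Proof.
move=> mg g0.
have ms : measurable_fun setT (fun x : measurableTypeR R => x + a : measurableTypeR R)%R.
  exact: measurable_funD.
transitivity (\int[pushforward lebesgue_measure (fun x : measurableTypeR R => x + a : measurableTypeR R)%R]_(x in setT) g x).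
  by rewrite ge0_integral_pushforward//= preimage_setT.
apply: eq_measure_integral => //= A mA _.
have [M ME] := pushforward_measure (@lebesgue_measure R) ms.
rewrite -ME; apply/esym; apply: (@lebesgue_measure_unique _ M) => // _ [[x y]] _ <-.
rewrite ME /pushforward/= (_ : _ @^-1` _ = `]x - a, y - a]%classic)%R.
  rewrite !lebesgue_measure_itv/= !lte_fin ltrD2r; case: ifPn => // _.
  by rewrite -!EFinB; congr (_%:E); ring.
by apply/seteqP; split => z /=; rewrite !in_itv/= ltrBlDr lerBrDr.
Qed.

Lemma integral_lebesgue_scale (c : R) (g : measurableTypeR R -> \bar R) :
  (0 < c)%R -> measurable_fun setT g -> (forall x, 0 <= g x) ->
  c%:E * \int[lebesgue_measure]_x g (c * x)%R = \int[lebesgue_measure]_x g x.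
Proof.
move=> c0 mg g0.
have ms : measurable_fun setT (fun x : measurableTypeR R => c * x : measurableTypeR R)%R.
  exact: measurable_funM.
have [M ME] := pushforward_measure (@lebesgue_measure R) ms.
transitivity (c%:E * \int[M]_x g x).
  by congr (_ * _); rewrite ME ge0_integral_pushforward//= preimage_setT.
have c0' : (0 <= c)%R by exact: ltW.
rewrite -(@ge0_integral_mscale _ _ _ M setT measurableT (NngNum c0') g)//.
apply: eq_measure_integral => //= A mA _.
apply/esym; apply: (@lebesgue_measure_unique _ (mscale (NngNum c0') M)) => // _ [[x y]] _ <-.
transitivity (c%:E * M `]x, y]%classic); last by [].
rewrite ME /pushforward/= (_ : _ @^-1` _ = `]x / c, y / c]%classic)%R.
  rewrite !lebesgue_measure_itv/= !lte_fin ltr_pM2r ?invr_gt0//; case: ifPn => // _.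
    by rewrite -!EFinB -EFinM; congr (_%:E); field; rewrite gt_eqF.
  by rewrite mule0.
by apply/seteqP; split => z /=; rewrite !in_itv/= ltr_pdivrMr// ler_pdivlMr// mulrC.
Qed.

Lemma lebesgue_rV_shift d (y : 'rV[R]_d) (A : set 'rV[R]_d) : measurable A ->
  lebesgue_rV [set x | A (x + y)%R] = lebesgue_rV A.
Proof.
elim: d y A => [|n IH] y A mA.
  by congr (@lebesgue_rV R 0); apply/seteqP; split => x /=; rewrite [(x + y)%R]thinmx0 [x]thinmx0.
pose g x := lebesgue_rV [set v : 'rV[R]_n | A (row_mx (x%:M) v)].
rewrite !lebesgue_rVS; pose a := (y : 'rV_(1 + n)) ord0 (lshift n ord0).
transitivity (\int[lebesgue_measure]_x g (x + a)%R); last first.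
  apply: integral_lebesgue_shift; first exact: measurable_lebesgue_rV_section.
  by move=> x; exact: lebesgue_rV_ge0.
apply: eq_integral => x _.
have mc : measurable_fun setT (fun v : 'rV[R]_n => row_mx ((x + a)%:M) v : 'rV[R]_(1 + n)).
  exact: (@measurable_fun_pair2 _ _ _ _ _ _ _ (x + a)%R (@measurable_consrV n)).
have mA' : measurable [set v : 'rV[R]_n | A (row_mx (x + a)%:M v)].
  exact: (measurable_preimage mc).
rewrite /g -(IH (rsubmx (y : 'rV_(1 + n))) _ mA').
have yE v : (row_mx x%:M v + (y : 'rV_(1 + n)))%R = row_mx (x + a)%:M (v + rsubmx (y : 'rV_(1 + n))).
  rewrite -[y in LHS](@hsubmxK _ 1 1 n) add_row_mx; congr row_mx.
  by apply/matrixP => i j; rewrite !ord1 !mxE !mulr1n.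
by congr lebesgue_rV; apply: eq_set => v /=; congr A; exact: yE.
Qed.

Lemma lebesgue_rV_scale d (c : R) (A : set 'rV[R]_d) : (0 < c)%R -> measurable A ->
  (c ^+ d)%:E * lebesgue_rV [set x | A (c *: x)%R] = lebesgue_rV A.
Proof.
move=> c0; elim: d A => [|n IH] A mA.
  rewrite expr0 mul1e.
  by congr (@lebesgue_rV R 0); apply/seteqP; split => x /=; rewrite [(c *: x)%R]thinmx0 [x]thinmx0.
pose g x := lebesgue_rV [set v : 'rV[R]_n | A (row_mx (x%:M) v)].
have mg : measurable_fun setT (g : measurableTypeR R -> \bar R).
  exact: measurable_lebesgue_rV_section.
have g0 x : 0 <= g x by exact: lebesgue_rV_ge0.
rewrite !lebesgue_rVS -[RHS](@integral_lebesgue_scale c g)// exprS EFinM -muleA; congr (_ * _).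
have mg' : measurable_fun setT (fun x : measurableTypeR R => g (c * x)%R).
  by apply: (measurableT_comp mg); exact: measurable_funM.
have gE x : g (c * x)%R = (c ^+ n)%:E *
    lebesgue_rV [set v : 'rV[R]_n | A (c *: (row_mx (x%:M) v : 'rV[R]_(1 + n)))%R].
  have mc : measurable_fun setT (fun v : 'rV[R]_n => row_mx ((c * x)%:M) v : 'rV[R]_(1 + n)).
    exact: (@measurable_fun_pair2 _ _ _ _ _ _ _ (c * x)%R (@measurable_consrV n)).
  have mA' : measurable [set v : 'rV[R]_n | A (row_mx (c * x)%:M v)].
    exact: (measurable_preimage mc).
  rewrite /g -(IH _ mA'); congr (_ * lebesgue_rV _); apply: eq_set => v /=; congr A.
  by rewrite scale_row_mx scale_scalar_mx.
have mcA : measurable [set x : 'rV[R]_(1 + n) | A (c *: x)%R].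
  apply: measurable_preimage mA; apply: measurable_fun_rV => i.
  under eq_fun do rewrite mxE.
  by apply: measurable_funM => //; exact: measurable_coord.
transitivity (\int[lebesgue_measure]_x ((c ^+ n)%:E *
    lebesgue_rV [set v : 'rV[R]_n | A (c *: (row_mx (x%:M) v : 'rV[R]_(1 + n)))%R])); last first.
  by apply: eq_integral => x _; rewrite gE.
rewrite ge0_integralZl//.
- exact: (measurable_lebesgue_rV_section mcA).
- by move=> x _; exact: lebesgue_rV_ge0.
- by rewrite lee_fin exprn_ge0// ltW.
Qed.

Lemma lebesgue_rV_box d (I : set (measurableTypeR R)) : measurable I ->
  lebesgue_rV [set x : 'rV[R]_d | forall i, I (x ord0 i)] =
  (lebesgue_measure I) ^+ d.
Proof.
move=> mI; elim: d => [|n IH].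
  by rewrite expe0 /lebesgue_rV diracE mem_set//= => -[].
rewrite lebesgue_rVS (eq_integral (fun x => lebesgue_measure I ^+ n * (\1_I x)%:E)).
  rewrite ge0_integralZl//; last 2 first.
  - by apply/measurable_EFinP; exact: measurable_indic.
  - by apply: expe_ge0.
  by rewrite integral_indic// setIT expeS muleC.
move=> x _; rewrite indicE; have [xI|xI] := boolP (x \in I).
  rewrite mule1 -IH; congr lebesgue_rV; apply: eq_set => v.
  apply/propext; split => [H i|H i].
    have e : (row_mx x%:M v : 'rV[R]_n.+1) ord0 (rshift 1 i) = v ord0 i := row_mxEr _ _ _ _.
    by rewrite -e; exact: H.
  case: (split_ordP (i : 'I_(1 + n))) => j ->.
    have -> : (row_mx x%:M v : 'rV[R]_n.+1) ord0 (lshift n j) = x.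
      by rewrite (row_mxEl x%:M v) mxE (ord1 j) mulr1n.
    by rewrite inE in xI.
  by have -> : (row_mx x%:M v : 'rV[R]_n.+1) ord0 (rshift 1 j) = v ord0 j := row_mxEr _ _ _ _.
rewrite mule0 (_ : [set v | _] = set0); first by have [mu <-//] := lebesgue_rV_measure n.
rewrite -subset0 => v /(_ (lshift n (ord0 : 'I_1))).
have -> : (row_mx x%:M v : 'rV[R]_n.+1) ord0 (lshift n (ord0 : 'I_1)) = x.
  by rewrite (row_mxEl x%:M v) mxE mulr1n.
by move=> Ix; rewrite mem_set in xI.
Qed.

End lebesgue_rV_theory.

(** * Integrating out independent marks *)

Lemma fin_num_addeI (R : realDomainType) (a b c : \bar R) :
  a \is a fin_num -> (a + b = a + c)%E -> b = c.
Proof. by case: a b c => [a| |] [b| |] [c| |]//= _ [/addrI ->]. Qed.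

Section conditioning.
Context {R : realType} d d1 d2 (Omega : measurableType d)
  (T1 : measurableType d1) (T2 : measurableType d2).
Variables (P : probability Omega R) (Q : probability T2 R).
Local Open Scope ereal_scope.

(* In the induction below, [g'] is what becomes of [g] once the marks already
   treated have been integrated out. *)
Lemma integrate_out (X : Omega -> T1) (Y : Omega -> T2) (g g' : Omega -> R) :
  measurable_fun setT X -> measurable_fun setT Y ->
  measurable_fun setT g -> measurable_fun setT g' ->
  (forall w, 0 <= g w <= 1)%R -> (forall w, 0 <= g' w <= 1)%R ->
  (forall A B, measurable A -> measurable B ->
    \int[P]_(w in X @^-1` A `&` Y @^-1` B) (g w)%:E =
    \int[P]_(w in X @^-1` A) (g' w)%:E * Q B) ->
  forall T : set (T1 * T2), measurable T ->
    \int[P]_(w in [set w | T (X w, Y w)]) (g w)%:E =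
    \int[P]_w ((g' w)%:E * Q (xsection T (X w))).
Proof.
move=> mX mY mg mg' g01 g'01 H.
have mZ : measurable_fun setT (fun w => (X w, Y w)) by exact: measurable_fun_pair.
have mT T : measurable T -> measurable [set w | T (X w, Y w)].
  by move=> ?; exact: (measurable_preimage mZ).
have mgE : measurable_fun setT (EFin \o g) by exact/measurable_EFinP.
have mgE' : measurable_fun setT (EFin \o g') by exact/measurable_EFinP.
have g0 w : 0 <= (g w)%:E by rewrite lee_fin; case/andP: (g01 w).
have g'0 w : 0 <= (g' w)%:E by rewrite lee_fin; case/andP: (g'01 w).
have mQ T : measurable T -> measurable_fun setT (fun w => Q (xsection T (X w))).
  by move=> mT0; exact: (measurableT_comp (measurable_fun_xsection Q mT0) mX).
have xsT x : xsection [set: T1 * T2] x = setT.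
  by apply/seteqP; split => // y _; rewrite /xsection/= inE.
have HT : \int[P]_w (g w)%:E = \int[P]_w (g' w)%:E.
  have := H _ _ measurableT measurableT.
  by rewrite !preimage_setT setTI probability_setT mule1.
move=> T mT0; have := mT0; rewrite measurable_prod_measurableType => sT.
(* The sets satisfying the identity form a Dynkin system, and the rectangles, for which it is the
   hypothesis [H], are stable under intersection. *)
apply: (@dynkin_induction _ (T1 * T2)%type
  [set A `*` B | A in measurable & B in measurable]
  [set T | \int[P]_(w in [set w | T (X w, Y w)]) (g w)%:E =
    \int[P]_w ((g' w)%:E * Q (xsection T (X w)))]) => //.
- by rewrite measurable_prod_measurableType.
- move=> _ _ [A mA [B mB <-]] [A' mA' [B' mB' <-]].
  exists (A `&` A'); first exact: measurableI.
  by exists (B `&` B'); [exact: measurableI | rewrite setXI].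
- rewrite /= HT; apply: eq_integral => w _.
  by rewrite xsT probability_setT mule1.
- move=> _ [A mA [B mB <-]] /=.
  rewrite (_ : [set w | _] = X @^-1` A `&` Y @^-1` B)//.
  rewrite H// muleC -ge0_integralZl//; last 2 first.
  + exact: measurable_preimage.
  + exact: measurable_funTS.
  rewrite integral_mkcond; apply: eq_integral => w _; rewrite patchE.
  rewrite muleC; have [XA|XA] := boolP (w \in X @^-1` A).
    by rewrite in_xsectionX//; move: XA; rewrite !inE.
  by rewrite notin_xsectionX ?measure0 ?mule0//; apply: contra XA; rewrite !inE.
- move=> S mS /= IH.
  have e1 : \int[P]_(w in [set w | S (X w, Y w)]) (g w)%:E +
      \int[P]_(w in [set w | (~` S) (X w, Y w)]) (g w)%:E = \int[P]_w (g w)%:E.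
    rewrite -ge0_integral_setU//.
    + congr (integral _ _ _); apply/seteqP; split => // w _ /=.
      exact: lem.
    + exact: mT.
    + by apply: mT; exact: measurableC.
    + exact: measurable_funTS.
    + by apply/disj_setPS => w [].
  have e2 : \int[P]_w ((g' w)%:E * Q (xsection S (X w))) +
      \int[P]_w ((g' w)%:E * Q (xsection (~` S) (X w))) = \int[P]_w (g' w)%:E.
    rewrite -ge0_integralD//.
    + apply: eq_integral => w _; rewrite -ge0_muleDr// -measureU//.
      * transitivity ((g' w)%:E * Q setT); last by rewrite probability_setT mule1.
        congr (_ * Q _); apply/seteqP; split => // y _; rewrite /xsection/= !inE.
        exact: lem.
      * exact: measurable_xsection.
      * by apply: measurable_xsection; exact: measurableC.
      * by rewrite -xsectionI setICr xsection0.
    + by move=> w _; exact: mule_ge0.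
    + by apply: emeasurable_funM => //; exact: mQ.
    + by move=> w _; exact: mule_ge0.
    + by apply: emeasurable_funM => //; apply: mQ; exact: measurableC.
  (* Passing to the complement cancels this term in the extended reals. *)
  have fin : \int[P]_w ((g' w)%:E * Q (xsection S (X w))) \is a fin_num.
    rewrite ge0_fin_numE; last by apply: integral_ge0 => w _; exact: mule_ge0.
    apply: (@le_lt_trans _ _ (\int[P]_w (cst 1 w))).
      apply: ge0_le_integral => //.
      + by move=> w _; exact: mule_ge0.
      + by apply: emeasurable_funM => //; exact: mQ.
      + move=> w _; rewrite /= -[leRHS]mule1; apply: lee_pmul => //.
          by rewrite lee_fin; case/andP: (g'01 w).
        exact: probability_le1 (measurable_xsection _ _).
    by rewrite integral_cst// mul1e; exact: (le_lt_trans (probability_le1 P measurableT) (ltry 1)).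
  move: e1; rewrite HT -e2 IH => e.
  exact: (fin_num_addeI fin e).
- move=> F mF tF /= IH.
  rewrite (_ : [set w | _] = \bigcup_k [set w | F k (X w, Y w)])//.
  rewrite ge0_integral_bigcup//; last 3 first.
  + by move=> k; exact: mT.
  + exact: measurable_funTS.
  + apply/trivIsetP => i j _ _ ij; have /trivIsetP/(_ i j Logic.I Logic.I ij) := tF.
    by move=> FF; apply/seteqP; split => // w [Fi Fj]; have : set0 (X w, Y w) by rewrite -FF.
  transitivity (\int[P]_w \sum_(k <oo) ((g' w)%:E * Q (xsection (F k) (X w)))).
    rewrite integral_nneseries//.
    + by apply: eq_eseriesr => k _; exact: IH.
    + by move=> k; apply: emeasurable_funM => //; exact: mQ.
    + by move=> k w _; exact: mule_ge0.
  apply: eq_integral => w _; rewrite xsection_bigcup measure_bigcup//.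
  + by rewrite -nneseriesZl//; apply: eq_eseriesl => k; rewrite in_setT.
  + by move=> k _; exact: measurable_xsection.
  + exact: trivIset_xsection.
Qed.

Let aff (a b : nat -> R) (T : nat -> set (T1 * T2)) n z : R :=
  (a n + b n * \1_(T n) z)%R.

Let affQ (a b : nat -> R) (T : nat -> set (T1 * T2)) n x : R :=
  (a n + b n * fine (Q (xsection (T n) x)))%R.

Let fineQ01 (T : set (T1 * T2)) x : measurable T ->
  (0 <= fine (Q (xsection T x)) <= 1)%R.
Proof.
move=> mT; have mx := measurable_xsection x mT.
rewrite fine_ge0//= -lee_fin fineK ?fin_num_measure//.
exact: probability_le1.
Qed.

Let affine01 (a b z : R) : (0 <= a -> 0 <= b -> a + b <= 1 -> 0 <= z <= 1 ->
  0 <= a + b * z <= 1)%R.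
Proof.
move=> a0 b0 ab /andP[z0 z1]; rewrite addr_ge0 ?mulr_ge0//=.
by apply: le_trans ab; rewrite lerD2l ler_piMr.
Qed.

Let indic01 U (A : set U) x : (0 <= (\1_A x : R) <= 1)%R.
Proof. by rewrite indicE; case: (x \in A); rewrite ?lexx ler01. Qed.

Let prod01 (I : finType) (p : pred I) (F : I -> R) :
  (forall i, 0 <= F i <= 1)%R -> (0 <= \prod_(i | p i) F i <= 1)%R.
Proof.
move=> F01; rewrite prodr_ge0/=; last by move=> i _; case/andP: (F01 i).
by apply: prodr_ile1 => i _; exact: F01.
Qed.

Let prod_indic (m : nat) U (D : nat -> set U) (x : U) :
  (\prod_(n < m) \1_(D n) x)%R = \1_(\bigcap_(n < m) D n) x :> R.
Proof.
rewrite indicE; have [|] := boolP (x \in _).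
  rewrite inE => xD; apply: big1 => i _; rewrite indicE mem_set//.
  exact: (xD _ (ltn_ord i)).
rewrite notin_setE => /existsNP[n /not_implyP[nm nD]].
rewrite (bigD1 (Ordinal nm))//= indicE memNset// mul0r//.
Qed.

Let ge0_integral_lin (a b : R) (u v : Omega -> \bar R) :
  (0 <= a)%R -> (0 <= b)%R ->
  (forall w, 0 <= u w) -> (forall w, 0 <= v w) ->
  measurable_fun setT u -> measurable_fun setT v ->
  \int[P]_w (a%:E * u w + b%:E * v w) =
  a%:E * \int[P]_w u w + b%:E * \int[P]_w v w.
Proof.
move=> a0 b0 u0 v0 mu mv; rewrite ge0_integralD ?ge0_integralZl//.
- by move=> w _; rewrite mule_ge0.
- exact: measurable_funeM.
- by move=> w _; rewrite mule_ge0.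
- exact: measurable_funeM.
Qed.

Let measurable_fun_bigprod (I : finType) (p : pred I) (h : I -> Omega -> R) :
  (forall i, measurable_fun setT (h i)) ->
  measurable_fun setT (fun w => \prod_(i | p i) h i w)%R.
Proof.
move=> mh; elim: (index_enum I) => [|i s IH].
  by under eq_fun do rewrite big_nil; exact: measurable_cst.
under eq_fun do rewrite big_cons; case: (p i) => //.
exact: measurable_funM.
Qed.

(** Averaging over independent marks replaces each indicator by its conditional probability,
    simultaneously in all factors. Affine factors with [a + b <= 1] stay in [0, 1] and are general
    enough for 1 - z 1_T. *)
Lemma integrate_out_prod (X : nat -> Omega -> T1) (Y : nat -> Omega -> T2)
    (m : nat) (a b : nat -> R) (T : nat -> set (T1 * T2)) :
  (forall n, measurable_fun setT (X n)) ->
  (forall n, measurable_fun setT (Y n)) ->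
  (forall (A : nat -> set T1) (B : nat -> set T2),
    (forall n, measurable (A n)) -> (forall n, measurable (B n)) ->
    P (\bigcap_(n < m) (X n @^-1` A n `&` Y n @^-1` B n)) =
    P (\bigcap_(n < m) X n @^-1` A n) * (\prod_(n < m) fine (Q (B n)))%:E) ->
  (forall n, 0 <= a n)%R -> (forall n, 0 <= b n)%R ->
  (forall n, a n + b n <= 1)%R -> (forall n, measurable (T n)) ->
  \int[P]_w (\prod_(n < m) (a n + b n * \1_(T n) (X n w, Y n w)))%:E =
  \int[P]_w (\prod_(n < m) (a n + b n * fine (Q (xsection (T n) (X n w)))))%:E.
Proof.
move=> mX mY ind.
have mXY n : measurable_fun setT (fun w => (X n w, Y n w)).
  exact: measurable_fun_pair.
have maff a' b' T' n : measurable (T' n) ->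
    measurable_fun setT (fun w => aff a' b' T' n (X n w, Y n w)).
  move=> mT'; apply: measurable_funD => //; apply: measurable_funM => //.
  by apply: (measurableT_comp _ (mXY n)); exact: measurable_indic.
have maffQ a' b' T' n : measurable (T' n) ->
    measurable_fun setT (fun w => affQ a' b' T' n (X n w)).
  move=> mT'; apply: measurable_funD => //; apply: measurable_funM => //.
  have mq := measurableT_comp (measurable_fun_xsection Q mT') (mX n).
  exact: measurableT_comp mq.
(* Factors of index at least [k] are indicators of rectangles, the others are arbitrary. For k = 0
   the identity is the independence hypothesis; each step of the induction frees one more factor. *)
suff claim k : forall (a b : nat -> R) (T : nat -> set (T1 * T2)),
    (forall n, 0 <= a n)%R -> (forall n, 0 <= b n)%R ->
    (forall n, a n + b n <= 1)%R -> (forall n, measurable (T n)) ->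
    (forall n, (k <= n < m)%N -> [/\ a n = 0%R, b n = 1%R & exists A B,
     [/\ measurable A, measurable B & T n = A `*` B]]) ->
    \int[P]_w (\prod_(n < m) aff a b T n (X n w, Y n w))%:E =
    \int[P]_w (\prod_(n < m) affQ a b T n (X n w))%:E.
  move=> a0 b0 ab mT; apply: (claim m) => // n /andP[mn nm].
  by rewrite ltnNge mn in nm.
elim: k => [|k IH] {}a {}b {}T a0 b0 ab mT rect.
  have /choice[AB ABP] : forall n, exists AB : set T1 * set T2,
      [/\ measurable AB.1, measurable AB.2 & (n < m)%N -> T n = AB.1 `*` AB.2].
    move=> n; have [nm|nm] := boolP (n < m)%N; last first.
      by exists (setT, setT); split => //=; rewrite (negbTE nm).
    by have [_ _ [A [B [mA mB TE]]]] := rect n nm; exists (A, B).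
  pose A n := (AB n).1; pose B n := (AB n).2.
  have mA n : measurable (A n) by have [] := ABP n.
  have mB n : measurable (B n) by have [] := ABP n.
  have TE n : (n < m)%N -> T n = A n `*` B n by have [] := ABP n.
  have mXA n : measurable (X n @^-1` A n) by exact: measurable_preimage.
  have mYB n : measurable (Y n @^-1` B n) by exact: measurable_preimage.
  transitivity (\int[P]_w (\1_(\bigcap_(n < m) (X n @^-1` A n `&` Y n @^-1` B n)) w)%:E).
    apply: eq_integral => w _; rewrite -prod_indic; congr EFin.
    apply: eq_bigr => i _; have [aE bE _] := rect i (ltn_ord i).
    by rewrite /aff aE bE add0r mul1r TE// !indicE !in_setI; congr (_%:R); apply/idP/idP; rewrite !inE.
  rewrite integral_indic//; last first.
    by apply: bigcap_measurableType => n _; exact: measurableI.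
  rewrite setIT; etransitivity; first exact: ind.
  transitivity (\int[P]_w ((\prod_(n < m) fine (Q (B n)))%:E *
      (\1_(\bigcap_(n < m) X n @^-1` A n) w)%:E)).
    rewrite ge0_integralZl//; last 2 first.
    - apply/measurable_EFinP; apply: measurable_indic.
      by apply: bigcap_measurableType => n _.
    - by rewrite lee_fin; apply: prodr_ge0 => i _; exact: fine_ge0.
    rewrite integral_indic ?setIT 1?muleC//.
    by apply: bigcap_measurableType => n _.
  apply: eq_integral => w _; rewrite -prod_indic -EFinM -big_split/=.
  congr EFin; apply: eq_bigr => i _; have [aE bE _] := rect i (ltn_ord i).
  rewrite /affQ aE bE add0r mul1r TE// indicE mulrC.
  have [XA|XA] := boolP (w \in _).
    by rewrite in_xsectionX ?mul1r//; move: XA; rewrite !inE.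
  by rewrite notin_xsectionX ?measure0 ?mul0r//; apply: contra XA; rewrite !inE.
have [mk|km] := leqP m k.
  by apply: IH => // n /andP[/(leq_trans mk)]; rewrite leqNgt => /negP.
pose i0 := Ordinal km.
pose g w : R := (\prod_(i < m | i != i0) aff a b T i (X i w, Y i w))%R.
pose g' w : R := (\prod_(i < m | i != i0) affQ a b T i (X i w))%R.
have aff01 (i : 'I_m) w : (0 <= aff a b T i (X i w, Y i w) <= 1)%R.
  exact: affine01.
have affQ01 (i : 'I_m) w : (0 <= affQ a b T i (X i w) <= 1)%R.
  by apply: affine01 => //; exact: fineQ01.
have g01 w : (0 <= g w <= 1)%R by exact: prod01.
have g'01 w : (0 <= g' w <= 1)%R by exact: prod01.
have mg : measurable_fun setT g.
  by apply: measurable_fun_bigprod => i; exact: maff.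
have mg' : measurable_fun setT g'.
  by apply: measurable_fun_bigprod => i; exact: maffQ.
have g0 w : 0 <= (g w)%:E by rewrite lee_fin; case/andP: (g01 w).
have g'0 w : 0 <= (g' w)%:E by rewrite lee_fin; case/andP: (g'01 w).
have mgE : measurable_fun setT (EFin \o g) by exact/measurable_EFinP.
have mgE' : measurable_fun setT (EFin \o g') by exact/measurable_EFinP.
have key := @integrate_out (X k) (Y k) g g' (mX k) (mY k) mg mg' g01 g'01.
have {}key : forall S : set (T1 * T2), measurable S ->
    \int[P]_(w in [set w | S (X k w, Y k w)]) (g w)%:E =
    \int[P]_w ((g' w)%:E * Q (xsection S (X k w))).
  apply: key => A B mA mB.
  (* Factor [k] is replaced by the indicator of [A * B], so that the induction hypothesis verifies
     the rectangle condition of [integrate_out]. *)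
  pose a' n := if n == k then 0%R else a n.
  pose b' n := if n == k then 1%R else b n.
  pose T' n := if n == k then A `*` B else T n.
  have mT' n : measurable (T' n) by rewrite /T'; case: ifP => // _; exact: measurableX.
  have a'0 n : (0 <= a' n)%R by rewrite /a'; case: ifP.
  have b'0 n : (0 <= b' n)%R by rewrite /b'; case: ifP.
  have ab' n : (a' n + b' n <= 1)%R.
    by rewrite /a' /b'; case: ifP => // _; rewrite add0r.
  have rect' n : (k <= n < m)%N -> [/\ a' n = 0%R, b' n = 1%R & exists A B,
     [/\ measurable A, measurable B & T' n = A `*` B]].
    move=> /andP[kn nm]; rewrite /a' /b' /T'; have [nk|nk] := eqVneq n k.
      by split => //; exists A, B; split.
    by apply: rect; rewrite nm ltn_neqAle eq_sym nk kn.
  have H := IH a' b' T' a'0 b'0 ab' mT' rect'.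
  have mXA : measurable (X k @^-1` A) by exact: measurable_preimage.
  have mYB : measurable (Y k @^-1` B) by exact: measurable_preimage.
  transitivity (\int[P]_w (\prod_(n < m) aff a' b' T' n (X n w, Y n w))%:E).
    rewrite integral_mkcond; apply: eq_integral => w _; rewrite (bigD1 i0)//=.
    rewrite {1}/aff /a' /b' /T' eqxx add0r mul1r (eq_bigr (fun i : 'I_m => aff a b T i (X i w, Y i w))).
      rewrite -/(g w) indicE patchE.
      rewrite (_ : ((X k w, Y k w) \in A `*` B) = (w \in X k @^-1` A `&` Y k @^-1` B)).
        by case: ifPn => _; rewrite ?mul1r ?mul0r.
      by apply/idP/idP; rewrite !inE.
    by move=> i ik; rewrite /aff /a' /b' /T' (_ : (i == k :> nat) = false)//; apply: contra_neqF ik => /eqP ik; exact: val_inj.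
  rewrite H.
  transitivity (\int[P]_w ((Q B) * ((g' \_ (X k @^-1` A)) w)%:E)).
    apply: eq_integral => w _; rewrite (bigD1 i0)//=.
    rewrite {1}/affQ /a' /b' /T' eqxx add0r mul1r (eq_bigr (fun i : 'I_m => affQ a b T i (X i w))).
      rewrite -/(g' w) patchE; case: ifPn => XA.
        rewrite in_xsectionX; last by move: XA; rewrite !inE.
        by rewrite EFinM fineK// fin_num_measure.
      by rewrite notin_xsectionX ?measure0 ?mul0r ?mule0//; apply: contra XA; rewrite !inE.
    by move=> i ik; rewrite /affQ /a' /b' /T' (_ : (i == k :> nat) = false)//; apply: contra_neqF ik => /eqP ik; exact: val_inj.
  rewrite ge0_integralZl//; last 2 first.
  - by apply/measurable_EFinP; apply/measurable_restrict => //; exact: measurable_funTS.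
  - by move=> w _; rewrite patchE; case: ifP.
  rewrite muleC; congr (_ * _); rewrite [RHS]integral_mkcond.
  by apply: eq_integral => w _; rewrite !patchE; case: ifP.
(* The constant part [a k] of factor [k] is the case of the full set. *)
have ET : \int[P]_w (g w)%:E = \int[P]_w (g' w)%:E.
  have := key setT measurableT => /=; rewrite (_ : [set _ | True] = setT)// => ->.
  apply: eq_integral => w _; rewrite (_ : xsection _ _ = setT) ?probability_setT ?mule1//.
  by apply/seteqP; split => // y _; rewrite /xsection/= inE.
pose D := [set w | T k (X k w, Y k w)].
have mD : measurable D by exact: (measurable_preimage (mXY k)).
have mQk : measurable_fun setT (fun w => Q (xsection (T k) (X k w))).
  exact: (measurableT_comp (measurable_fun_xsection Q (mT k)) (mX k)).
transitivity (\int[P]_w ((a k)%:E * (g w)%:E + (b k)%:E * ((EFin \o g) \_ D) w)).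
  apply: eq_integral => w _; rewrite (bigD1 i0)//= -/(g w) /aff patchE indicE.
  have -> : ((X k w, Y k w) \in T k) = (w \in D) by apply/idP/idP; rewrite !inE.
  by case: ifPn => wD; rewrite /= ?mule0 -!EFinM -?EFinD; congr EFin; ring.
rewrite ge0_integral_lin//; last 2 first.
- by move=> w; rewrite patchE; case: ifP => // _; exact: g0.
- by apply/(measurable_restrictT _ mD); exact: measurable_funTS.
rewrite -integral_mkcond ET key// -ge0_integral_lin//; last 2 first.
- by move=> w; exact: mule_ge0.
- by apply: emeasurable_funM.
apply: eq_integral => w _; rewrite (bigD1 i0)//= -/(g' w) /affQ.
rewrite -[Q _]fineK ?fin_num_measure//; last exact: measurable_xsection.
by rewrite -!EFinM -EFinD; congr EFin; ring.
Qed.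

End conditioning.

(** * Void probabilities of a marked Poisson process *)

(** [counting] sees points while the product sees indices; injectivity identifies the two, and a
    finite count means that all factors but finitely many are 1. *)
Lemma prod_injective_count (R : realType) (T : choiceType) (x : nat -> T)
    (A : set T) (z : R) (k : nat) :
  injective x -> counting (range x `&` A) = k%:R%:E :> \bar R ->
  exists M, forall m, (M <= m)%N ->
    \prod_(n < m) (if x n \in A then z else 1) = z ^+ k.
Proof.
move=> xI; rewrite /counting; case: asboolP => // finxA [].
move=> /(mulrIn (@oner_neq0 R)) cardxA.
pose S := [set n | A (x n)].
have xS : range x `&` A = x @` S.
  by apply/seteqP; split=> [_ [[n _ <-] An]|_ [n An <-]]; [exists n|split=> //; exists n].
have finS : finite_set S.
  rewrite (_ : S = x @^-1` (range x `&` A)).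
    by apply: finite_preimage => // m n _ _; exact: xI.
  by apply/seteqP; split=> n; [split => //; exists n|case].
have cardS : #|` fset_set S|%fset = k.
  rewrite -cardxA xS fset_set_image// card_imfset//.
have [M SM] : exists M, forall n, S n -> (n < M)%N.
  exists (\max_(n <- fset_set S) n).+1 => n Sn; rewrite ltnS.
  by apply: leq_bigmax_seq => //; rewrite in_fset_set// inE.
exists M => m Mm.
rewrite -(big_mkord predT (fun n => if x n \in A then z else 1)) -big_mkcond.
rewrite -big_filter (perm_big (fset_set S)); last first.
  apply: uniq_perm; [exact/filter_uniq/iota_uniq | exact: fset_uniq|].
  move=> n; rewrite mem_filter mem_index_iota in_fset_set//=.
  have -> : (n \in S) = (x n \in A) by apply/idP/idP; rewrite !inE.
  have [xA|//] := boolP (x n \in A) => /=.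
  by apply: leq_trans Mm; apply: SM; rewrite inE in xA.
by rewrite big_const_seq count_predT cardS -Monoid.iteropE.
Qed.

Definition poisson_weight (R : realType) (l : R) (k : nat) : R :=
  l ^+ k / k`!%:R * expR (- l).

(** At l = 0, [poisson_prob] falls back on the Dirac mass at 0, which the weights reproduce because
    0^0 = 1. Null sets are thereby treated like all others. *)
Lemma poisson_prob1 (R : realType) (l : R) (k : nat) : 0 <= l ->
  poisson_prob l 0 [set k] = (poisson_weight l k)%:E.
Proof.
rewrite le_eqVlt /poisson_prob /poisson_weight => /predU1P[<-|l0].
  rewrite ltxx oppr0 expR0 mulr1 diracE; case: k => [|k].
    by rewrite expr0 fact0 invr1 mulr1 mem_set.
  by rewrite expr0n mul0r memNset.
by rewrite l0 esum_set1 ?lee_fin ?poisson_pmf_ge0// /poisson_pmf l0.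
Qed.

Lemma poisson_weight_ge0 (R : realType) (l : R) k : 0 <= l -> 0 <= poisson_weight l k.
Proof. by move=> l0; rewrite !mulr_ge0 ?exprn_ge0 ?invr_ge0 ?expR_ge0. Qed.

Lemma poisson_weight_gen (R : realType) (l z : R) : 0 <= l -> 0 <= z ->
  (\sum_(k <oo) (z ^+ k * poisson_weight l k)%:E = (expR (- (l * (1 - z))))%:E)%E.
Proof.
move=> l0 z0; rewrite (_ : expR _ = expR (- l) * expR (l * z)); last first.
  by rewrite -expRD; congr expR; ring.
rewrite EFinM (eq_eseriesr (g := fun k => ((expR (- l))%:E * (exp_coeff (l * z) k)%:E)%E)).
  rewrite nneseriesZl; last by move=> k _; rewrite lee_fin exp_coeff_ge0 ?mulr_ge0.
  congr (_ * _)%E; apply/cvg_lim => //.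
  rewrite (_ : (fun n => _) = EFin \o series (exp_coeff (l * z))).
    by apply: cvg_EFin; [exact: nearW|exact: is_cvg_series_exp_coeff].
  by apply/funext => n /=; rewrite /series/= -sumEFin.
move=> k _; rewrite -EFinM; congr EFin.
by rewrite /poisson_weight /exp_coeff/= exprMn; ring.
Qed.

(** * Laplace functional of a Poisson process, from its counts *)

Section poisson_laplace.
Context {R : realType} {q : nat} d (Omega : measurableType d).
Variables (P : probability Omega R) (mu : {measure set 'rV[R]_q -> \bar R}).
Variables (lam : R) (X : nat -> Omega -> 'rV[R]_q).
Hypothesis lam0 : 0 < lam.
Hypothesis mX : forall n, measurable_fun setT (X n).
Hypothesis injX : {ae P, forall w, injective (X ^~ w)}.

Let E (A : set 'rV[R]_q) (k : nat) : set Omega :=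
  [set w | counting (range (X ^~ w) `&` A) = k%:R%:E :> \bar R].

Hypothesis mE : forall A k, measurable A -> measurable (E A k).
Hypothesis PE : forall A k, measurable A -> (mu A < +oo)%E ->
  P (E A k) = (poisson_weight (lam * fine (mu A)) k)%:E.
Hypothesis indE : forall r (A : 'I_r -> set 'rV[R]_q) (k : 'I_r -> nat),
  (forall i, measurable (A i)) -> trivIset setT A ->
  P [set w | forall i, E (A i) (k i) w] = (\prod_(i < r) fine (P (E (A i) (k i))))%:E.

Let pp (f : 'rV[R]_q -> R) (m : nat) (w : Omega) : R := \prod_(n < m) f (X n w).

Let pp01 f m w : (forall x, 0 <= f x <= 1) -> 0 <= pp f m w <= 1.
Proof.
move=> f01; rewrite prodr_ge0/=; last by move=> i _; case/andP: (f01 (X i w)).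
by apply: prodr_ile1 => i _; exact: f01.
Qed.

Let mpp (f : 'rV[R]_q -> R) m : measurable_fun setT f -> measurable_fun setT (pp f m).
Proof.
move=> mf; rewrite /pp; elim: m => [|m IH].
  by under eq_fun do rewrite big_ord0; exact: measurable_cst.
under eq_fun do rewrite big_ord_recr/=.
by apply: measurable_funM => //; exact: measurableT_comp mf (mX m).
Qed.

Let cvg_pp f w : (forall x, 0 <= f x <= 1) -> cvgn (pp f ^~ w).
Proof.
move=> f01; apply: nonincreasing_is_cvgn; last first.
  by exists 0 => _ [m _ <-]; case/andP: (pp01 m w f01).
apply/nonincreasing_seqP => m; rewrite /pp big_ord_recr/= ler_piMr//.
  by case/andP: (pp01 m w f01).
by case/andP: (f01 (X m w)).
Qed.

(** The product of [f] over all enumerated points. It converges for every [w], the partial products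
    being nonincreasing and nonnegative when [f] has values in [0, 1]. *)
Let L f w := limn (pp f ^~ w).

Let L01 f w : (forall x, 0 <= f x <= 1) -> 0 <= L f w <= 1.
Proof.
move=> f01; apply/andP; split.
  by apply: limr_ge; [exact: cvg_pp|apply: nearW => m; case/andP: (pp01 m w f01)].
by apply: limr_le; [exact: cvg_pp|apply: nearW => m; case/andP: (pp01 m w f01)].
Qed.

Let mL (f : 'rV[R]_q -> R) : measurable_fun setT f -> (forall x, 0 <= f x <= 1) ->
  measurable_fun setT (L f).
Proof.
move=> mf f01; apply: (@measurable_fun_cvg _ _ _ _ (pp f)).
  by move=> m; exact: mpp.
by move=> w _; exact: cvg_pp.
Qed.

Let step (z : R) (A : set 'rV[R]_q) x : R := if x \in A then z else 1.

Let step01 z A : 0 <= z <= 1 -> forall x, 0 <= step z A x <= 1.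
Proof. by move=> z01 x; rewrite /step; case: ifP; rewrite ?ler01 ?lexx. Qed.

Let mstep z A : measurable A -> measurable_fun setT (step z A).
Proof.
move=> mA; rewrite (_ : step z A = fun x => 1 + (z - 1) * \1_A x).
  by apply: measurable_funD => //; apply: measurable_funM.
by apply/funext => x; rewrite indicE /step; case: ifP => _; rewrite ?mulr1 ?mulr0 ?addr0// subrKC.
Qed.

Let LE z A k w : injective (X ^~ w) -> E A k w -> L (step z A) w = z ^+ k.
Proof.
move=> iX /(prod_injective_count z iX)[M HM]; apply/cvg_lim => //.
apply: cvg_near_cst; exists M => // m /= Mm; exact: HM.
Qed.

Let trivE A : trivIset setT (E A).
Proof.
apply/trivIsetP => i j _ _ ij; apply/seteqP; split => // w [].
by rewrite /E/= => -> [] /(mulrIn (@oner_neq0 R)) e; rewrite e eqxx in ij.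
Qed.

(** The Poisson weights sum to 1 (generating function at z = 1), so the count is almost surely a
    natural number. *)
Let PE1 A : measurable A -> (mu A < +oo)%E -> P (\bigcup_k E A k) = 1%E.
Proof.
move=> mA muA; rewrite measure_bigcup; [|by move=> k _; exact: mE|exact: trivE].
have l0 : 0 <= lam * fine (mu A) by rewrite mulr_ge0 ?fine_ge0// ltW.
have := poisson_weight_gen l0 ler01; rewrite subrr mulr0 oppr0 expR0 => <-.
under eq_eseriesl do rewrite in_setT.
apply: eq_eseriesr => k _; rewrite expr1n mul1r; exact: PE.
Qed.

Let integral_split (D : set Omega) (f : Omega -> R) A : measurable D ->
  measurable_fun setT f -> (forall w, 0 <= f w) ->
  measurable A -> (mu A < +oo)%E ->
  (\int[P]_(w in D) (f w)%:E = \sum_(k <oo) \int[P]_(w in D `&` E A k) (f w)%:E)%E.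
Proof.
move=> mD mf f0 mA muA.
have mfE : measurable_fun setT (EFin \o f) by exact/measurable_EFinP.
have mU : measurable (\bigcup_k E A k) by apply: bigcup_measurable => k _; exact: mE.
have PN : P (~` \bigcup_k E A k) = 0%E.
  by rewrite probability_setC// PE1// subee.
rewrite -{1}(setUIDK D (\bigcup_k E A k)) ge0_integral_setU//; last 5 first.
- exact: measurableI.
- exact: measurableD.
- exact: measurable_funTS.
- by move=> w _; rewrite lee_fin.
- by apply/disj_setPS => w [[_ +] [_]].
rewrite [X in (_ + X)%E](_ : _ = 0%E); last first.
  apply: null_set_integral; [exact: measurableD|exact: measurable_funTS|].
  apply/eqP; rewrite eq_le measure_ge0 andbT -PN; apply: le_measure.
  - by rewrite inE; exact: measurableD.
  - by rewrite inE; exact: measurableC.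
  - by move=> w [].
rewrite adde0 setI_bigcupr ge0_integral_bigcup//.
- by move=> k; apply: measurableI => //; exact: mE.
- exact: measurable_funTS.
- by move=> w _; rewrite lee_fin.
- exact: trivIset_setIl.
Qed.

Let fin_bigcap_ord r (S : set 'I_r) (F : 'I_r -> set Omega) :
  (forall i, measurable (F i)) -> measurable (\bigcap_(i in S) F i).
Proof. by move=> mF; apply: fin_bigcap_measurable. Qed.

Let prodL01 r (p : pred 'I_r) (f : 'I_r -> 'rV[R]_q -> R) w :
  (forall i x, 0 <= f i x <= 1) -> 0 <= \prod_(i | p i) L (f i) w <= 1.
Proof.
move=> f01; rewrite prodr_ge0/=.
  by apply: prodr_ile1 => i _; exact: L01.
by move=> i _; case/andP: (L01 w (f01 i)).
Qed.

(** Joint generating function of the counts on disjoint sets, reached by interpolation: the sets of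
    index below [j] enter through z^count, the others through a prescribed count. j = 0 is the
    independence of counts, j = r the full generating function. *)
Let claim r (A : 'I_r -> set 'rV[R]_q) (z : 'I_r -> R) :
  (forall i, measurable (A i)) -> (forall i, mu (A i) < +oo)%E -> trivIset setT A ->
  (forall i, 0 <= z i <= 1) ->
  forall j, (j <= r)%N -> forall k : 'I_r -> nat,
  (\int[P]_(w in \bigcap_(i in [set i : 'I_r | (j <= i)%N]) E (A i) (k i))
     (\prod_(i < r | (i < j)%N) L (step (z i) (A i)) w)%:E =
   (\prod_(i < r | (i < j)%N) expR (- (lam * fine (mu (A i)) * (1 - z i))) *
    \prod_(i < r | (j <= i)%N) poisson_weight (lam * fine (mu (A i))) (k i))%:E)%E.
Proof.
move=> mA muA tA z01.
have s01 i x := step01 (A i) (z01 i) x.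
have mprod j : measurable_fun setT (fun w => \prod_(i < r | (i < j)%N) L (step (z i) (A i)) w).
  elim: (index_enum _) => [|i s IH].
    by under eq_fun do rewrite big_nil; exact: measurable_cst.
  under eq_fun do rewrite big_cons.
  case: (i < j)%N => //; apply: measurable_funM => //; apply: mL => //; exact: mstep.
elim => [|j IH] jr k.
  under eq_integral do rewrite big_pred0//.
  rewrite integral_cst ?mul1e; last by apply: fin_bigcap_ord => i; exact: mE.
  rewrite big_pred0// mul1r (_ : \bigcap_(_ in _) _ = [set w | forall i, E (A i) (k i) w]).
    rewrite [LHS](indE k mA tA); congr EFin; apply: eq_bigr => i _.
    by rewrite PE.
  by apply/seteqP; split => w H i; [exact: H|move=> _; exact: H].
pose j0 := Ordinal jr.
have l0 : 0 <= lam * fine (mu (A j0)) by rewrite mulr_ge0 ?fine_ge0// ltW.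
have mD : measurable (\bigcap_(i in [set i : 'I_r | (j < i)%N]) E (A i) (k i)).
  by apply: fin_bigcap_ord => i; exact: mE.
(* Split according to the number [l] of points in [A j0]; there [L] is z^l, and the sum over [l] is
   a Poisson generating function. *)
rewrite (@integral_split _ _ (A j0))//; last first.
  by move=> w; case/andP: (prodL01 (fun i : 'I_r => (i < j.+1)%N) w s01).
pose kl l i := if i == j0 then l else k i.
have jpred (p : 'I_r -> R) : \prod_(i < r | (i < j.+1)%N) p i =
    p j0 * \prod_(i < r | (i < j)%N) p i.
  rewrite (bigD1 j0)//=; congr (_ * _); apply: eq_bigl => i.
  by rewrite ltnS ltn_neqAle andbC.
have jpred2 (p : 'I_r -> R) : \prod_(i < r | (j <= i)%N) p i =
    p j0 * \prod_(i < r | (j < i)%N) p i.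
  rewrite (bigD1 j0)//=; congr (_ * _); apply: eq_bigl => i.
  by rewrite ltn_neqAle eq_sym andbC.
transitivity (\sum_(l <oo) (((\prod_(i < r | (i < j)%N) expR (- (lam * fine (mu (A i)) * (1 - z i)))) *
    (\prod_(i < r | (j < i)%N) poisson_weight (lam * fine (mu (A i))) (k i)))%:E *
    (z j0 ^+ l * poisson_weight (lam * fine (mu (A j0))) l)%:E))%E; last first.
  rewrite nneseriesZl; last first.
    move=> l _; rewrite lee_fin mulr_ge0 ?poisson_weight_ge0 ?exprn_ge0//.
    by case/andP: (z01 j0).
  rewrite poisson_weight_gen//; last by case/andP: (z01 j0).
  by rewrite -EFinM; congr EFin; rewrite jpred; ring.
apply: eq_eseriesr => l _.
have -> : \bigcap_(i in [set i : 'I_r | (j < i)%N]) E (A i) (k i) `&` E (A j0) l =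
    \bigcap_(i in [set i : 'I_r | (j <= i)%N]) E (A i) (kl l i).
  apply/seteqP; split => [w [H Hl] i /= ji|w H].
    rewrite /kl; case: eqVneq => [->//|ij]; apply: H => /=.
    by rewrite ltn_neqAle ji andbT; apply: contra_neq ij => ij; exact/val_inj.
  split; last by have := H j0 (leqnn j); rewrite /kl eqxx.
  move=> i /= ji; have := H i (ltnW ji); rewrite /kl.
  by case: eqVneq ji => [->|//]; rewrite ltnn.
have := IH (ltnW jr) (kl l).
rewrite jpred2 (_ : kl l j0 = l); last by rewrite /kl eqxx.
rewrite [X in _ = (_ * (_ * X))%:E -> _](eq_bigr (fun i : 'I_r => poisson_weight (lam * fine (mu (A i))) (k i))); last first.
  by move=> i ji; rewrite /kl; case: eqVneq ji => [->|//]; rewrite ltnn.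
set I := (\int[P]_(w in _) _)%E => HI.
transitivity ((z j0 ^+ l)%:E * I)%E; last first.
  by rewrite HI -!EFinM; congr EFin; ring.
rewrite /I -ge0_integralZl//; last 4 first.
- by apply: fin_bigcap_ord => i; exact: mE.
- by apply: measurable_funTS; exact/measurable_EFinP.
- by move=> w _; rewrite lee_fin; case/andP: (prodL01 (fun i : 'I_r => (i < j)%N) w s01).
- by rewrite lee_fin exprn_ge0//; case/andP: (z01 j0).
apply: ae_eq_integral.
- by apply: fin_bigcap_ord => i; exact: mE.
- by apply: measurable_funTS; exact/measurable_EFinP.
- by apply: measurable_funTS; apply: measurable_funeM; exact/measurable_EFinP.
apply: filterS injX => w iw Dw; rewrite jpred -EFinM; congr (_ * _)%:E.
apply: LE => //; have := Dw j0 (leqnn j); rewrite /kl eqxx//.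
Qed.

Let compl01 (f : 'rV[R]_q -> R) : (forall x, 0 <= f x <= 1) ->
  forall x, 0 <= 1 - f x <= 1.
Proof. by move=> f01 x; have /andP[? ?] := f01 x; lra. Qed.

Let bounded_cvg (g : nat -> Omega -> R) (h : Omega -> R) :
  (forall m, measurable_fun setT (g m)) -> measurable_fun setT h ->
  (forall m w, 0 <= g m w <= 1) -> (forall w, g ^~ w @ \oo --> h w) ->
  (\int[P]_w (g m w)%:E @[m --> \oo] --> \int[P]_w (h w)%:E)%E.
Proof.
move=> mg mh g01 gh.
have [|||||_ _] := @dominated_convergence _ _ _ P setT measurableT
  (fun m w => (g m w)%:E) (fun w => (h w)%:E) (cst 1%E) => //.
- by move=> m; exact/measurable_EFinP.
- exact/measurable_EFinP.
- by apply: aeW => w _; apply: cvg_EFin; [exact: nearW|exact: gh].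
- exact: finite_measure_integrable_cst.
- apply: aeW => w m _; rewrite lee_fin ger0_norm; by case/andP: (g01 m w).
Qed.

Let pp_int01 (f : 'rV[R]_q -> R) m : measurable_fun setT f -> (forall x, 0 <= f x <= 1) ->
  (0 <= \int[P]_w (pp f m w)%:E <= 1)%E.
Proof.
move=> mf f01; apply/andP; split.
  by apply: integral_ge0 => w _; rewrite lee_fin; case/andP: (pp01 m w f01).
rewrite -[leRHS](_ : \int[P]_w (cst 1 w) = 1)%E; last first.
  by rewrite integral_cst// mul1e; exact: probability_setT.
apply: ge0_le_integral => //.
- by move=> w _; rewrite lee_fin; case/andP: (pp01 m w f01).
- by apply/measurable_EFinP; exact: mpp.
- by move=> w _; rewrite lee_fin; case/andP: (pp01 m w f01).
Qed.

Import HBNNSimple.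

(** 1 - f is the product, over the nonzero values y of f, of the step functions equal to 1 - y on
    the level set of y. The value 0 is left out because its level set may have infinite measure. *)
Lemma poisson_laplace_simple (f : {nnsfun 'rV[R]_q >-> R}) :
  (forall x, f x <= 1) -> (\int[mu]_x (f x)%:E < +oo)%E ->
  (\int[P]_w (\prod_(n < m) (1 - f (X n w)))%:E @[m --> \oo] -->
   (expR (- (lam * fine (\int[mu]_x (f x)%:E))))%:E)%E.
Proof.
move=> f1 fint.
have f01 x : 0 <= f x <= 1 by rewrite f1 andbT.
have finR : finite_set (range f) by [].
pose s := [seq y <- (fset_set (range f) : seq R) | y != 0].
have us : uniq s by exact/filter_uniq/fset_uniq.
have ms x : f x != 0 -> f x \in s.
  by move=> fx0; rewrite mem_filter fx0/= in_fset_set// inE; exists x.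
pose r := size s; pose y (i : 'I_r) := s`_i.
have yinj : injective y.
  by move=> i j /eqP; rewrite nth_uniq// => /eqP; exact: val_inj.
have y01 i : 0 < y i <= 1.
  have : y i \in s by exact: mem_nth.
  rewrite mem_filter => /andP[yi0]; rewrite in_fset_set// inE => -[x _ xi].
  by rewrite lt_neqAle eq_sym yi0 -xi f1 andbT/=.
pose A (i : 'I_r) := f @^-1` [set y i].
have mf : measurable_fun setT f by [].
have mA i : measurable (A i) by exact: (measurable_preimage mf (measurable_set1 (y i))).
have tA : trivIset setT A.
  apply/trivIsetP => i j _ _ ij; apply/seteqP; split => // x [] /= xi xj.
  have /yinj ji : y i = y j by rewrite -xi -xj.
  by rewrite ji eqxx in ij.
have fE x : f x = \sum_(i < r) y i * \1_(A i) x.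
  have [fx0|/ms/(nthP 0)[k kr fxk]] := eqVneq (f x) 0.
    rewrite big1 ?fx0// => i _; rewrite indicE memNset ?mulr0//= /A/= fx0 => y0.
    by have := y01 i; rewrite -y0 ltxx.
  rewrite (bigD1 (Ordinal kr))//= indicE mem_set ?mulr1; last by rewrite /A/= -fxk.
  rewrite [y _]fxk big1 ?addr0// => i ik; rewrite indicE memNset ?mulr0// /A/= -fxk.
  by move=> /(@yinj (Ordinal kr)) ki; rewrite ki eqxx in ik.
have prodE x : 1 - f x = \prod_(i < r) step (1 - y i) (A i) x.
  have [fx0|/ms/(nthP 0)[k kr fxk]] := eqVneq (f x) 0.
    rewrite big1 ?fx0 ?subr0// => i _; rewrite /step memNset//= /A/= fx0 => y0.
    by have := y01 i; rewrite -y0 ltxx.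
  rewrite (bigD1 (Ordinal kr))//= {1}/step mem_set; last by rewrite /A/= -fxk.
  rewrite [y _]fxk big1 ?mulr1// => i ik; rewrite /step memNset// /A/= -fxk.
  by move=> /(@yinj (Ordinal kr)) ki; rewrite ki eqxx in ik.
have intf : (\int[mu]_x (f x)%:E = \sum_(i < r) (y i)%:E * mu (A i))%E.
  under eq_integral do rewrite fE -sumEFin.
  rewrite ge0_integral_sum//=.
  - apply: eq_bigr => i _; under eq_integral do rewrite EFinM.
    rewrite ge0_integralZl//; last 2 first.
    + by apply/measurable_EFinP; exact: measurable_indic.
    + by rewrite lee_fin; have /andP[/ltW] := y01 i.
    by rewrite integral_indic// setIT.
  - move=> i; apply/measurable_EFinP; apply: measurable_funM => //.
  - by move=> i x _; rewrite lee_fin mulr_ge0//; have /andP[/ltW] := y01 i.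
(* A level set of infinite measure with a positive value would make the integral of [f] infinite. *)
have muA i : (mu (A i) < +oo)%E.
  move: fint; rewrite intf; apply: contraTT; rewrite -!leNgt !leye_eq => /eqP muAi.
  rewrite (bigD1 i)//= muAi gt0_muley ?lte_fin; last by have /andP[] := y01 i.
  rewrite addye//; rewrite gt_eqF// (lt_le_trans (@ltNy0 R))//.
  apply: sume_ge0 => j _; rewrite mule_ge0// lee_fin; by have /andP[/ltW] := y01 j.
have z01 i : 0 <= 1 - y i <= 1 by have /andP[? ?] := y01 i; lra.
have := claim mA muA tA z01 (leqnn r) (fun=> 0%N).
rewrite (_ : \bigcap_(_ in _) _ = setT); last first.
  apply/seteqP; split => // w _ i /=; by rewrite leqNgt ltn_ord.
rewrite [X in (_ * X)%:E]big_pred0; last by move=> i; rewrite leqNgt ltn_ord.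
rewrite mulr1 -expR_sum (_ : \sum_(i < r | _) _ = - (lam * fine (\int[mu]_x (f x)%:E))); last first.
  rewrite intf -sum_fine; last by move=> i _; rewrite fin_numM// ge0_fin_numE.
  rewrite mulr_sumr -sumrN; apply: eq_big => [i|i _]; first by rewrite ltn_ord.
  rewrite fineM//=; last by rewrite ge0_fin_numE.
  by rewrite subKr -mulrA [_ * y i]mulrC.
under eq_integral do under eq_bigl do rewrite ltn_ord.
move=> <-.
have m1f : measurable_fun setT (fun x => 1 - f x) by exact: measurable_funB.
have s01 i x := step01 (A i) (z01 i) x.
apply: (@bounded_cvg (pp (fun x => 1 - f x))).
- by move=> m; exact: mpp.
- rewrite -[X in measurable_fun _ X]/(fun w => \prod_(i < r) L (step (1 - y i) (A i)) w).
  elim: (index_enum _) => [|i t IH].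
    by under eq_fun do rewrite big_nil; exact: measurable_cst.
  under eq_fun do rewrite big_cons.
  by apply: measurable_funM => //; apply: mL => //; exact: mstep.
- by move=> m w; apply: pp01; exact: compl01.
- move=> w; rewrite (_ : (fun m => _) = fun m => \prod_(i < r) pp (step (1 - y i) (A i)) m w).
    elim: (index_enum _) => [|i t IH].
      by under eq_fun do rewrite big_nil; rewrite big_nil; exact: cvg_cst.
    under eq_fun do rewrite big_cons; rewrite big_cons.
    by apply: cvgM => //; exact: cvg_pp.
  apply/funext => m; rewrite /pp exchange_big/=; apply: eq_bigr => n _.
  exact: prodE.
Qed.

(** Approximation from below by simple functions [f j]. The limits in [j] and [m] are exchanged by
    monotonicity, since [e g m] decreases in both [g] and [m]: the limiting value bounds every
    [e s m] from below, and [e s m <= e (f j) m] bounds it from above. *)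
Lemma poisson_laplace (s : 'rV[R]_q -> R) : measurable_fun setT s ->
  (forall x, 0 <= s x <= 1) -> (\int[mu]_x (s x)%:E < +oo)%E ->
  (\int[P]_w (\prod_(n < m) (1 - s (X n w)))%:E @[m --> \oo] -->
   (expR (- (lam * fine (\int[mu]_x (s x)%:E))))%:E)%E.
Proof.
move=> ms s01 sint.
have msE : measurable_fun setT (EFin \o s) by exact/measurable_EFinP.
pose f := nnsfun_approx measurableT msE.
have s0 x : (0 <= (s x)%:E)%E by rewrite lee_fin; case/andP: (s01 x).
have fcvg x : f j x @[j --> \oo] --> s x.
  have /fine_cvgP[_] : ((f j x)%:E @[j --> \oo] --> (s x)%:E)%E.
    exact: (cvg_nnsfun_approx measurableT msE (fun x _ => s0 x)).
  exact.
have fnd x : {homo (f ^~ x) : i j / (i <= j)%N >-> i <= j}.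
  by move=> i j ij; exact/lefP/nd_nnsfun_approx.
have fs j x : f j x <= s x.
  rewrite -(cvg_lim _ (fcvg x))//; apply: nondecreasing_cvgn_le => //.
  by apply/cvg_ex; exists (s x).
have f01 j x : 0 <= f j x <= 1.
  by rewrite fun_ge0/= (le_trans (fs j x))//; case/andP: (s01 x).
have mf j : measurable_fun setT (f j) by [].
pose I j := (\int[mu]_x (f j x)%:E)%E; pose J := (\int[mu]_x (s x)%:E)%E.
have J0 : (0 <= J)%E by apply: integral_ge0.
have I0 j : (0 <= I j)%E by apply: integral_ge0 => x _; rewrite lee_fin.
have IJ j : (I j <= J)%E.
  apply: ge0_le_integral => //.
  - by move=> x _; rewrite lee_fin.
  - exact/measurable_EFinP.
  - by move=> x _; rewrite lee_fin.
have Ioo j : (I j < +oo)%E by exact: le_lt_trans (IJ j) sint.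
have IcJ : fine (I j) @[j --> \oo] --> fine J.
  apply: fine_cvg; rewrite fineK ?ge0_fin_numE//.
  have := @cvg_monotone_convergence _ _ _ mu setT measurableT (fun j x => (f j x)%:E).
  rewrite (_ : (\int[mu]_(x in setT) _)%E = J).
    apply; [by move=> j; exact/measurable_EFinP | by move=> j x _; rewrite lee_fin|].
    by move=> x _ i j ij; rewrite lee_fin; exact: fnd.
  apply: eq_integral => x _; apply/cvg_lim => //.
  by apply: cvg_EFin; [exact: nearW|exact: fcvg].
pose e g m := fine (\int[P]_w (pp (fun x => 1 - g x) m w)%:E).
have efin (g : 'rV[R]_q -> R) m : measurable_fun setT g -> (forall x, 0 <= g x <= 1) ->
    (\int[P]_w (pp (fun x => 1 - g x) m w)%:E)%E = (e g m)%:E.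
  move=> mg g01; rewrite fineK//.
  have := @pp_int01 (fun x => 1 - g x) m (measurable_funB (measurable_cst _) mg) (compl01 g01).
  move=> /andP[h0 h1]; rewrite ge0_fin_numE//; exact: le_lt_trans h1 (ltry 1).
have e_le (g h : 'rV[R]_q -> R) m m' : measurable_fun setT g -> (forall x, 0 <= g x <= 1) ->
    measurable_fun setT h -> (forall x, 0 <= h x <= 1) ->
    (forall x, g x <= h x) -> (m <= m')%N -> e h m' <= e g m.
  move=> mg g01 mh h01 gh mm'; rewrite -lee_fin -!efin//.
  have m1g : measurable_fun setT (fun x => 1 - g x) by exact: measurable_funB.
  have m1h : measurable_fun setT (fun x => 1 - h x) by exact: measurable_funB.
  apply: ge0_le_integral => //.
  - by move=> w _; rewrite lee_fin; case/andP: (pp01 m' w (compl01 h01)).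
  - by apply/measurable_EFinP; exact: mpp.
  - by apply/measurable_EFinP; exact: mpp.
  move=> w _; rewrite lee_fin (le_trans (_ : _ <= pp (fun x => 1 - h x) m w))//.
    rewrite /pp -(subnKC mm') big_split_ord/= ler_piMr//.
      by case/andP: (pp01 m w (compl01 h01)).
    by apply: prodr_ile1 => i _; exact: compl01.
  apply: ler_prod => i _; case/andP: (compl01 h01 (X i w)) => -> _ /=.
  by rewrite lerB.
have ej j : e (f j) m @[m --> \oo] --> expR (- (lam * fine (I j))).
  have f1 x : f j x <= 1 by case/andP: (f01 j x).
  have := @poisson_laplace_simple (f j) f1 (Ioo j).
  by move=> /fine_cvgP[_].
have em m : e (f j) m @[j --> \oo] --> e s m.
  apply: fine_cvg; rewrite -efin//.
  have m1s : measurable_fun setT (fun x => 1 - s x) by exact: measurable_funB.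
  have m1f j : measurable_fun setT (fun x => 1 - f j x) by exact: measurable_funB.
  apply: (@bounded_cvg (fun j => pp (fun x => 1 - f j x) m)).
  - by move=> j; exact: mpp.
  - exact: mpp.
  - by move=> j w; apply: pp01; exact: compl01.
  - move=> w; rewrite /pp; elim: (index_enum _) => [|i t IH].
      by under eq_fun do rewrite big_nil; rewrite big_nil; exact: cvg_cst.
    under eq_fun do rewrite big_cons; rewrite big_cons.
    by apply: cvgM => //; apply: cvgB; [exact: cvg_cst|exact: fcvg].
have ejm j m : expR (- (lam * fine (I j))) <= e (f j) m.
  rewrite -(cvg_lim _ (ej j))//; apply: limr_le; first by apply/cvg_ex; eexists; exact: ej.
  by exists m => // m' /= mm'; apply: e_le.
have Jem m : expR (- (lam * fine J)) <= e s m.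
  rewrite -(cvg_lim _ (em m))//; apply: limr_ge; first by apply/cvg_ex; eexists; exact: em.
  apply: nearW => j; apply: le_trans (ejm j m).
  rewrite ler_expR lerN2; apply: ler_wpM2l; first exact: ltW.
  by apply: fine_le; rewrite ?ge0_fin_numE.
have aJ : expR (- (lam * fine (I j))) @[j --> \oo] --> expR (- (lam * fine J)).
  apply: continuous_cvg; first exact: continuous_expR.
  by apply: cvgN; apply: cvgMr.
suff : e s m @[m --> \oo] --> expR (- (lam * fine J)).
  rewrite (_ : (fun m => _) = fun m => (e s m)%:E).
    by move=> h; apply: cvg_EFin; [exact: nearW|exact: h].
  by apply/funext => m; exact: efin.
apply/cvgrPdist_le => eps eps0.
have [j aj] : exists j, expR (- (lam * fine (I j))) <= expR (- (lam * fine J)) + eps / 2.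
  have /cvgrPdist_le/(_ (eps / 2))[|j _ /(_ j (leqnn j))] := aJ; first by rewrite divr_gt0.
  by rewrite distrC ler_distl => /andP[_ ?]; exists j.
have /cvgrPdist_le/(_ (eps / 2))[|M _ HM] := ej j; first by rewrite divr_gt0.
exists M => // m /HM /=; rewrite distrC ler_distl => /andP[_ h].
rewrite distrC ger0_norm ?subr_ge0// lerBlDl.
have := e_le (f j) s m m (mf j) (f01 j) ms s01 (fs j) (leqnn m); lra.
Qed.

End poisson_laplace.

(* X enumerates a Poisson process of intensity lam * mu, and the marks Y are
   independent of X, with independent components of law Q. *)
Record marked_poisson (R : realType) (q : nat) d (Omega : measurableType d)
    (P : probability Omega R) (mu : set 'rV[R]_q -> \bar R) (lam : R)
    (Q : set 'rV[R]_q -> \bar R) (X Y : nat -> Omega -> 'rV[R]_q) : Prop := {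
  mp_gt0 : 0 < lam ;
  mp_mX : forall n, measurable_fun setT (X n) ;
  mp_mY : forall n, measurable_fun setT (Y n) ;
  mp_inj : {ae P, forall w, injective (X ^~ w)} ;
  mp_mcount : forall A k, measurable A -> measurable
    [set w | counting (range (X ^~ w) `&` A) = k%:R%:E :> \bar R] ;
  mp_count : forall A k, measurable A -> (mu A < +oo)%E ->
    P [set w | counting (range (X ^~ w) `&` A) = k%:R%:E :> \bar R] =
    (poisson_weight (lam * fine (mu A)) k)%:E ;
  mp_indep_count : forall r (A : 'I_r -> set 'rV[R]_q) (k : 'I_r -> nat),
    (forall i, measurable (A i)) -> trivIset setT A ->
    P [set w | forall i,
        counting (range (X ^~ w) `&` A i) = (k i)%:R%:E :> \bar R] =
    (\prod_(i < r) fine (P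
      [set w | counting (range (X ^~ w) `&` A i) = (k i)%:R%:E :> \bar R]))%:E ;
  mp_indep_marks : forall m (A B : nat -> set 'rV[R]_q),
    (forall n, measurable (A n)) -> (forall n, measurable (B n)) ->
    P (\bigcap_(n < m) (X n @^-1` A n `&` Y n @^-1` B n)) =
    (P (\bigcap_(n < m) X n @^-1` A n) * (\prod_(n < m) fine (Q (B n)))%:E)%E
}.

Section marked_poisson_theory.
Context {R : realType} {q : nat} d (Omega : measurableType d).
Variables (P : probability Omega R) (mu : {sigma_finite_measure set 'rV[R]_q -> \bar R}).
Variables (lam : R) (Q : probability 'rV[R]_q R) (X Y : nat -> Omega -> 'rV[R]_q).
Hypothesis mp : marked_poisson P mu lam Q X Y.
Variable T : set ('rV[R]_q * 'rV[R]_q).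
Hypothesis mT : measurable T.
Hypothesis Tfin : ((mu \x Q) T < +oo)%E.

Let nu := lam * fine ((mu \x Q)%E T).

Let nu0 : 0 <= nu.
Proof. by rewrite mulr_ge0 ?fine_ge0// ltW// (mp_gt0 mp). Qed.

Let mXY n : measurable_fun setT (fun w => (X n w, Y n w)).
Proof. exact: measurable_fun_pair (mp_mX mp n) (mp_mY mp n). Qed.

(** Integrating out the marks turns 1 - z 1_T(X, Y) into 1 - z Q(T_X), to which the Laplace
    functional of the unmarked process applies. *)
Lemma marked_laplace (z : R) : 0 <= z <= 1 ->
  (\int[P]_w (\prod_(n < m) (1 - z * \1_T (X n w, Y n w)))%:E @[m --> \oo] -->
   (expR (- (z * nu)))%:E)%E.
Proof.
move=> /andP[z0 z1].
pose s x := z * fine (Q (xsection T x)).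
have mQ : measurable_fun setT (fun x => Q (xsection T x)) by exact: measurable_fun_xsection.
have finQ x : Q (xsection T x) \is a fin_num by apply: fin_num_measure; exact: measurable_xsection.
have ms : measurable_fun setT s by apply: measurable_funM => //; exact: measurableT_comp mQ.
have s01 x : 0 <= s x <= 1.
  rewrite /s mulr_ge0 ?fine_ge0//= mulr_ile1 ?fine_ge0// -lee_fin fineK//.
  by apply: probability_le1; exact: measurable_xsection.
have sint : (\int[mu]_x (s x)%:E = z%:E * (mu \x Q) T)%E.
  rewrite -ge0_integralZl//; first by apply: eq_integral => x _; rewrite EFinM fineK.
have sfin : (\int[mu]_x (s x)%:E < +oo)%E.
  by rewrite sint lte_mul_pinfty.
have -> : z * nu = lam * fine (\int[mu]_x (s x)%:E)%E.
  by rewrite sint fineM// ?ge0_fin_numE// mulrCA.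
have := poisson_laplace (mp_gt0 mp) (mp_mX mp) (mp_inj mp) (mp_mcount mp) (mp_count mp)
  (mp_indep_count mp) ms s01 sfin.
rewrite (_ : (fun m => _) = (fun m => \int[P]_w (\prod_(n < m) (1 - z * \1_T (X n w, Y n w)))%:E)%E)//.
apply/funext => m.
(* Written with the complement of [T], the factors have the nonnegative coefficients 1 - z and z
   required by [integrate_out_prod]. *)
transitivity (\int[P]_w (\prod_(n < m) (1 - z + z * fine (Q (xsection (~` T) (X n w)))))%:E)%E.
  apply: eq_integral => w _; congr EFin; apply: eq_bigr => n _.
  have -> : xsection (~` T) (X n w) = ~` xsection T (X n w).
    by apply/seteqP; split => y; rewrite /xsection/= !inE.
  rewrite probability_setC; last exact: measurable_xsection.
  by rewrite fineB//= /s; ring.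
transitivity (\int[P]_w (\prod_(n < m) (1 - z + z * \1_(~` T) (X n w, Y n w)))%:E)%E.
  apply/esym; apply: (@integrate_out_prod _ _ _ _ _ _ _ P Q X Y m (fun=> 1 - z) (fun=> z) (fun=> ~` T)).
  - exact: mp_mX mp.
  - exact: mp_mY mp.
  - by move=> A B mA mB; exact: (mp_indep_marks mp).
  - by move=> _; rewrite subr_ge0.
  - by [].
  - by move=> _; rewrite subrK.
  - by move=> _; exact: measurableC.
apply: eq_integral => w _; congr EFin; apply: eq_bigr => n _.
rewrite !indicE in_setC; case: (_ \in T); rewrite /=; ring.
Qed.

Let C m := \bigcap_(n < m) [set w | ~ T (X n w, Y n w)].
Let D m := [set w | exists i j, [/\ (i < j < m)%N, T (X i w, Y i w) & T (X j w, Y j w)]].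

Let mTn n : measurable [set w | T (X n w, Y n w)].
Proof. exact: (measurable_preimage (mXY n) mT). Qed.

Let mC m : measurable (C m).
Proof.
by apply: bigcap_measurableType => n _; apply: (@measurableC _ _ [set w | T (X n w, Y n w)]).
Qed.

Let mD m : measurable (D m).
Proof.
rewrite (_ : D m = \bigcup_i \bigcup_(j in [set j | (i < j < m)%N])
    ([set w | T (X i w, Y i w)] `&` [set w | T (X j w, Y j w)])).
  apply: bigcupT_measurable => i; apply: bigcup_measurable => j _.
  exact: measurableI.
apply/seteqP; split => [w [i [j [ij Ti Tj]]]|w [i _ [j ij [Ti Tj]]]].
  by exists i => //; exists j.
by exists i, j.
Qed.

Lemma marked_void :
  P [set w | forall n, ~ T (X n w, Y n w)] = (expR (- nu))%:E.
Proof.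
have := @marked_laplace 1; rewrite ler01 lexx mul1r => /(_ isT) h.
have -> : [set w | forall n, ~ T (X n w, Y n w)] = \bigcap_m C m.
  apply/seteqP; split => [w H m _ n _|w H n]; first exact: H.
  exact: (H n.+1 I n (ltnSn n)).
have : P (C m) @[m --> \oo] --> P (\bigcap_m C m).
  apply: nonincreasing_cvg_mu.
  - by rewrite (le_lt_trans (probability_le1 P (mC 0)))// ltry.
  - exact: mC.
  - exact: (bigcapT_measurable mC).
  - move=> m n mn; apply/subsetPset => w H k /= km; apply: H => /=.
    exact: leq_trans mn.
move/(cvg_unique (@ereal_hausdorff R)); apply.
rewrite (_ : (fun m => P (C m)) = (fun m => \int[P]_w (\prod_(n < m) (1 - 1 * \1_T (X n w, Y n w)))%:E)%E)//.
apply/funext => m; rewrite -[in LHS](setIT (C m)) -integral_indic//.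
apply: eq_integral => w _; congr EFin; rewrite indicE.
have [|] := boolP (w \in C m).
  rewrite inE => Cw; rewrite big1// => n _.
  by rewrite indicE memNset ?mulr0 ?subr0//; exact: (Cw n (ltn_ord n)).
rewrite notin_setE => /existsNP[n /not_implyP[nm /contrapT Tn]].
by rewrite (bigD1 (Ordinal nm))//= indicE mem_set// mulr1 subrr mul0r.
Qed.

(* Comparing the Laplace transform at [z = 1/2] with the void probability
   detects the event [D] that two points fall into [T]. *)
Let pointwise m w : \prod_(n < m) (1 - 2^-1 * \1_T (X n w, Y n w)) <=
  2^-1 + 2^-1 * \1_(C m) w - 4^-1 * \1_(D m) w :> R.
Proof.
have f01 n : 0 <= 1 - 2^-1 * (\1_T (X n w, Y n w) : R) <= 1.
  by rewrite indicE; case: (_ \in T); rewrite /=; lra.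
have rest (p : pred 'I_m) : 0 <= \prod_(n < m | p n) (1 - 2^-1 * (\1_T (X n w, Y n w) : R)) <= 1.
  rewrite prodr_ge0/=; last by move=> i _; case/andP: (f01 i).
  by apply: prodr_ile1 => i _; exact: f01.
have half n : T (X n w, Y n w) -> 1 - 2^-1 * \1_T (X n w, Y n w) = 2^-1 :> R.
  by move=> Tn; rewrite indicE mem_set//=; lra.
have [Cw|] := pselect (C m w).
  rewrite big1; last by move=> n _; rewrite indicE memNset ?mulr0 ?subr0//; exact: (Cw n (ltn_ord n)).
  rewrite !indicE mem_set// memNset/=; first lra.
  by move=> [i [j [/andP[ij jm] Ti _]]]; apply: (Cw i (ltn_trans ij jm)).
move=> Cw; rewrite [\1_(C m) w]indicE memNset//.
have [|Dw] := pselect (D m w).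
  move=> /[dup] Dw [i [j [/andP[ij jm] Ti Tj]]]; rewrite indicE mem_set//=.
  rewrite (bigD1 (Ordinal jm))//= (bigD1 (Ordinal (ltn_trans ij jm)))/=; last first.
    by apply/eqP => -[ji]; rewrite ji ltnn in ij.
  rewrite !half//; set r := \prod_(_ < _ | _) _.
  have /andP[r0 r1] : 0 <= r <= 1 by exact: rest.
  lra.
rewrite indicE memNset//=.
move/existsNP: Cw => [n /not_implyP[nm /contrapT Tn]].
rewrite (bigD1 (Ordinal nm))//= half//; set r := \prod_(_ < _ | _) _.
have /andP[r0 r1] : 0 <= r <= 1 by exact: rest.
lra.
Qed.

Lemma marked_two :
  (P [set w | exists i j, [/\ i <> j, T (X i w, Y i w) & T (X j w, Y j w)]] <=
   (nu ^+ 2 / 2)%:E)%E.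
Proof.
have -> : [set w | exists i j, [/\ i <> j, T (X i w, Y i w) & T (X j w, Y j w)]] =
    \bigcup_m D m.
  apply/seteqP; split => [w [i [j [ij Ti Tj]]]|w [m _ [i [j [/andP[ij jm] Ti Tj]]]]].
    have [ltij|ltji|//] := ltngtP i j.
      by exists j.+1 => //; exists i, j; rewrite ltij ltnSn.
    by exists i.+1 => //; exists j, i; rewrite ltji ltnSn.
  by exists i, j; split => // e; rewrite e ltnn in ij.
have cD : P (D m) @[m --> \oo] --> P (\bigcup_m D m).
  apply: nondecreasing_cvg_mu; [exact: mD|exact: (bigcup_measurable (fun k _ => mD k))|].
  move=> m n mn; apply/subsetPset => w [i [j [/andP[ij jm] Ti Tj]]].
  by exists i, j; rewrite ij (leq_trans jm).
have cC : P (C m) @[m --> \oo] --> (expR (- nu))%:E.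
  have -> : (expR (- nu))%:E = P (\bigcap_m C m).
    rewrite -marked_void; congr (P _).
    apply/seteqP; split => [w H m _ n _|w H n]; first exact: H.
    exact: (H n.+1 I n (ltnSn n)).
  apply: nonincreasing_cvg_mu.
  - by rewrite (le_lt_trans (probability_le1 P (mC 0)))// ltry.
  - exact: mC.
  - exact: (bigcapT_measurable mC).
  - move=> m n mn; apply/subsetPset => w H k /= km; apply: H => /=.
    exact: leq_trans mn.
have cE : (\int[P]_w (\prod_(n < m) (1 - 2^-1 * \1_T (X n w, Y n w)))%:E @[m --> \oo] -->
   (expR (- (2^-1 * nu)))%:E)%E by apply: marked_laplace; lra.
have finP (A : set Omega) : measurable A -> P A = (fine (P A))%:E.
  by move=> mA; rewrite fineK// fin_num_measure.
have ineq m : (\int[P]_w (\prod_(n < m) (1 - 2^-1 * \1_T (X n w, Y n w)))%:E +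
    (4^-1)%:E * P (D m) <= (2^-1)%:E + (2^-1)%:E * P (C m))%E.
  have f0 w : 0 <= \prod_(n < m) (1 - 2^-1 * \1_T (X n w, Y n w)) :> R.
    by apply: prodr_ge0 => n _; rewrite indicE; case: (_ \in T); rewrite /=; lra.
  have mf : measurable_fun setT (fun w => \prod_(n < m) (1 - 2^-1 * \1_T (X n w, Y n w)) : R).
    elim: (index_enum _) => [|n t IH].
      by under eq_fun do rewrite big_nil; exact: measurable_cst.
    under eq_fun do rewrite big_cons.
    apply: measurable_funM => //; apply: measurable_funB => //; apply: measurable_funM => //.
    by apply: (measurableT_comp _ (mXY n)); exact: measurable_indic.
  have -> : ((4^-1)%:E * P (D m) = \int[P]_w (4^-1 * \1_(D m) w)%:E)%E.
    under eq_integral do rewrite EFinM.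
    rewrite ge0_integralZl ?integral_indic ?setIT//.
    by apply/measurable_EFinP; exact: measurable_indic.
  have -> : ((2^-1)%:E + (2^-1)%:E * P (C m) = \int[P]_w (2^-1 + 2^-1 * \1_(C m) w)%:E)%E.
    under eq_integral do rewrite EFinD EFinM.
    have mind : measurable_fun setT (fun w => (\1_(C m) w : R)%:E).
      by apply/measurable_EFinP; exact: measurable_indic.
    rewrite ge0_integralD//; last by apply: measurable_funeM.
    rewrite integral_cst// ge0_integralZl ?integral_indic ?setIT//.
    by congr (_ + _)%E; rewrite -[LHS]mule1; congr (_ * _)%E; apply/esym; exact: probability_setT.
  have mind : measurable_fun setT (fun w => 4^-1 * (\1_(D m) w : R)).
    by apply: measurable_funM => //; exact: measurable_indic.
  rewrite -ge0_integralD//; try by [exact/measurable_EFinP|move=> w _; rewrite lee_fin ?mulr_ge0].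
  apply: ge0_le_integral => //.
  - by move=> w _; rewrite -EFinD lee_fin addr_ge0// mulr_ge0.
  - by apply/measurable_EFinP; apply: measurable_funD.
  - apply/measurable_EFinP; apply: measurable_funD => //; apply: measurable_funM => //.
  - move=> w _; rewrite -EFinD lee_fin.
    have := pointwise m w; lra.
have lim_ineq : (4^-1 * fine (P (\bigcup_m D m)) <= 2^-1 + 2^-1 * expR (- nu) - expR (- (2^-1 * nu))).
  have fD : fine (P (D m)) @[m --> \oo] --> fine (P (\bigcup_m D m)).
    by apply: fine_cvg; rewrite -finP//; exact: (bigcup_measurable (fun k _ => mD k)).
  pose c m := fine (P (C m)).
  pose e m := fine (\int[P]_w (\prod_(n < m) (1 - 2^-1 * \1_T (X n w, Y n w)))%:E)%E.
  have fC : c m @[m --> \oo] --> expR (- nu) by exact: fine_cvg.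
  have fE : e m @[m --> \oo] --> expR (- (2^-1 * nu)) by exact: fine_cvg.
  have r1 : 2^-1 + 2^-1 * c m - e m @[m --> \oo] -->
      2^-1 + 2^-1 * expR (- nu) - expR (- (2^-1 * nu)).
    apply: cvgB => //; apply: cvgD; first exact: cvg_cst.
    exact: cvgMr.
  have r2 : 4^-1 * fine (P (D m)) @[m --> \oo] --> 4^-1 * fine (P (\bigcup_m D m)).
    by apply: cvgMr.
  rewrite -(cvg_lim _ r1)// -(cvg_lim _ r2)//; apply: ler_lim.
  - by apply/cvg_ex; eexists; exact: r2.
  - by apply/cvg_ex; eexists; exact: r1.
  have /fine_cvgP[Efin _] := cE.
  near=> m; have := ineq m; rewrite /c /e.
  have Em : (\int[P]_w (\prod_(n < m) (1 - 2^-1 * \1_T (X n w, Y n w)))%:E)%E \is a fin_num by near: m.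
  rewrite (finP _ (mD m)) (finP _ (mC m)) -[X in (X + _ <= _)%E](fineK Em) -!EFinM -!EFinD lee_fin.
  lra.
rewrite finP; last exact: (bigcup_measurable (fun k _ => mD k)).
rewrite lee_fin.
(* With x = exp(- nu / 2) the bound reads P(D) / 4 <= (1 - x)^2 / 2, and 1 - x <= nu / 2 yields nu^2
   / 2. *)
have e2 : expR (- nu) = expR (- (2^-1 * nu)) ^+ 2.
  by rewrite -expRM_natl; congr expR; field.
have h1 : 1 - 2^-1 * nu <= expR (- (2^-1 * nu)) by exact: expR_ge1Dx.
have h2 : expR (- (2^-1 * nu)) <= 1 by rewrite -expR0 ler_expR oppr_le0 mulr_ge0.
move: lim_ineq; rewrite e2; set x := expR _ in h1 h2 *; nra.
Unshelve. all: by end_near. Qed.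

End marked_poisson_theory.

(** * Gauss-Poisson processes as marked Poisson processes *)

(** Nonnegative integrals are suprema over simple functions below the integrand, hence monotone for
    arbitrary functions. This serves for counts whose measurability is left open. *)
Lemma le_integral_ge0 d (T : measurableType d) (R : realType)
    (m : {measure set T -> \bar R}) (D : set T) (f g : T -> \bar R) :
  (forall x, D x -> 0 <= f x)%E -> (forall x, D x -> f x <= g x)%E ->
  (\int[m]_(x in D) f x <= \int[m]_(x in D) g x)%E.
Proof.
move=> f0 fg; rewrite !ge0_integralE//; last first.
  by move=> x Dx; exact: le_trans (f0 x Dx) (fg x Dx).
apply: le_ereal_sup => _ [h /= hf <-]; exists h => //= x.
apply: le_trans (hf x) _; rewrite !patchE; case: ifPn => //.
by rewrite inE => Dx; exact: fg.
Qed.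

Section counting_lemmas.
Context {R : realType} {T : choiceType}.
Implicit Types S A : set T.

Lemma counting_eqP S (k : nat) : counting S = k%:R%:E :> \bar R <->
  finite_set S /\ #|` fset_set S|%fset = k.
Proof.
rewrite /counting; split.
  by case: asboolP => // fS [] /(mulrIn (@oner_neq0 R)).
by case=> fS <-; rewrite asboolT.
Qed.

Lemma counting_eq0P S : counting S = 0%:R%:E :> \bar R <-> S = set0.
Proof.
rewrite counting_eqP; split=> [[fS /eqP]|->].
  by rewrite cardfs_eq0 => /eqP/fset_set_set0; exact.
by split; [exact: finite_set0 | rewrite fset_set0].
Qed.

Lemma counting_eq1P S : counting S = 1%:R%:E :> \bar R <-> exists x, S = [set x].
Proof.
rewrite counting_eqP; split=> [[fS /eqP/cardfs1P[x Sx]]|[x ->]].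
  by exists x; rewrite -(fset_setK fS) Sx set_fset1.
by split; [exact: finite_set1|rewrite fset_set1 cardfs1].
Qed.

End counting_lemmas.

Section second_point.
Context {R : realType} {q : nat}.
Implicit Types S A : set 'rV[R]_q.

Lemma measurable_set1_rV (x : 'rV[R]_q) : measurable [set x].
Proof.
have -> : [set x] = \bigcap_(i in [set: 'I_q]) (fun y : 'rV[R]_q => y ord0 i) @^-1` [set x ord0 i].
  apply/seteqP; split => [_ ->//|y H]; apply/rowP => i.
  exact: (H i I).
apply: fin_bigcap_measurable => // i _.
by apply: measurable_preimage; [exact: measurable_coord|exact: measurable_set1].
Qed.

(* Junk value 0 unless [S] has exactly one point other than 0. *)
Definition second_point S : 'rV[R]_q :=
  if `[< counting (S `&` ~` [set 0]) = 1%:R%:E :> \bar R >]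
  then xget 0 (S `&` ~` [set 0]) else 0.

(** The choice y = 0 covers the one-point cluster. *)
Definition point_or_pair S := exists y, S = [set 0; y].

Lemma second_point_pair (y : 'rV[R]_q) : second_point [set 0; y] = y.
Proof.
rewrite /second_point; have [->|y0] := eqVneq y 0.
  rewrite asboolF// (_ : _ `&` _ = set0) ?counting_eq1P//.
    by move=> [x] /seteqP[_ /(_ x erefl)].
  by apply/seteqP; split => // x [/= [] ->].
have e : [set 0; y] `&` ~` [set 0] = [set y].
  apply/seteqP; split => [x [/= [->//|->//]]|x ->]; split; first by right.
  exact/eqP.
by rewrite e asboolT; [exact: xget_unique|apply/counting_eq1P; exists y].
Qed.

Lemma point_or_pairE S : point_or_pair S -> S = [set 0; second_point S].
Proof. by case=> y ->; rewrite second_point_pair. Qed.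

(** Expresses the second point through count events, which generate the sigma-algebra on
    configurations. The junk value 0 cannot interfere because [A] avoids 0; sets containing 0 are
    reached through complements. *)
Lemma second_point_in S A : ~ A 0 -> A (second_point S) <->
  counting (S `&` A) = 1%:R%:E :> \bar R /\ counting (S `&` ~` [set 0]) = 1%:R%:E :> \bar R.
Proof.
move=> A0; rewrite /second_point; case: asboolP => [|h]; last by split => [//|[_]].
move/counting_eq1P => [x Sx]; rewrite Sx.
have -> : xget 0 [set x] = x by exact: xget_unique.
have [Sx1 x0] : S x /\ x <> 0 by have : [set x] x by []; rewrite -Sx => -[].
split=> [Ax|[/counting_eq1P[y Sy] _]].
  split; apply/counting_eq1P; exists x => //.
  apply/seteqP; split => [y [Sy Ay]|y ->//].
  have : (S `&` ~` [set 0]) y by split => //= y0; rewrite y0 in Ay.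
  by rewrite Sx.
have [Sy1 Ay] : S y /\ A y by have : [set y] y by []; rewrite -Sy => -[].
have : (S `&` ~` [set 0]) y by split => //= y0; rewrite y0 in Ay.
by rewrite Sx => <-.
Qed.

Lemma measurable_count_event A k : measurable A ->
  measurable [set S : configuration R q | counting (S `&` A) = k%:R%:E :> \bar R].
Proof. by move=> mA; apply: sub_sigma_algebra; exists A, k. Qed.

Lemma measurable_second_point : measurable_fun setT
  (second_point : configuration R q -> 'rV[R]_q).
Proof.
have m1 A : measurable A -> ~ A 0 ->
    measurable [set S : configuration R q | A (second_point S)].
  move=> mA A0.
  rewrite (_ : [set S | _] = [set S : configuration R q | counting (S `&` A) = 1%:R%:E :> \bar R] `&`
     [set S : configuration R q | counting (S `&` ~` [set 0]) = 1%:R%:E :> \bar R]).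
    apply: measurableI; apply: measurable_count_event => //.
    by apply: measurableC; exact: measurable_set1_rV.
  by apply/seteqP; split => S /=; have [h1 h2] := @second_point_in S A A0; [exact: h1|exact: h2].
move=> _ A mA; rewrite setTI.
have [A0|A0] := pselect (A 0); last exact: m1.
rewrite -(setCK (second_point @^-1` A)); apply: measurableC.
by apply: (m1 (~` A)) => //; exact: measurableC.
Qed.

Lemma measurable_point_or_pair :
  measurable (point_or_pair : set (configuration R q)).
Proof.
rewrite (_ : point_or_pair =
  [set S : configuration R q | counting (S `&` [set 0]) = 1%:R%:E :> \bar R] `&`
  ([set S : configuration R q | counting (S `&` ~` [set 0]) = 0%:R%:E :> \bar R] `|`
   [set S : configuration R q | counting (S `&` ~` [set 0]) = 1%:R%:E :> \bar R])).
  have m0 : measurable [set (0 : 'rV[R]_q)] by exact: measurable_set1_rV.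
  have m0C := measurableC m0.
  apply: measurableI; first exact: measurable_count_event.
  by apply: measurableU; exact: measurable_count_event.
apply/seteqP; split => S /=.
  move=> [y ->]; split.
    apply/counting_eq1P; exists 0; apply/seteqP; split => [x []//|x ->].
    by split => //; left.
  have [->|y0] := eqVneq y 0.
    by left; apply/counting_eq0P; apply/seteqP; split => // x [/= [] ->].
  right; apply/counting_eq1P; exists y; apply/seteqP; split => [x [/= [->//|->//]]|x ->].
  by split; [right|exact/eqP].
move=> [/counting_eq1P[x Sx]].
have S0 : S 0.
  have : [set x] x by [].
  by rewrite -Sx => -[Sxx x0]; rewrite -x0.
move=> [/counting_eq0P S0C|/counting_eq1P[y Sy]].
  exists 0; apply/seteqP; split => [z Sz|z /= [->//|->//]].
  have [->|z0] := eqVneq z 0; first by left.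
  suff : set0 z by [].
  by rewrite -S0C; split => //; exact/eqP.
exists y; apply/seteqP; split => [z Sz|z /= [->//|->]].
  have [->|z0] := eqVneq z 0; first by left.
  right; have : (S `&` ~` [set 0]) z by split => //; exact/eqP.
  by rewrite Sy.
have : [set y] y by [].
by rewrite -Sy => -[].
Qed.

End second_point.

Section gauss_poisson_marks.
Context {R : realType} {q : nat} {disp : measure_display}.
Context {Omega : measurableType disp} (P : probability Omega R).
Variables (V : probability 'rV[R]_q R) (p : R) (N : Omega -> set 'rV[R]_q).
Variable mu : {sigma_finite_measure set 'rV[R]_q -> \bar R}.
Hypothesis muE : forall A, measurable A -> mu A = lebesgue_rV A.

Lemma measurable_gauss_poisson_cluster (A : set 'rV[R]_q) (eta : {RV P >-> nat})
    (Y : {RV P >-> 'rV[R]_q}) : measurable A ->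
  measurable [set w | eta w = 2%N /\ A (Y w)].
Proof.
move=> mA; apply: (@measurableI _ _ (eta @^-1` [set 2%N]) (Y @^-1` A)).
  by apply: measurable_preimage.
exact: measurable_preimage.
Qed.

Lemma second_point_cluster (eta : Omega -> nat) (Y : Omega -> 'rV[R]_q) w :
  (eta w = 1%N \/ eta w = 2%N) ->
  point_or_pair (gauss_poisson_cluster eta Y w) /\
  second_point (gauss_poisson_cluster eta Y w) = if eta w == 2%N then Y w else 0.
Proof.
have s1 : [set 0] = [set 0; 0] :> set 'rV[R]_q by rewrite setUid.
rewrite /gauss_poisson_cluster => -[->|->] /=.
  by rewrite s1 second_point_pair; split => //; exists 0.
by rewrite second_point_pair; split => //; exists (Y w).
Qed.

(* Only the points Y <> 0 matter for pair differences, and these are the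
   second points of two-point clusters. *)
Lemma pair_difference_null (eta : {RV P >-> nat}) (Y : {RV P >-> 'rV[R]_q})
    (A : set 'rV[R]_q) :
  pair_difference_measure P (gauss_poisson_cluster eta Y) `<< @lebesgue_rV R q ->
  measurable A -> ~ A 0 -> mu A = 0%E ->
  P [set w | eta w = 2%N /\ A (Y w)] = 0%E.
Proof.
move=> ac mA A0 muA0.
have mD := measurable_gauss_poisson_cluster eta Y mA.
apply/eqP; rewrite eq_le measure_ge0 andbT.
have <- : pair_difference_measure P (gauss_poisson_cluster eta Y) A = 0%E.
  apply: (ac A) => // B mB BA; rewrite -muE//.
  by apply/eqP; rewrite eq_le measure_ge0 andbT -muA0 le_measure// inE.
rewrite -[X in (P X <= _)%E]setIT -integral_indic//.
apply: le_integral_ge0 => w _; first by rewrite lee_fin indicE; case: (_ \in _).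
rewrite indicE; have [|_] := boolP (w \in _); last exact: measure_ge0.
rewrite inE => -[eta2 AY]; rewrite /gauss_poisson_cluster eta2 eqxx.
set S := [set z | _].
have SY : S (Y w, 0).
  split => /=; [by right|by left| |by rewrite subr0].
  by move=> Y0; rewrite Y0 in AY.
rewrite /counting; case: asboolP => [finS|_]; last by rewrite leey.
rewrite lee_fin ler1n cardfs_gt0; apply/eqP => S0.
have : (Y w, 0) \in fset_set S by rewrite in_fset_set// inE.
by rewrite S0 inE.
Qed.

(** The mark of a parent is the second point of its cluster, a measurable function of the cluster,
    so it inherits independence and law. The description of [N] by marks holds almost surely; the
    description by the clusters [L], valid everywhere, is kept for exact measurability. *)
Lemma gauss_poisson_marked : gauss_poisson_process P V p N ->
  exists (lam : R) (Q : probability 'rV[R]_q R) (X Y : nat -> Omega -> 'rV[R]_q)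
      (L : nat -> Omega -> set 'rV[R]_q),
  [/\ marked_poisson P mu lam Q X Y,
      {ae P, forall w, N w = range (X ^~ w) `|` range (fun n => X n w + Y n w)},
      0 <= p <= 1 /\ (forall A : set 'rV[R]_q, measurable A -> ~ A 0 -> Q A = (p%:E * V A)%E),
      (forall A : set 'rV[R]_q, measurable A -> ~ A 0 -> mu A = 0%E -> Q A = 0%E) &
      (forall n, random_point_set (L n) /\ forall w, finite_set (L n w)) /\
      forall w, N w = \bigcup_n [set l + X n w | l in L n w]].
Proof.
move=> [lam [eta [Y0 [eta12 Peta PY indY]]]].
move=> [lam0 rL0 _ _ ac [X [L [injX pX rL ind NE]]]].
have mX n : measurable_fun setT (X n) by [].
pose Y n w := second_point (L n w).
have mL n : measurable_fun setT (L n : Omega -> configuration R q) by have [] := rL n.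
have mY n : measurable_fun setT (Y n).
  exact: (measurableT_comp measurable_second_point (mL n)).
have lawL n (H : set (configuration R q)) : measurable H ->
    P (L n @^-1` H) = P (gauss_poisson_cluster eta Y0 @^-1` H).
  by move=> mH; have [_ _] := rL n; exact.
have lawY n A : measurable A ->
    P (Y n @^-1` A) = P [set w | A (second_point (gauss_poisson_cluster eta Y0 w))].
  move=> mA; apply: (lawL n (second_point @^-1` A)).
  exact: (measurable_preimage measurable_second_point).
have p01 : 0 <= p <= 1.
  rewrite -!lee_fin -Peta measure_ge0/=.
  by apply: probability_le1; apply: (measurable_preimage (A := [set 2%N])).
(* All marks have the law of the mark of cluster 0. It may charge 0, where the one-point clusters
   are recorded. *)
pose Ym : {mfun Omega >-> 'rV[R]_q} := HB.pack (Y 0) (isMeasurableFun.Build _ _ _ _ _ (mY 0)).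
pose Q : probability 'rV[R]_q R := distribution P Ym.
have QE n A : measurable A -> P (Y n @^-1` A) = Q A.
  by move=> mA; rewrite lawY// -(lawY 0).
have QA0 (A : set 'rV[R]_q) : measurable A -> ~ A 0 -> Q A = P [set w | eta w = 2%N /\ A (Y0 w)].
  move=> mA A0; rewrite -(QE 0)// lawY//; congr (P _).
  apply: eq_set => w; have [_ ->] := second_point_cluster Y0 (eta12 w).
  case: eqP => e; apply/propext; split => //; first by move=> [].
  by move=> [].
exists lam, Q, X, Y, L; split.
- split => //.
  + by move=> A k mA; have := measurable_preimage (poisson_random pX) (measurable_count_event k mA).
  + move=> A k mA muA; have := poisson_counts pX k mA; rewrite -muE// => /(_ muA) ->.
    by rewrite poisson_prob1// mulr_ge0 ?fine_ge0// ltW.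
  + by move=> r A k mA tA; exact: (poisson_indep pX).
  + move=> m A B mA mB.
    (* All conditions on parents form a single event of index [None], which makes the parents one
       member of the independent family. *)
    pose E (i : option nat) : set Omega :=
      if i is Some n then Y n @^-1` B n else \bigcap_(n < m) X n @^-1` A n.
    have := ind (None :: map Some (iota 0 m)) E.
    rewrite /= big_cons big_map => /(_ _ _)/=.
    have uJ : (None \notin [seq Some i | i <- iota 0 m]) && uniq [seq Some i | i <- iota 0 m].
      rewrite map_inj_uniq ?iota_uniq ?andbT; last by move=> ? ? [].
      by apply/mapP => -[].
    have FE i : i \in None :: [seq Some i | i <- iota 0 m] ->
        (if i is Some n then sigma_of_config (L n) else sigma_of_points (fun x : nat => X x)) (E i).
      move=> _; case: i => [n|].
        exists (second_point @^-1` B n); last by rewrite setTI.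
        exact: (measurable_preimage measurable_second_point).
      apply: (@bigcap_measurableType _ (g_sigma_algebraType
        (\bigcup_n preimage_set_system setT (X n) measurable))) => n _.
      by apply: sub_sigma_algebra; exists n => //; exists (A n) => //; rewrite setTI.
    move=> /(_ uJ FE) H.
    rewrite (_ : \bigcap_(_ < _) _ = \bigcap_(i in [set` None :: [seq Some i | i <- iota 0 m]]) E i).
      rewrite H EFinM fineK ?fin_num_measure//; last first.
        by apply: bigcap_measurableType => n _; exact: measurable_preimage.
      congr (_ * _%:E)%E; rewrite -(big_mkord predT (fun n => fine (Q (B n)))) /index_iota subn0.
      by apply: eq_bigr => n _; rewrite /= QE.
    apply/seteqP; split => w Hw.
      move=> [n|] /=; rewrite inE/=.
        by move=> /mapP[k]; rewrite mem_iota add0n => /andP[_ km] [->]; have [] := Hw k km.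
      by move=> _ n nm; have [] := Hw n nm.
    move=> n /= nm; split.
      by apply: (Hw None) => //=; rewrite inE.
    apply: (Hw (Some n)) => /=; rewrite inE/=; apply/mapP; exists n => //.
    by rewrite mem_iota.
(* Each [L n] equals the typical cluster in law only; its shape is transferred through the
   measurable set [point_or_pair]. *)
- have goodL : {ae P, forall w, forall n, point_or_pair (L n w)}.
    apply: ae_foralln => n.
    exists (L n @^-1` (~` point_or_pair)); split => //.
      by apply: (measurable_preimage (mL n)); apply: measurableC; exact: measurable_point_or_pair.
    etransitivity; first by apply: lawL; apply: measurableC; exact: measurable_point_or_pair.
    rewrite (_ : _ @^-1` _ = set0) ?measure0//.
    by apply/seteqP; split => // w /=; have [] := second_point_cluster Y0 (eta12 w).
  apply: filterS goodL => w gL; rewrite NE; apply/seteqP; split => x.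
    move=> [n _ [l]]; rewrite (point_or_pairE (gL n)) => -[->|->] <-.
      by left; exists n => //; rewrite add0r.
    by right; exists n => //; rewrite addrC.
  move=> [[n _ <-]|[n _ <-]]; exists n => //.
    by exists 0; rewrite ?add0r// (point_or_pairE (gL n)); left.
  by exists (Y n w); [rewrite (point_or_pairE (gL n)); right|rewrite addrC].
- split => // A mA A0; rewrite QA0//.
  have -> : [set w | eta w = 2%N /\ A (Y0 w)] = [set w | eta w = 2%N] `&` Y0 @^-1` A by [].
  by rewrite indY// Peta PY.
- by move=> A mA A0 muA0; rewrite QA0//; exact: pair_difference_null ac _ _ _.
- split => // n; have [rn fn _] := rL n; split => //.
Qed.

End gauss_poisson_marks.

(** * Measurability of the empty space events *)

Lemma measurable_fun_nat_valued d (T : measurableType d) (R : realType)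
    (f : T -> \bar R) : (forall w, exists k : nat, f w = k%:R%:E) ->
  (forall k : nat, measurable [set w | f w = k%:R%:E]) -> measurable_fun setT f.
Proof.
move=> fk mk _ A mA; rewrite setTI.
have -> : f @^-1` A = \bigcup_(k in [set k : nat | A k%:R%:E]) [set w | f w = k%:R%:E].
  apply/seteqP; split => [w Aw|w [k /= Ak fw]]; last by rewrite /preimage/= fw.
  by have [k fw] := fk w; exists k => //=; rewrite -fw.
by apply: bigcup_measurable.
Qed.

Section random_finite_set.
Context {R : realType} {q : nat} {d : measure_display} {Omega : measurableType d}.
Variable L : Omega -> set 'rV[R]_q.
Hypotheses (rL : random_point_set L) (finL : forall w, finite_set (L w)).
Context {d' : measure_display} {T : measurableType d'}.
Variable W : Omega -> T.
Hypothesis mW : measurable_fun setT W.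

Let cnt (w : Omega) (A : set 'rV[R]_q) : \bar R := counting (L w `&` A).

Let mfin (w : Omega) (A : set 'rV[R]_q) : measurable (L w `&` A).
Proof.
apply: countable_measurable; first exact: measurable_set1_rV.
by apply: finite_set_countable; exact: finite_setIl.
Qed.

Let cntE w A : exists k : nat, cnt w A = k%:R%:E.
Proof.
exists #|` fset_set (L w `&` A)|%fset; apply/counting_eqP; split => //.
exact: finite_setIl.
Qed.

Let mcnt A : measurable A -> measurable_fun setT (cnt ^~ A).
Proof.
move=> mA; apply: measurable_fun_nat_valued => [w|k]; first exact: cntE.
exact: (measurable_preimage rL (measurable_count_event k mA)).
Qed.

(** Points are counted in a set depending on a random parameter [W]. For a rectangle this is an
    indicator times a fixed count; complements are handled by subtraction, legitimate because [L w]
    is finite. *)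
Lemma measurable_counting_section (D : set (T * 'rV[R]_q)) : measurable D ->
  measurable_fun setT (fun w => counting (L w `&` xsection D (W w)) : \bar R).
Proof.
move: D; set G := [set A `*` B | A in @measurable _ T & B in @measurable _ 'rV[R]_q].
suff H D : <<s G >> D -> measurable_fun setT (fun w => counting (L w `&` xsection D (W w)) : \bar R).
  by move=> D mD; apply: H; rewrite -measurable_prod_measurableType.
move: D.
apply: dynkin_induction.
- exact: measurable_prod_measurableType.
- move=> _ _ [A mA [B mB <-]] [A' mA' [B' mB' <-]].
  exists (A `&` A'); first exact: measurableI.
  by exists (B `&` B'); [exact: measurableI|rewrite setXI].
- rewrite (_ : (fun w => _) = cnt ^~ setT); first exact: mcnt.
  apply/funext => w; congr (counting (_ `&` _)).
  by apply/seteqP; split => // x _; apply/mem_set.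
- move=> _ [A mA [B mB <-]].
  rewrite (_ : (fun w => _) = fun w => ((\1_A (W w))%:E * cnt w B)%E).
    apply: emeasurable_funM; last exact: mcnt.
    apply/measurable_EFinP; apply: (measurableT_comp _ mW).
    by apply: measurable_indic.
  apply/funext => w; rewrite indicE; have [WA|WA] := boolP (W w \in A).
    rewrite mul1e; congr (counting (_ `&` _)).
    by rewrite in_xsectionX.
  by rewrite mul0e notin_xsectionX// setI0 measure0.
- move=> D mD mfD.
  have xsC w : xsection (~` D) (W w) = ~` xsection D (W w) by rewrite !xsectionE.
  rewrite (_ : (fun w => _) = fun w => (cnt w setT - counting (L w `&` xsection D (W w)))%E).
    by apply: emeasurable_funB => //; exact: mcnt.
  apply/funext => w; have [k ck] := cntE w (xsection D (W w)).
  have -> : cnt w setT = (counting (L w `&` xsection (~` D) (W w)) +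
      counting (L w `&` xsection D (W w)))%E.
    rewrite -measureU//.
    - by rewrite xsC -setIUr setUC setUv.
    - by rewrite xsC setIACA setICl setI0.
  by rewrite -/(cnt w (xsection D (W w))) ck addeK.
- move=> F mF tF mfF.
  rewrite (_ : (fun w => _) = fun w => (\sum_(n <oo) counting (L w `&` xsection (F n) (W w)))%E).
    by apply: ge0_emeasurable_sum.
  apply/funext => w; rewrite xsection_bigcup setI_bigcupr measure_bigcup//.
  - by apply: eq_eseriesl => n; rewrite in_setT.
  - by apply/trivIset_setIl; exact: trivIset_xsection.
Qed.

Lemma measurable_exists_point (D : set (T * 'rV[R]_q)) : measurable D ->
  measurable [set w | exists2 l, L w l & D (W w, l)].
Proof.
move=> mD; have := measurable_counting_section mD => mf.
have -> : [set w | exists2 l, L w l & D (W w, l)] =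
    ~` ((fun w => counting (L w `&` xsection D (W w))) @^-1` [set 0%:R%:E : \bar R]).
  apply/seteqP; split => [w [l Ll Dl] /= /counting_eq0P h|w /= h].
    suff : set0 l by [].
    by rewrite -h; split => //; exact/mem_set.
  apply: contrapT => h'; apply: h; apply/counting_eq0P.
  apply/seteqP; split => // l [Ll /set_mem Dl].
  by apply: h'; exists l.
apply: measurableC; apply: measurable_preimage => //.
Qed.

End random_finite_set.

(** * The gauge of B *)

Section gauge.
Context {R : realType} {q : nat}.
Variable B : set 'rV[R]_q.
Hypotheses (cB : compact B)
  (xB : convex_set (B : set (convex_lmodType 'rV[R]_q)))
  (nB : nbhs (0 : 'rV[R]_q) B).
Implicit Types x y : 'rV[R]_q.

(** The Minkowski functional of [B]. It may fail to be a norm, as [B] can be asymmetric. *)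
Definition gauge x : R := inf [set t | 0 <= t /\ exists2 b, B b & x = t *: b].

Let B0 : B 0. Proof. exact: nbhs_singleton nB. Qed.

Let convB (s : R) x y : 0 <= s <= 1 -> B x -> B y -> B (s *: x + (1 - s) *: y).
Proof.
move=> /andP[s0 s1] Bx By.
by have := xB (Itv01 s0 s1) (mem_set Bx) (mem_set By); rewrite inE.
Qed.

Let dilate_le (s t : R) x : 0 <= s -> s <= t ->
  (exists2 b, B b & x = s *: b) -> exists2 b, B b & x = t *: b.
Proof.
move=> s0 st [b Bb ->]; have [t0|t0] := eqVneq t 0.
  by exists b => //; suff -> : s = t; [by []|lra].
have tp : 0 < t by rewrite lt_neqAle eq_sym t0 (le_trans s0).
exists ((s / t) *: b); last by rewrite scalerA mulrCA divff// mulr1.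
have -> : (s / t) *: b = (s / t) *: b + (1 - s / t) *: 0 by rewrite scaler0 addr0.
apply: convB => //; apply/andP; split; last by rewrite ler_pdivrMr// mul1r.
by rewrite divr_ge0// ltW.
Qed.

Lemma norm_le_mem : exists2 r : R, 0 < r & forall x, `|x| <= r -> B x.
Proof.
have /nbhs_ballP[e /= e0 eB] := nB.
exists (e / 2); first by rewrite divr_gt0.
move=> x xe; apply: eB; rewrite -ball_normE /ball_/= sub0r normrN.
by apply: le_lt_trans xe _; lra.
Qed.

Lemma mem_norm_le : exists2 M : R, 0 < M & forall x, B x -> `|x| <= M.
Proof.
have [M [_ HM]] := compact_bounded cB.
exists (`|M| + 1); first by rewrite ltr_wpDl.
by move=> x Bx; apply: (HM (`|M| + 1)) => //; rewrite (le_lt_trans (ler_norm M))// ltrDl.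
Qed.

Let absorb x : exists2 t : R, 0 <= t & exists2 b, B b & x = t *: b.
Proof.
have [r r0 rB] := norm_le_mem; exists (`|x| / r); first by rewrite divr_ge0// ltW.
have [->|x0] := eqVneq x 0; first by exists 0 => //; rewrite scaler0.
have nx : `|x| != 0 by rewrite normr_eq0.
exists ((r / `|x|) *: x).
  apply: rB; rewrite normrZ ger0_norm ?divfK//.
  by rewrite divr_ge0// ltW.
by rewrite scalerA mulrA divfK ?gt_eqF// divff// scale1r.
Qed.

Let has_inf_dilate x : has_inf [set t | 0 <= t /\ exists2 b, B b & x = t *: b].
Proof.
split; first by have [t t0 h] := absorb x; exists t.
by exists 0 => t /= [].
Qed.

Lemma gauge_ge0 x : 0 <= gauge x.
Proof.
by apply: lb_le_inf; [have [] := has_inf_dilate x|move=> t []].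
Qed.

(** The infimum is attained: for t > 0 because [B] is closed, at t = 0 because boundedness of [B]
    forces x = 0. *)
Lemma gauge_le (t : R) x : 0 <= t -> gauge x <= t <-> exists2 b, B b & x = t *: b.
Proof.
move=> t0; split => [gt|xt]; last first.
  by apply: ge_inf; [have [] := has_inf_dilate x|split].
have gt' s : t < s -> exists2 b, B b & x = s *: b.
  move=> ts; have s0 : 0 < s - t by lra.
  have [r [r0 rb] rs] := inf_adherent s0 (has_inf_dilate x).
  by apply: dilate_le rb => //; rewrite -/(gauge x) in rs; lra.
have [tz|tz] := eqVneq t 0.
  exists 0 => //; rewrite tz scale0r; apply/eqP; rewrite -normr_le0.
  have [M M0 BM] := mem_norm_le.
  apply/ler_addgt0Pr => e e0; rewrite add0r.
  have [|b Bb ->] := gt' (e / M); first by rewrite tz divr_gt0.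
  have eM : 0 < e / M by rewrite divr_gt0.
  rewrite normrZ (ger0_norm (ltW eM)).
  by rewrite -ler_pdivlMl// invf_div divfK ?gt_eqF// BM.
have tp : 0 < t by rewrite lt_neqAle eq_sym tz.
exists (t^-1 *: x); last by rewrite scalerA divff// scale1r.
(* x / s belongs to [B] for every s > t. *)
have cvgs : s^-1 *: x @[s --> t^'+] --> t^-1 *: x.
  apply: cvgZr_tmp; apply: cvgV => //.
  exact: cvg_at_right_filter.
apply: (closed_cvg _ (compact_closed (@norm_hausdorff _ _) cB) _ _ cvgs).
near=> s; have ts : t < s by near: s; exact: nbhs_right_gt.
have [b Bb ->] := gt' s ts.
by rewrite scalerA mulVf ?scale1r// gt_eqF// (lt_trans tp).
Unshelve. all: by end_near.
Qed.

Lemma gauge0 : gauge 0 = 0.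
Proof.
apply/eqP; rewrite eq_le gauge_ge0 andbT; apply/gauge_le => //.
by exists 0 => //; rewrite scaler0.
Qed.

Lemma gauge_le0 x : gauge x <= 0 <-> x = 0.
Proof.
split=> [|->]; last by rewrite gauge0.
by move/(gauge_le _ (lexx _)) => [b _ ->]; rewrite scale0r.
Qed.

Let gaugeZ_le (s : R) x : 0 <= s -> gauge (s *: x) <= s * gauge x.
Proof.
move=> s0; apply/gauge_le; first by rewrite mulr_ge0// gauge_ge0.
have /(gauge_le _ (gauge_ge0 x))[b Bb xb] := lexx (gauge x).
by exists b => //; rewrite -scalerA -xb.
Qed.

Lemma gaugeZ (s : R) x : 0 <= s -> gauge (s *: x) = s * gauge x.
Proof.
move=> s0; apply/eqP; rewrite eq_le gaugeZ_le//=.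
have [->|sn0] := eqVneq s 0; first by rewrite mul0r gauge_ge0.
have sp : 0 < s by rewrite lt_neqAle eq_sym sn0.
rewrite -ler_pdivlMl// (le_trans _ (gaugeZ_le _ _)) ?invr_ge0//.
by rewrite scalerA mulVf// scale1r.
Qed.

Lemma gaugeD x y : gauge (x + y) <= gauge x + gauge y.
Proof.
have [|xy] := eqVneq (gauge x + gauge y) 0.
  move=> e; have /gauge_le0 -> : gauge x <= 0 by have := gauge_ge0 y; lra.
  by rewrite add0r gauge0 add0r.
have sp : 0 < gauge x + gauge y.
  by rewrite lt_neqAle eq_sym xy addr_ge0// gauge_ge0.
apply/gauge_le; first exact: ltW.
have /(gauge_le _ (gauge_ge0 x))[b Bb xb] := lexx (gauge x).
have /(gauge_le _ (gauge_ge0 y))[c Bc yc] := lexx (gauge y).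
pose s := gauge x / (gauge x + gauge y).
exists (s *: b + (1 - s) *: c).
  apply: convB => //; apply/andP; split; last first.
    by rewrite ler_pdivrMr// mul1r lerDl gauge_ge0.
  by apply: divr_ge0; [exact: gauge_ge0|exact: ltW].
rewrite scalerDr !scalerA {1}xb {1}yc /s; congr (_ *: _ + _ *: _); field.
  by rewrite gt_eqF.
by rewrite gt_eqF.
Qed.

(** Substitute for symmetry. A ball of radius r lies in [B] and [B] lies in a ball of radius M, so c
    = M / r works. *)
Lemma gaugeN : exists2 c : R, 0 < c & forall x, gauge (- x) <= c * gauge x.
Proof.
have [r r0 rB] := norm_le_mem; have [M M0 BM] := mem_norm_le.
exists (M / r); first by rewrite divr_gt0.
move=> x; apply/gauge_le; first by rewrite mulr_ge0 ?gauge_ge0 ?divr_ge0 ?ltW.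
have /(gauge_le _ (gauge_ge0 x))[b Bb xb] := lexx (gauge x).
exists (- ((r / M) *: b)).
  have rM : 0 < r / M by rewrite divr_gt0.
  apply: rB; rewrite normrN normrZ (ger0_norm (ltW rM)).
  by rewrite mulrAC ler_pdivrMr// ler_pM2l// BM.
rewrite scalerN scalerA {1}xb; congr (- (_ *: _)); field.
by rewrite !gt_eqF.
Qed.

Lemma measurable_gauge : measurable_fun setT gauge.
Proof.
apply: (measurability _ (RGenOInfty.measurableE R)) => _ [_ [a ->] <-].
rewrite setTI; rewrite (_ : _ @^-1` _ = ~` [set x | gauge x <= a]); last first.
  by apply/seteqP; split => x /=; rewrite in_itv/= andbT ltNge => /negP.
apply: measurableC; have [a0|a0] := leP 0 a; last first.
  rewrite (_ : [set x | _] = set0)//.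
  by apply/seteqP; split => // x /=; have := gauge_ge0 x; lra.
have -> : [set x | gauge x <= a] = ( *:%R a) @` B.
  apply/seteqP; split => [x /(gauge_le _ a0)[b Bb ->]|_ [b Bb <-]]; first by exists b.
  by apply/gauge_le => //; exists b.
apply: closed_measurable_mx; apply: compact_closed; first exact: norm_hausdorff.
apply: continuous_compact => //; apply: continuous_subspaceT.
exact: scaler_continuous.
Qed.

End gauge.

(** On nonnegative reals, 0 included, the inverse is the power with exponent -1, whose measurability
    is known. *)
Lemma measurable_funV_ge0 d (T : measurableType d) (R : realType) (f : T -> R) :
  measurable_fun setT f -> (forall x, 0 <= f x) ->
  measurable_fun setT (fun x => (f x)^-1).
Proof.
move=> mf f0; rewrite (_ : (fun x => _) = (fun x => f x `^ (-1))).
  exact: (measurableT_comp (measurable_powR _) mf).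
by apply/funext => x; rewrite powR_inv1.
Qed.

Lemma measurable_fun_ler_set d (T : measurableType d) (R : realType) (f g : T -> R) :
  measurable_fun setT f -> measurable_fun setT g -> measurable [set x | f x <= g x].
Proof.
by move=> mf mg; rewrite -[X in measurable X]setTI; exact: measurable_fun_le.
Qed.

Lemma measurable_fun_ltr_set d (T : measurableType d) (R : realType) (f g : T -> R) :
  measurable_fun setT f -> measurable_fun setT g -> measurable [set x | f x < g x].
Proof.
move=> mf mg; rewrite (_ : [set x | _] = ~` [set x | g x <= f x]).
  by apply: measurableC; exact: measurable_fun_ler_set.
by apply/seteqP; split => x /=; rewrite ltNge => /negP.
Qed.

Lemma measurable_fun_rVD d (T : measurableType d) (R : realType) q (f g : T -> 'rV[R]_q) :
  measurable_fun setT f -> measurable_fun setT g -> measurable_fun setT (f \+ g).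
Proof.
move=> mf mg; apply: measurable_fun_rV => i.
rewrite (_ : (fun w => _) = (fun w => f w ord0 i) \+ (fun w => g w ord0 i)).
  apply: measurable_funD.
    exact: (measurableT_comp (measurable_coord i) mf).
  exact: (measurableT_comp (measurable_coord i) mg).
by apply/funext => w; rewrite /= mxE.
Qed.

Lemma measurable_fun_rVZ d (T : measurableType d) (R : realType) q (a : T -> R)
    (f : T -> 'rV[R]_q) : measurable_fun setT a -> measurable_fun setT f ->
  measurable_fun setT (fun w => a w *: f w).
Proof.
move=> ma mf; apply: measurable_fun_rV => i.
rewrite (_ : (fun w => _) = a \* (fun w => f w ord0 i)).
  apply: measurable_funM => //.
  exact: (measurableT_comp (measurable_coord i) mf).
by apply/funext => w; rewrite /= mxE.
Qed.

Lemma measurable_fun_rVN d (T : measurableType d) (R : realType) q (f : T -> 'rV[R]_q) :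
  measurable_fun setT f -> measurable_fun setT (fun w => - f w).
Proof.
move=> mf; under eq_fun do rewrite -scaleN1r.
by apply: measurable_fun_rVZ.
Qed.

Section distance_gauge.
Context {R : realType} {q : nat}.
Variable B : set 'rV[R]_q.
Hypotheses (cB : compact B)
  (xB : convex_set (B : set (convex_lmodType 'rV[R]_q)))
  (nB : nbhs (0 : 'rV[R]_q) B).
Implicit Types (x y : 'rV[R]_q) (K : set 'rV[R]_q).
Local Notation g := (gauge B).

Let translateP (t : R) y : 0 <= t -> translate_scale 0 t B y <-> g y <= t.
Proof.
move=> t0; rewrite (gauge_le cB xB nB)//; split => [[b Bb <-]|[b Bb ->]]; exists b => //.
  by rewrite add0r.
by rewrite add0r.
Qed.

Lemma dist_rel_ge0 K : (0 <= dist_rel B 0 K)%E.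
Proof.
rewrite leNgt; apply/negP => /ereal_inf_lt[_ [t [t0 _] <-]].
by rewrite lte_fin ltNge t0. Qed.

(** The strict inequality has a pointwise form for arbitrary [K]; the large one would need the
    infimum to be attained. *)
Lemma dist_rel_ltP K (s : R) :
  (dist_rel B 0 K < s%:E)%E <-> exists2 y, K y & g y < s.
Proof.
split => [/ereal_inf_lt[_ [t [t0 [y [ty Ky]]] <-]]|[y Ky ys]].
  rewrite lte_fin => ts; exists y => //.
  by apply: le_lt_trans ts; apply/translateP.
apply/ereal_inf_ltP; exists (g y)%:E; last by rewrite lte_fin.
have gy0 := gauge_ge0 nB y.
by exists (g y) => //; split => //; exists y; split => //; apply/translateP.
Qed.

Lemma dist_rel_geP K (s : R) :
  (s%:E <= dist_rel B 0 K)%E <-> forall y, K y -> s <= g y.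
Proof.
split => [h y Ky|h].
  rewrite leNgt; apply/negP => ys; move: h; rewrite leNgt => /negP; apply.
  by apply/dist_rel_ltP; exists y.
rewrite leNgt; apply/negP => /dist_rel_ltP[y Ky]; rewrite ltNge => /negP; apply.
exact: h.
Qed.

Lemma contactE K : contact B K 0 = [set y | K y /\ g y <= fine (dist_rel B 0 K)].
Proof.
have d0 : 0 <= fine (dist_rel B 0 K) by rewrite fine_ge0// dist_rel_ge0.
by apply/seteqP; split => y [] /= => [/translateP|] h1 h2; split => //;
  [exact: h1|apply/translateP].
Qed.

End distance_gauge.

Section empty_space_measurable.
Context {R : realType} {q : nat} {d : measure_display} {Omega : measurableType d}.
Variable B : set 'rV[R]_q.
Hypotheses (cB : compact B)
  (xB : convex_set (B : set (convex_lmodType 'rV[R]_q)))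
  (nB : nbhs (0 : 'rV[R]_q) B).
Variables (N : Omega -> set 'rV[R]_q) (X : nat -> Omega -> 'rV[R]_q)
  (L : nat -> Omega -> set 'rV[R]_q).
Hypotheses (mX : forall n, measurable_fun setT (X n))
  (rL : forall n, random_point_set (L n)) (finL : forall n w, finite_set (L n w))
  (NE : forall w, N w = \bigcup_n [set l + X n w | l in L n w]).
Local Notation g := (gauge B).

Let mg := measurable_gauge cB xB nB.

(** [N] is a countable union of finite random sets shifted by measurable vectors; the shift [X n]
    joins [W] as a parameter. *)
Lemma measurable_exists_cluster_point d' (T : measurableType d') (W : Omega -> T)
    (D : set (T * 'rV[R]_q)) : measurable_fun setT W -> measurable D ->
  measurable [set w | exists2 y, N w y & D (W w, y)].
Proof.
move=> mW mD.
pose D' : set ((T * 'rV[R]_q) * 'rV[R]_q) := [set z | D (z.1.1, z.2 + z.1.2)].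
have mD' : measurable D'.
  apply: (measurable_preimage (f := fun z : (T * 'rV[R]_q) * 'rV[R]_q => (z.1.1, z.2 + z.1.2)) _ mD).
  apply: measurable_fun_pair; first exact: (measurableT_comp measurable_fst measurable_fst).
  apply: (measurable_fun_rVD measurable_snd).
  exact: (measurableT_comp measurable_snd measurable_fst).
rewrite (_ : [set w | _] =
    \bigcup_n [set w | exists2 l, L n w l & D' ((W w, X n w), l)]).
  apply: bigcupT_measurable => n.
  by apply: measurable_exists_point => //; exact: measurable_fun_pair.
apply/seteqP; split => [w [y]|w [n _ [l Ll Dl]]].
  by rewrite NE => -[n _ [l Ll <-]] Dl; exists n => //; exists l.
by exists (l + X n w) => //; rewrite NE; exists n => //; exists l.
Qed.

Let D w := dist_rel B 0 (N w).

Let mD : measurable_fun setT D.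
Proof.
apply: (measurability _ (ErealGenInftyO.measurableE R)) => _ [_ [a ->] <-].
rewrite setTI.
rewrite (_ : _ @^-1` _ = [set w | exists2 y, N w y & [set z : unit * 'rV[R]_q | g z.2 < a] (tt, y)]).
  apply: measurable_exists_cluster_point => //.
  apply: measurable_fun_ltr_set => //.
  exact: (measurableT_comp mg measurable_snd).
by apply/seteqP; split => w /=; rewrite in_itv/= => /(dist_rel_ltP cB xB nB).
Qed.

Let md : measurable_fun setT (fun w => fine (D w)).
Proof. exact: measurableT_comp mD. Qed.

(** The distance, already known to be measurable, plays the role of the random parameter; contact
    points are the points of [N] with gauge at most that parameter. *)
Let mexd (A : set (R * 'rV[R]_q)) : measurable A ->
  measurable [set w | exists2 y, contact B (N w) 0 y & A (fine (D w), y)].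
Proof.
move=> mA.
rewrite (_ : [set w | _] = [set w | exists2 y, N w y &
    ([set z : R * 'rV[R]_q | g z.2 <= z.1] `&` A) (fine (D w), y)]).
  apply: measurable_exists_cluster_point; [exact: md|apply: measurableI => //].
  apply: measurable_fun_ler_set => //.
  exact: (measurableT_comp mg measurable_snd).
apply/seteqP; split => w [y].
  by rewrite (contactE cB xB nB) => -[/= h1 h2] Ay; exists y.
by move=> Ny [/= h Ay]; exists y => //; rewrite (contactE cB xB nB).
Qed.

Let uniq_contact : set Omega :=
  [set w | (0 < D w < +oo)%E /\ exists y, contact B (N w) 0 = [set y]].

Let muniq : measurable uniq_contact.
Proof.
pose lo (i : 'I_q) (r : rat) := [set w | exists2 y, contact B (N w) 0 y &
  [set z : R * 'rV[R]_q | z.2 ord0 i < ratr r] (fine (D w), y)].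
pose hi (i : 'I_q) (r : rat) := [set w | exists2 y, contact B (N w) 0 y &
  [set z : R * 'rV[R]_q | ratr r <= z.2 ord0 i] (fine (D w), y)].
have mc i : measurable_fun setT (fun z : R * 'rV[R]_q => z.2 ord0 i).
  exact: (measurableT_comp (measurable_coord i) measurable_snd).
have mlo i r : measurable (lo i r) by apply: mexd; exact: measurable_fun_ltr_set.
have mhi i r : measurable (hi i r) by apply: mexd; exact: measurable_fun_ler_set.
rewrite (_ : uniq_contact = [set w | 0 < D w]%E `&` [set w | D w < +oo]%E `&`
    [set w | exists2 y, contact B (N w) 0 y & [set: R * 'rV[R]_q] (fine (D w), y)] `\`
    \bigcup_i \bigcup_r (lo i r `&` hi i r)).
  apply: measurableD.
    apply: measurableI; last exact: mexd.
    apply: measurableI.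
      rewrite -[X in measurable X]setTI; by apply: emeasurable_fun_o_infty => //; exact: mD.
    by rewrite -[X in measurable X]setTI; apply: emeasurable_fun_infty_o => //; exact: mD.
  apply: countable_bigcupT_measurable => // i.
  by apply: countable_bigcupT_measurable => // r; exact: measurableI.
apply/seteqP; split => [w [/andP[h1 h2] [y cy]]|w [[[h1 h2] [y cy _]] nb]].
  split; first by split => //; exists y => //; rewrite cy.
  move=> [i _ [r _ [[y1 c1 /= h3] [y2 c2 /= h4]]]].
  move: c1 c2; rewrite cy => e1 e2; rewrite e1 in h3; rewrite e2 in h4.
  by move: h4; rewrite leNgt h3.
split; first by apply/andP.
exists y; apply/seteqP; split => [z cz|z ->//].
apply/rowP => i; apply/eqP; rewrite eq_le; apply/andP; split.
  rewrite leNgt; apply/negP => /rat_in_itvoo[r]; rewrite in_itv/= => /andP[yr rz].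
  apply: nb; exists i => //; exists r => //; split; first by exists y.
  by exists z => //=; exact: ltW.
rewrite leNgt; apply/negP => /rat_in_itvoo[r]; rewrite in_itv/= => /andP[yr rz].
apply: nb; exists i => //; exists r => //; split; first by exists z.
by exists y => //=; exact: ltW.
Qed.

(* [P] need not be complete, so measurability up to null sets would not do; the
   non-unique contacts are separated by rational hyperplanes. *)
Lemma measurable_empty_space_event u0 (t : R) (C : set 'rV[R]_q) : measurable C ->
  measurable [set w | (dist_rel B 0 (N w) <= t%:E)%E /\ C (dir_rel B u0 (N w) 0)].
Proof.
move=> mC.
(* The power -1 is measurable on all reals and agrees with the inverse at the nonnegative
   distance. *)
pose A := [set z : R * 'rV[R]_q | C (z.1 `^ (-1) *: (- z.2))].
have mA : measurable A.
  apply: measurable_preimage mC; apply: measurable_fun_rVZ.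
    exact: (measurableT_comp (measurable_powR _) measurable_fst).
  by apply: measurable_fun_rVN; exact: measurable_snd.
have mt : measurable [set w | D w <= t%:E]%E.
  by rewrite -[X in measurable X]setTI; apply: emeasurable_fun_infty_c => //; exact: mD.
rewrite (_ : [set w | _] = ([set w | D w <= t%:E]%E `&`
    (uniq_contact `&` [set w | exists2 y, contact B (N w) 0 y & A (fine (D w), y)] `|`
     ~` uniq_contact `&` (if `[< C u0 >] then setT else set0)))).
  apply: measurableI => //; apply: measurableU.
    by apply: measurableI => //; exact: mexd.
  by apply: measurableI; [exact: measurableC muniq|case: ifPn].
have dirE w : uniq_contact w -> C (dir_rel B u0 (N w) 0) <->
    exists2 y, contact B (N w) 0 y & A (fine (D w), y).
  move=> uw; rewrite /dir_rel asboolT//; have [_ [y cy]] := uw.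
  rewrite cy (_ : xget 0 [set y] = y); last exact: xget_unique.
  rewrite /A/= sub0r; split => [h|[_ -> /=]].
    by exists y => //=; rewrite powR_inv1// fine_ge0// dist_rel_ge0.
  by rewrite powR_inv1// fine_ge0// dist_rel_ge0.
apply/seteqP; split => w [Dt].
  move=> Cw; split => //; have [uw|uw] := pselect (uniq_contact w).
    by left; split => //; apply/dirE.
  right; split => //; move: Cw; rewrite /dir_rel asboolF// => Cu.
  by rewrite asboolT.
move=> [[uw /(dirE _ uw)]|[uw]]; first by split.
case: asboolP => // Cu _; split => //.
by rewrite /dir_rel asboolF.
Qed.

End empty_space_measurable.

(** * Lebesgue measure of cones and thin shells *)

Section lebesgue_product.
Context {R : realType} {q : nat}.
Variable mu : {sigma_finite_measure set 'rV[R]_q -> \bar R}.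
Hypothesis muE : forall A, measurable A -> mu A = lebesgue_rV A.
Variable Q : probability 'rV[R]_q R.
Local Notation V := 'rV[R]_q.
Local Notation M := (mu \x Q)%E.

Lemma measurable_translate (y : V) (A : set V) : measurable A ->
  measurable [set x | A (x + y)].
Proof.
move=> mA; apply: (measurable_preimage (f := fun x : V => x + y) _ mA).
by apply: measurable_fun_rVD; [exact: measurable_id|exact: measurable_cst].
Qed.

Lemma mu_translate (y : V) (A : set V) : measurable A ->
  mu [set x | A (x + y)] = mu A.
Proof.
by move=> mA; rewrite !muE ?lebesgue_rV_shift//; exact: measurable_translate.
Qed.

Lemma measurable_box (I : set R) : measurable I ->
  measurable [set x : V | forall i, I (x ord0 i)].
Proof.
move=> mI.
rewrite (_ : [set x | _] = \bigcap_(i in [set: 'I_q]) (fun y : V => y ord0 i) @^-1` I).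
  apply: fin_bigcap_measurable => // i _.
  exact: (measurable_preimage (measurable_coord i)).
by apply/seteqP; split => [x H i _|x H i]; [exact: H|exact: (H i)].
Qed.

Lemma mu_bounded (A : set V) (r : R) : measurable A ->
  (forall x, A x -> `|x| <= r) -> (mu A < +oo)%E.
Proof.
move=> mA Ar; have mI : measurable `[- r, r]%classic by exact: measurable_itv.
apply: (@le_lt_trans _ _ (mu [set x : V | forall i, `[- r, r]%classic (x ord0 i)])).
  apply: le_measure; rewrite ?inE//; first exact: measurable_box.
  move=> x /Ar xr i /=; rewrite in_itv/= -ler_norml (le_trans _ xr)//.
  rewrite [leRHS]/Num.norm/= mx_normrE.
  exact: (le_bigmax _ (fun ij : 'I_1 * 'I_q => `|x ij.1 ij.2|) (ord0, i)).
rewrite muE; last exact: measurable_box.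
rewrite lebesgue_rV_box// lebesgue_measure_itv/=.
by case: ifP => _; rewrite -?EFinD -?EFin_expe ltry.
Qed.

Lemma mu_set1 (x : V) : (0 < q)%N -> mu [set x] = 0%E.
Proof.
move=> q0; have m0 : measurable [set (0 : V)] by exact: measurable_set1_rV.
have -> : [set x] = [set z : V | [set 0] (z - x)].
  by apply/seteqP; split => z /= => [->|/eqP]; [rewrite subrr|rewrite subr_eq0 => /eqP].
rewrite mu_translate// muE//.
have -> : [set (0 : V)] = [set x : V | forall i, [set 0] (x ord0 i)].
  apply/seteqP; split => [z -> i /=|z H]; first by rewrite mxE.
  by apply/rowP => i; rewrite mxE; exact: H.
rewrite lebesgue_rV_box; last exact: measurable_set1.
by rewrite lebesgue_measure_set1; case: (q) q0 => // n _; rewrite expeS mul0e.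
Qed.

(** With the mark integrated last, translations and dilations act on the position at a fixed mark,
    where Lebesgue measure behaves well. *)
Lemma product_ysectionE (E : set (V * V)) : measurable E ->
  M E = (\int[Q]_y mu (ysection E y))%E.
Proof.
move=> mE; apply: (product_measure_unique (m' := (mu \x^ Q)%E)) => // A A' mA mA'.
by rewrite /= product_measure2E.
Qed.

Lemma ysection_preimage (E : set (V * V)) y : ysection E y = [set x | E (x, y)].
Proof. by rewrite ysectionE. Qed.

(** For a fixed mark the map is a translation. It makes the secondary point the base point of the
    pair. *)
Lemma product_shear (E : set (V * V)) : measurable E ->
  M [set z | E (z.1 + z.2, z.2)] = M E.
Proof.
move=> mE.
have mE' : measurable [set z : V * V | E (z.1 + z.2, z.2)].
  apply: (measurable_preimage (f := fun z : V * V => (z.1 + z.2, z.2)) _ mE).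
  apply: measurable_fun_pair; last exact: measurable_snd.
  by apply: measurable_fun_rVD; [exact: measurable_fst|exact: measurable_snd].
rewrite !product_ysectionE//; apply: eq_integral => y _.
rewrite !ysection_preimage -(mu_translate y (A := [set x | E (x, y)]))//.
by rewrite -ysection_preimage; exact: measurable_ysection.
Qed.

Lemma measurable_scale (c : R) (E : set (V * V)) : measurable E ->
  measurable [set z | E (c *: z.1, z.2)].
Proof.
move=> mE; apply: (measurable_preimage (f := fun z : V * V => (c *: z.1, z.2)) _ mE).
apply: measurable_fun_pair; last exact: measurable_snd.
by apply: measurable_fun_rVZ; [exact: measurable_cst|exact: measurable_fst].
Qed.

Lemma product_scale (c : R) (E : set (V * V)) : 0 < c -> measurable E ->
  M E = ((c ^+ q)%:E * M [set z | E (c *: z.1, z.2)])%E.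
Proof.
move=> c0 mE; have mE' := measurable_scale c mE.
rewrite !product_ysectionE// -ge0_integralZl//; last first.
- by rewrite lee_fin exprn_ge0// ltW.
- by apply: measurable_fun_ysection.
apply: eq_integral => y _.
have my (F : set (V * V)) : measurable F -> measurable [set x | F (x, y)].
  by move=> mF; rewrite -ysection_preimage; exact: measurable_ysection.
rewrite !ysection_preimage !muE//; [|exact: (my [set z | E (c *: z.1, z.2)])|exact: my].
by rewrite -(lebesgue_rV_scale c0 (A := [set x | E (x, y)]))//; exact: my.
Qed.

End lebesgue_product.

Section cone_measure.
Context {R : realType} {q : nat}.
Variable mu : {sigma_finite_measure set 'rV[R]_q -> \bar R}.
Hypothesis muE : forall A, measurable A -> mu A = lebesgue_rV A.
Variable Q : probability 'rV[R]_q R.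
Variable B : set 'rV[R]_q.
Hypotheses (cB : compact B)
  (xB : convex_set (B : set (convex_lmodType 'rV[R]_q)))
  (nB : nbhs (0 : 'rV[R]_q) B).
Hypothesis q0 : (0 < q)%N.
Local Notation V := 'rV[R]_q.
Local Notation M := (mu \x Q)%E.
Local Notation g := (gauge B).
Implicit Types E : set (V * V).

Let mg := measurable_gauge cB xB nB.

Let mg1 : measurable_fun setT (fun z : V * V => g z.1).
Proof. exact: (measurableT_comp mg measurable_fst). Qed.

Lemma measurable_gauge_le (E : set (V * V)) (r : R) : measurable E ->
  measurable [set z | E z /\ g z.1 <= r].
Proof.
move=> mE; apply: (@measurableI _ _ E [set z | g z.1 <= r]) => //.
exact: (measurable_fun_ler_set mg1 (measurable_cst r)).
Qed.

Lemma mu_gauge_le (s : R) : (mu [set x | (g x <= s)%R] < +oo)%E.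
Proof.
have [b b0 Bb] := mem_norm_le cB.
apply: (@mu_bounded _ _ mu muE _ (s * b)).
  exact: (measurable_fun_ler_set mg (measurable_cst s)).
move=> x /= xs; have s0 : 0 <= s := le_trans (gauge_ge0 nB x) xs.
move/(gauge_le cB xB nB x s0) : xs => [y By ->].
by rewrite normrZ ger0_norm// ler_wpM2l// Bb.
Qed.

Lemma product_gauge_le E (s : R) : measurable E ->
  (M [set z | E z /\ (g z.1 <= s)%R] < +oo)%E.
Proof.
move=> mE; apply: (@le_lt_trans _ _ (M ([set x | (g x <= s)%R] `*` setT))).
  apply: le_measure; rewrite ?inE.
  - exact: measurable_gauge_le.
  - by apply: measurableX => //; exact: measurable_fun_ler_set.
  - by move=> z [].
rewrite product_measure1E//; last exact: measurable_fun_ler_set.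
apply: le_lt_trans (mu_gauge_le s); rewrite -[leRHS]mule1.
by apply: lee_wpmul2l => //; exact: probability_le1.
Qed.

Definition cone_measure E : R := fine (M [set z | E z /\ g z.1 <= 1]).

(** A cone in the position, for each value of the mark. *)
Definition is_cone E := forall (c : R) z, 0 < c -> E z -> E (c *: z.1, z.2).

Lemma cone_measureE E : measurable E ->
  M [set z | E z /\ g z.1 <= 1] = (cone_measure E)%:E.
Proof.
by move=> mE; rewrite fineK// ge0_fin_numE// product_gauge_le.
Qed.

(** Dilation by [s] maps the part of the cone with gauge at most 1 onto the part with gauge at most
    [s]. At s = 0 only the position 0 remains, a null set because q > 0. *)
Lemma product_cone E (s : R) : measurable E -> is_cone E -> 0 <= s ->
  M [set z | E z /\ g z.1 <= s] = (s ^+ q * cone_measure E)%:E.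
Proof.
move=> mE cE s0.
have mEs (r : R) := measurable_gauge_le r mE.
have [->|sn0] := eqVneq s 0.
  rewrite expr0n gtn_eqF// mul0r.
  apply/eqP; rewrite eq_le measure_ge0 andbT.
  have m0 : measurable [set (0 : V)] by exact: measurable_set1_rV.
  apply: (@le_trans _ _ (M ([set (0 : V)] `*` setT))).
    apply: le_measure; rewrite ?inE//; first exact: measurableX.
    by move=> z [_ /(gauge_le0 cB xB nB) z0].
  rewrite product_measure1E//.
  have e : mu [set (0 : V)] = 0%E by exact: mu_set1.
  by rewrite [X in (X * _)%E]e mul0e.
have sp : 0 < s by rewrite lt_neqAle eq_sym sn0.
rewrite (product_scale muE Q sp)// EFinM; congr (_ * _)%E.
rewrite -cone_measureE//; congr (M _); apply/seteqP; split => z /= [h1 h2].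
  split; last by move: h2; rewrite (gaugeZ cB xB nB _ (ltW sp)) -[leRHS]mulr1 ler_pM2l.
  rewrite (_ : z = (s^-1 *: (s *: z.1), z.2)).
    by apply: (cE _ (s *: z.1, z.2)) => //; rewrite invr_gt0.
  by rewrite scalerA mulVf// scale1r; case: (z).
split; last by rewrite gaugeZ// ler_piMr.
exact: (cE _ z).
Qed.

Lemma product_cone_shell E (s t : R) : measurable E -> is_cone E -> 0 <= s -> s <= t ->
  M [set z | E z /\ s < g z.1 <= t] = ((t ^+ q - s ^+ q) * cone_measure E)%:E.
Proof.
move=> mE cE s0 st.
have mEs (r : R) := measurable_gauge_le r mE.
have -> : [set z | E z /\ s < g z.1 <= t] =
    [set z | E z /\ g z.1 <= t] `\` [set z | E z /\ g z.1 <= s].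
  apply/seteqP; split => [z [Ez /andP[h1 h2]]|z [[Ez h2] h1]].
    by split => // -[_]; rewrite leNgt h1.
  split => //; apply/andP; split => //.
  by rewrite ltNge; apply/negP => h3; exact: h1.
rewrite measureD//; last exact: product_gauge_le.
rewrite (_ : _ `&` _ = [set z | E z /\ g z.1 <= s]).
  transitivity ((t ^+ q * cone_measure E)%:E - (s ^+ q * cone_measure E)%:E)%E.
    congr (_ - _)%E; first exact: (product_cone mE cE (le_trans s0 st)).
    exact: product_cone.
  by rewrite -EFinB mulrBl.
by apply/seteqP; split => [z []//|z [h1 h2]]; split => //; split => //; exact: le_trans st.
Qed.

Lemma le_cone_measure E F : measurable E -> measurable F -> E `<=` F ->
  cone_measure E <= cone_measure F.
Proof.
move=> mE mF EF; rewrite -lee_fin -!cone_measureE//.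
apply: le_measure; rewrite ?inE.
- exact: measurable_gauge_le.
- exact: measurable_gauge_le.
- by move=> z [/EF].
Qed.

Lemma cone_measure_ge0 E : 0 <= cone_measure E.
Proof. exact: fine_ge0. Qed.

Lemma cone_measure_bigcup (E : nat -> set (V * V)) : (forall n, measurable (E n)) ->
  {homo E : n m / (n <= m)%N >-> n `<=` m} ->
  cone_measure (E n) @[n --> \oo] --> cone_measure (\bigcup_n E n).
Proof.
move=> mE nE; have mU : measurable (\bigcup_n E n) by exact: bigcupT_measurable.
have mI (F : set (V * V)) := @measurable_gauge_le F 1.
apply: fine_cvg; rewrite fineK ?ge0_fin_numE ?product_gauge_le//.
rewrite (_ : [set z | _] = \bigcup_n [set z | E n z /\ g z.1 <= 1]).
  apply: nondecreasing_cvg_mu.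
  - by move=> n; exact: mI.
  - by apply: bigcupT_measurable => n; exact: mI.
  - by move=> n m nm; apply/subsetPset => z [h1 h2]; split => //; exact: nE h1.
apply/seteqP; split => [z [[n _ En] z1]|z [n _ [En z1]]]; first by exists n.
by split => //; exists n.
Qed.

Lemma cone_measure_bigcap0 (E : nat -> set (V * V)) : (forall n, measurable (E n)) ->
  {homo E : n m / (n <= m)%N >-> m `<=` n} -> \bigcap_n E n = set0 ->
  cone_measure (E n) @[n --> \oo] --> 0.
Proof.
move=> mE nE E0.
have mI (F : set (V * V)) := @measurable_gauge_le F 1.
apply: fine_cvg; rewrite -[X in _ --> X](measure0 M).
rewrite (_ : set0 = \bigcap_n [set z | E n z /\ g z.1 <= 1]).
  apply: nonincreasing_cvg_mu.
  - exact: product_gauge_le.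
  - by move=> n; exact: mI.
  - by apply: bigcapT_measurable => n; exact: mI.
  - by move=> n m nm; apply/subsetPset => z [h1 h2]; split => //; exact: nE h1.
apply/seteqP; split => // z h; rewrite -E0 => n _.
by have [] := h n I.
Qed.

End cone_measure.

Lemma exists_invS_le (R : realType) (h : R) : 0 < h -> exists n, n.+1%:R^-1 <= h.
Proof.
move=> h0; exists (Num.truncn h^-1).
rewrite -[leRHS]invrK lef_pV2 ?posrE ?invr_gt0//.
by rewrite ltW// truncnS_gt.
Qed.

(** Continuity of measures is a statement about sequences; monotonicity extends the limit from
    1/(n+1) to real h. *)
Lemma cvg_at_right0_antitone (R : realType) (k : R -> R) (l : R) :
  (forall h h', 0 < h -> h <= h' -> k h' <= k h) ->
  k n.+1%:R^-1 @[n --> \oo] --> l -> k h @[h --> 0^'+] --> l.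
Proof.
move=> kk kl.
have kn n : k n.+1%:R^-1 <= l.
  have nd : nondecreasing_seq (fun n => k n.+1%:R^-1).
    by move=> i j ij; apply: kk => //; rewrite lef_pV2 ?posrE// ler_nat.
  have -> : l = limn (fun n => k n.+1%:R^-1) by apply/esym/cvg_lim.
  by apply: (nondecreasing_cvgn_le nd); apply/cvg_ex; exists l.
have kh h : 0 < h -> k h <= l.
  by move=> h0; have [n nh] := exists_invS_le h0; apply: le_trans (kn n); exact: kk.
apply/cvgrPdist_lt => e e0.
have /cvgrPdist_lt/(_ e e0)[n0 _ H] := kl.
near=> h.
have h0 : 0 < h by [].
have hn : h <= n0.+1%:R^-1 by near: h; exact: nbhs_right_le.
have := H n0 (leqnn _); have := kn n0; have := kh h h0; have := kk h _ h0 hn.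
by rewrite !ltr_norml; lra.
Unshelve. all: by end_near.
Qed.

Lemma cvg_at_right0_monotone (R : realType) (k : R -> R) (l : R) :
  (forall h h', 0 < h -> h <= h' -> k h <= k h') ->
  k n.+1%:R^-1 @[n --> \oo] --> l -> k h @[h --> 0^'+] --> l.
Proof.
move=> kk kl; rewrite -[l]opprK; rewrite (_ : k = fun h => - (- k h)); last first.
  by apply/funext => h; rewrite opprK.
apply: cvgN; apply: cvg_at_right0_antitone; first by move=> h h' h0 hh'; rewrite lerN2 kk.
exact: cvgN.
Qed.

Lemma cvg_difference_quotient_exp (R : realType) (n : nat) (t : R) :
  h^-1 * ((t + h) ^+ n - t ^+ n) @[h --> 0^'+] --> n%:R * t ^+ n.-1.
Proof.
have dX : derivable (fun x : R => x ^+ n) t 1 by exact: exprn_derivable.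
have eX := @exp_derive1 R n t; rewrite derive1E in eX.
have : h^-1 *: ((fun x : R => x ^+ n) (h *: 1 + t) - t ^+ n) @[h --> 0^'] --> n%:R * t ^+ n.-1.
  have := dX; rewrite /derivable => /cvg_ex[l hl].
  have -> : n%:R * t ^+ n.-1 = l.
    have <- : 'D_1 (fun x : R => x ^+ n) t = n%:R * t ^+ n.-1 by exact: eX.
    by rewrite /derive; apply/cvg_lim.
  exact: hl.
move=> /cvg_dnbhs_at_right.
suff -> : (fun h => h^-1 * ((t + h) ^+ n - t ^+ n)) =
    (fun x => x^-1 *: ((x%:A + t) ^+ n - t ^+ n)) by [].
by apply/funext => h; rewrite -[h%:A]/(h * 1) mulr1 (addrC h).
Qed.

Lemma cvg_at_right0_of_rate (R : realType) (f : R -> R) (l : R) :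
  h^-1 * f h @[h --> 0^'+] --> l -> f h @[h --> 0^'+] --> 0.
Proof.
move=> fl.
have h0 : h @[h --> (0 : R)^'+] --> (0 : R) by apply: cvg_at_right_filter; exact: cvg_id.
have H : h * (h^-1 * f h) @[h --> 0^'+] --> 0 * l by exact: cvgM.
rewrite mul0r in H; apply: cvg_trans H; apply: near_eq_cvg; near=> h.
by rewrite /= mulrA mulfV ?mul1r// gt_eqF.
Unshelve. all: by end_near.
Qed.

(** * Rate of the overlap between the shell and a shifted body *)

Section contact_overlap.
Context {R : realType} {q : nat}.
Variable mu : {sigma_finite_measure set 'rV[R]_q -> \bar R}.
Hypothesis muE : forall A, measurable A -> mu A = lebesgue_rV A.
Variable Q : probability 'rV[R]_q R.
Variable B : set 'rV[R]_q.
Hypotheses (cB : compact B)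
  (xB : convex_set (B : set (convex_lmodType 'rV[R]_q)))
  (nB : nbhs (0 : 'rV[R]_q) B).
Hypothesis q0 : (0 < q)%N.
Local Notation V := 'rV[R]_q.
Local Notation M := (mu \x Q)%E.
Local Notation g := (gauge B).

Let mg := measurable_gauge cB xB nB.

(** Convexity of the gauge along a line: the parameters at which it is at most [r] form an
    interval. *)
Lemma gauge_segment (u v : V) (r a b s : R) : a <= s -> s <= b ->
  g (a *: u + v) <= r -> g (b *: u + v) <= r -> g (s *: u + v) <= r.
Proof.
move=> as_ sb ga gb; have [ab|ab] := eqVneq a b.
  by have -> : s = a by lra.
have ba : 0 < b - a by rewrite subr_gt0 lt_neqAle ab (le_trans as_).
pose p := (s - a) / (b - a).
have p0 : 0 <= p by apply: divr_ge0; lra.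
have p1 : p <= 1 by rewrite ler_pdivrMr//; lra.
have -> : s *: u + v = (1 - p) *: (a *: u + v) + p *: (b *: u + v).
  rewrite !scalerDr !scalerA addrACA -!scalerDl subrK scale1r.
  by congr (_ *: _ + _); rewrite /p; field; rewrite subr_eq0 eq_sym.
apply: le_trans (gaugeD cB xB nB _ _) _.
rewrite !(gaugeZ cB xB nB)//; last by lra.
by nra.
Qed.

Definition direction (x : V) : V := (g x)^-1 *: x.

Lemma direction_scale (c : R) (x : V) : 0 < c -> direction (c *: x) = direction x.
Proof.
move=> c0; rewrite /direction gaugeZ ?ltW// scalerA invfM mulrAC mulVf ?mul1r//.
by rewrite gt_eqF.
Qed.

Lemma gauge_direction (x : V) : 0 < g x -> x = g x *: direction x.
Proof. by move=> gx; rewrite /direction scalerA divff ?scale1r// gt_eqF. Qed.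

Lemma gauge_direction1 (x : V) : 0 < g x -> g (direction x) = 1.
Proof.
by move=> gx; rewrite /direction gaugeZ ?invr_ge0 ?ltW// mulVf// gt_eqF.
Qed.

Lemma measurable_direction : measurable_fun setT direction.
Proof.
apply: measurable_fun_rVZ; last exact: measurable_id.
by apply: measurable_funV_ge0 => // x; exact: gauge_ge0.
Qed.

Variables (phi : V -> V) (E : set (V * V)) (t : R).
Hypotheses (mphi : measurable_fun setT phi) (mE : measurable E) (cE : is_cone E)
  (t0 : 0 <= t).

Let f (s : R) (z : V * V) := g (s *: direction z.1 + phi z.2).

Let mf s : measurable_fun setT (f s).
Proof.
apply: (measurableT_comp mg); apply: measurable_fun_rVD.
  apply: measurable_fun_rVZ; first exact: measurable_cst.
  exact: (measurableT_comp measurable_direction measurable_fst).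
exact: (measurableT_comp mphi measurable_snd).
Qed.

Let pos := [set z : V * V | 0 < g z.1].

Let mpos : measurable pos.
Proof.
apply: measurable_fun_ltr_set; first exact: measurable_cst.
exact: (measurableT_comp mg measurable_fst).
Qed.

Let mle s : measurable [set z | f s z <= t].
Proof. exact: (measurable_fun_ler_set (mf s) (measurable_cst t)). Qed.

Let inner (h : R) := E `&` pos `&` ([set z | f t z <= t] `&` [set z | f (t + h) z <= t]).

Let outer (c h : R) := E `&` pos `&` ([set z | t < f t z] `&` [set z | f t z <= t + c * h]).

Let minner h : measurable (inner h).
Proof. by apply: measurableI; apply: measurableI; do ?[exact: mE|exact: mpos|exact: mle]. Qed.

Let mouter c h : measurable (outer c h).
Proof.
apply: measurableI; apply: measurableI; do ?[exact: mE|exact: mpos].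
  exact: (measurable_fun_ltr_set (measurable_cst t) (mf t)).
exact: (measurable_fun_ler_set (mf t) (measurable_cst _)).
Qed.

Let pos_cone (c : R) z : 0 < c -> pos z -> pos (c *: z.1, z.2).
Proof. by move=> c0 /= z0; rewrite /pos/= gaugeZ ?ltW// mulr_gt0. Qed.

Let cinner h : is_cone (inner h).
Proof.
move=> c z c0 [[Ez pz] [/= h1 h2]]; split; first by split; [exact: cE|exact: pos_cone].
by split; rewrite /= /f/= direction_scale.
Qed.

Let couter c' h : is_cone (outer c' h).
Proof.
move=> c z c0 [[Ez pz] [/= h1 h2]]; split; first by split; [exact: cE|exact: pos_cone].
by split; rewrite /= /f/= direction_scale.
Qed.

Let inner_anti (h h' : R) : 0 < h -> h <= h' -> inner h' `<=` inner h.
Proof.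
move=> h0 hh' z [Ez [/= h1 h2]]; split => //; split => //=.
by apply: gauge_segment h1 h2; lra.
Qed.

Let kappaI := cone_measure mu Q B (\bigcup_n inner n.+1%:R^-1).

Let cvg_inner : cone_measure mu Q B (inner h) @[h --> 0^'+] --> kappaI.
Proof.
apply: cvg_at_right0_antitone.
  by move=> h h' h0 hh'; apply: (le_cone_measure muE Q cB xB nB);
    [exact: minner|exact: minner|exact: inner_anti].
apply: (cone_measure_bigcup muE cB xB nB); first by move=> n; exact: minner.
move=> i j ij; apply: inner_anti; first by rewrite invr_gt0.
by rewrite lef_pV2 ?posrE// ler_nat.
Qed.

Let outer_mono (c h h' : R) : 0 < c -> 0 < h -> h <= h' -> outer c h `<=` outer c h'.
Proof.
move=> c0 h0 hh' z [Ez [/= h1 h2]]; split => //; split => //=.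
by apply: le_trans h2 _; rewrite lerD2l ler_pM2l.
Qed.

(** The sets [outer c h] decrease to the empty set, since they demand t < f t z strictly. *)
Let cvg_outer (c : R) : 0 < c -> cone_measure mu Q B (outer c h) @[h --> 0^'+] --> 0.
Proof.
move=> c0; apply: cvg_at_right0_monotone.
  by move=> h h' h0 hh'; apply: (le_cone_measure muE Q cB xB nB);
    [exact: mouter|exact: mouter|exact: outer_mono].
apply: (cone_measure_bigcap0 muE Q cB xB nB); first by move=> n; exact: mouter.
  move=> i j ij; apply: outer_mono => //.
  by rewrite lef_pV2 ?posrE// ler_nat.
apply/seteqP; split => // z H.
have [_ [/= tz _]] := H 0%N I.
(* Half of the gap f t z - t, so that c/(n+1) cannot bridge it. *)
have [|n nh] := @exists_invS_le R ((f t z - t) / (c *+ 2)).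
  by rewrite divr_gt0 ?mulrn_wgt0// subr_gt0.
have [_ [_ fz]] := H n I.
have {}tz : t < f t z := tz; have {}fz : f t z <= t + c * n.+1%:R^-1 := fz.
have : c * n.+1%:R^-1 <= c * ((f t z - t) / (c *+ 2)) by rewrite ler_pM2l.
rewrite (_ : c * ((f t z - t) / (c *+ 2)) = (f t z - t) / 2).
  by move: (f t z) (c * n.+1%:R^-1) tz fz => r b ? ? ?; lra.
by rewrite -mulr_natr; field; rewrite gt_eqF.
Qed.

(** [phi] will be the identity when the parent is in the shell and the secondary point in the body,
    and the opposite, after a shear, when the roles are exchanged. *)
Definition overlap (h : R) : set (V * V) :=
  [set z | (E z /\ t < g z.1 <= t + h) /\ g (z.1 + phi z.2) <= t].

Lemma measurable_overlap h : measurable (overlap h).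
Proof.
rewrite (_ : overlap h = E `&` [set z | t < g z.1] `&` [set z | g z.1 <= t + h] `&`
    [set z | g (z.1 + phi z.2) <= t]).
  have mg1 : measurable_fun setT (fun z : V * V => g z.1).
    exact: (measurableT_comp mg measurable_fst).
  apply: measurableI; last first.
    apply: (measurable_fun_ler_set _ (measurable_cst t)).
    apply: (measurableT_comp mg); apply: measurable_fun_rVD => //.
    exact: (measurableT_comp mphi measurable_snd).
  apply: measurableI; last exact: (measurable_fun_ler_set mg1 (measurable_cst _)).
  by apply: measurableI => //; exact: (measurable_fun_ltr_set (measurable_cst _) mg1).
by apply/seteqP; split => z => [[[Ez /andP[h1 h2]] h3]//|[[[Ez h1] h2] h3]];
  split => //; split => //; apply/andP.
Qed.

(* Write [x = s *: u] with [u] in a fixed direction. By convexity, the [s] in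
   [(t, t + h]] with [s *: u + phi y] in the dilated body include all of them if
   both end points qualify ([inner h]); if some qualify, then [u] is in the limit
   of [inner h] or [t *: u + phi y] is close to the body without being in it
   ([outer c h], a vanishing cone). *)
Lemma overlap_cvg : cvg (h^-1 * fine (M (overlap h)) @[h --> 0^'+]).
Proof.
have [c c0 gN] := gaugeN cB xB nB.
have shE (F : set (V * V)) h : measurable F -> is_cone F -> 0 < h ->
    M [set z | F z /\ t < g z.1 <= t + h] =
    (((t + h) ^+ q - t ^+ q) * cone_measure mu Q B F)%:E.
  by move=> mF cF h0; apply: product_cone_shell => //; lra.
pose U := \bigcup_n inner n.+1%:R^-1.
have mU : measurable U by apply: bigcupT_measurable => n; exact: minner.
have cU : is_cone U.
  by move=> s z s0 [n _ Hn]; exists n => //; exact: cinner.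
have mover h := measurable_overlap h.
have fin h : 0 < h -> M (overlap h) \is a fin_num.
  move=> h0; rewrite ge0_fin_numE//.
  apply: le_lt_trans (product_gauge_le muE Q cB xB nB (t + h) mE).
  apply: le_measure; rewrite ?inE//; first exact: measurable_gauge_le.
  by move=> z [[Ez /andP[_ h2]] _].
have mshell (F : set (V * V)) h : measurable F ->
    measurable [set z | F z /\ t < g z.1 <= t + h].
  move=> mF.
  have mg1 : measurable_fun setT (fun z : V * V => g z.1).
    exact: (measurableT_comp mg measurable_fst).
  rewrite (_ : [set z | _] = F `&` [set z | t < g z.1] `&` [set z | g z.1 <= t + h]).
    apply: measurableI; last exact: (measurable_fun_ler_set mg1 (measurable_cst _)).
    by apply: measurableI => //; exact: (measurable_fun_ltr_set (measurable_cst _) mg1).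
  by apply/seteqP; split => z => [[Ez /andP[h1 h2]]//|[[Ez h1] h2]];
    split => //; apply/andP.
have lo h : 0 < h ->
    ((t + h) ^+ q - t ^+ q) * cone_measure mu Q B (inner h) <= fine (M (overlap h)).
  move=> h0; rewrite -lee_fin fineK ?fin// -(shE _ h (minner h) (@cinner h) h0).
  apply: le_measure; rewrite ?inE//; first exact: (mshell _ _ (minner h)).
  move=> z [[[Ez pz] [/= h1 h2]] /andP[h3 h4]]; split; first by split => //; apply/andP.
  rewrite (gauge_direction pz); apply: gauge_segment h1 h2 => //.
  exact: ltW.
have hi h : 0 < h -> fine (M (overlap h)) <= ((t + h) ^+ q - t ^+ q) * kappaI +
    ((t + h) ^+ q - t ^+ q) * cone_measure mu Q B (outer c h).
  move=> h0; rewrite -lee_fin fineK ?fin// EFinD -(shE _ h mU cU h0).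
  rewrite -(shE _ h (mouter c h) (@couter c h) h0).
  apply: (@le_trans _ _ (M ([set z | U z /\ t < g z.1 <= t + h] `|`
                            [set z | outer c h z /\ t < g z.1 <= t + h]))).
    apply: le_measure; rewrite ?inE//.
      by apply: measurableU; apply: mshell; [exact: mU|exact: mouter].
    move=> z [[Ez /andP[h1 h2]] h3].
    have pz : pos z by exact: le_lt_trans h1.
    rewrite (gauge_direction pz) in h3.
    have [ftz|ftz] := leP (f t z) t.
      left; split; last by apply/andP.
      (* Both radii t and [g z.1] qualify, hence so does t + 1/(n+1) between them. *)
      have [n nh] := @exists_invS_le R (g z.1 - t) (ltac:(lra)).
      exists n => //; split => //; split => //=.
      have n0 : 0 < n.+1%:R^-1 :> R by rewrite invr_gt0.
      by move: (n.+1%:R^-1) n0 nh => b b0 nh; apply: gauge_segment ftz h3; lra.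
    right; split; last by apply/andP.
    split => //; split => //=.
    rewrite /f; set u := direction z.1.
    (* Moving back along [u] from radius [g z.1] to t costs at most h times the gauge of -u, which
       is at most c because [u] has gauge 1. *)
    rewrite (_ : t *: u + phi z.2 = (g z.1 *: u + phi z.2) + (g z.1 - t) *: (- u)).
      apply: le_trans (gaugeD cB xB nB _ _) _; apply: lerD => //.
      rewrite (gaugeZ cB xB nB); last by lra.
      have := gN u; rewrite (gauge_direction1 pz) mulr1 => gu.
      have : (g z.1 - t) * g (- u) <= h * c.
        by apply: ler_pM => //; [lra|exact: gauge_ge0|lra].
      by rewrite (mulrC c).
    by rewrite scalerN scalerBl; apply/rowP => i; rewrite !mxE; ring.
  by apply: measureU2; apply: mshell; [exact: mU|exact: mouter].
pose dq h : R := h^-1 * ((t + h) ^+ q - t ^+ q).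
have dqc : dq h @[h --> 0^'+] --> q%:R * t ^+ q.-1 by exact: cvg_difference_quotient_exp.
apply/cvg_ex; exists (q%:R * t ^+ q.-1 * kappaI).
apply: (@squeeze_cvgr _ _ _ _ (fun h => dq h * cone_measure mu Q B (inner h))
   (fun h => dq h * (kappaI + cone_measure mu Q B (outer c h)))).
- near=> h; have h0 : 0 < h by [].
  rewrite /dq -!mulrA !ler_pM2l ?invr_gt0//; apply/andP; split; first exact: lo.
  by rewrite mulrDr; exact: hi.
- exact: cvgM.
- apply: cvgM => //; rewrite -[X in _ --> X]addr0; apply: cvgD; first exact: cvg_cst.
  exact: cvg_outer.
Unshelve. all: by end_near.
Qed.

End contact_overlap.

Lemma measurable_setC10 (R : realType) (q : nat) : measurable [set~ (0 : 'rV[R]_q)].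
Proof. by apply: measurableC; exact: measurable_set1_rV. Qed.

(** * Pairs with both points in a small set, and the decomposition of hits *)

Section two_in_set.
Context {R : realType} {q : nat}.
Variable mu : {sigma_finite_measure set 'rV[R]_q -> \bar R}.
Hypothesis muE : forall A, measurable A -> mu A = lebesgue_rV A.
Variable Q : probability 'rV[R]_q R.
Local Notation V := 'rV[R]_q.
Local Notation M := (mu \x Q)%E.
Hypothesis acQ : forall A : set V, measurable A -> ~ A 0 -> mu A = 0%E -> Q A = 0%E.

(** Otherwise some A_n have mu(A_n) <= 2^-(n+1) and Q(A_n) > e. Their limsup is mu-null by
    Borel-Cantelli, avoids 0, and has Q-measure at least e because Q is finite: a contradiction. *)
Lemma ac_epsilon (e : R) : 0 < e -> exists2 r : R, 0 < r &
  forall A : set V, measurable A -> ~ A 0 -> (mu A <= r%:E)%E -> (Q A <= e%:E)%E.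
Proof.
move=> e0; apply: contrapT => H.
have HA n : exists A : set V, [/\ measurable A, ~ A 0,
    (mu A <= (1 / (2 ^ n.+1)%:R)%:E)%E & (e%:E < Q A)%E].
  apply: contrapT => h; apply: H; exists (1 / (2 ^ n.+1)%:R).
    by rewrite divr_gt0// ltr0n expn_gt0.
  move=> A mA A0 muA; rewrite leNgt; apply/negP => QA.
  by apply: h; exists A.
have [A HA'] := choice HA.
have mA n : measurable (A n) by have [] := HA' n.
have mL : measurable (lim_sup_set A).
  by apply: bigcapT_measurable => n; exact: bigcup_measurable.
have L0 : ~ lim_sup_set A 0.
  by move=> /(_ 0%N I)[n _]; have [] := HA' n.
have muL : mu (lim_sup_set A) = 0%E.
  apply: lim_sup_set_cvg0 => //.
  apply: le_lt_trans (ltry 1); apply: le_trans (@epsilon_trick0 R 1 xpredT ler01).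
  by apply: lee_nneseries => n _ //; have [] := HA' n.
have := acQ mL L0 muL; apply/eqP; rewrite gt_eqF//.
apply: (@lt_le_trans _ _ e%:E); first by rewrite lte_fin.
have mU n : measurable (\bigcup_(k in [set k | (n <= k)%N]) A k) by exact: bigcup_measurable.
have h : Q (\bigcup_(k in [set k | (n <= k)%N]) A k) @[n --> \oo] --> Q (lim_sup_set A).
  apply: lim_sup_set_cvg => //.
  by apply: (le_lt_trans (probability_le1 Q (mU 0%N))); rewrite ltry.
rewrite -(cvg_lim _ h)//; apply: lime_ge; first by apply/cvg_ex; exists (Q (lim_sup_set A)).
apply: nearW => n; have [_ _ _ /ltW eQ] := HA' n; apply: le_trans eQ _.
by apply: le_measure; rewrite ?inE//; apply: (bigcup_sup (i := n)) => /=.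
Qed.

Definition both_in (S : set V) : set (V * V) :=
  [set z | [/\ S z.1, S (z.1 + z.2) & z.2 <> 0]].

Lemma measurable_add_preimage (S : set V) : measurable S ->
  measurable [set z : V * V | S (z.1 + z.2)].
Proof.
move=> mS; apply: (measurable_preimage (f := fun z : V * V => z.1 + z.2) _ mS).
by apply: measurable_fun_rVD; [exact: measurable_fst|exact: measurable_snd].
Qed.

Lemma measurable_fst_preimage (S : set V) : measurable S ->
  measurable [set z : V * V | S z.1].
Proof. exact: (measurable_preimage measurable_fst). Qed.

Lemma measurable_snd_neq0 : measurable [set z : V * V | z.2 <> 0].
Proof.
apply: (measurable_preimage (f := @snd V V) (A := [set~ 0]) measurable_snd).
exact: measurable_setC10.
Qed.

Lemma measurable_both_in S : measurable S -> measurable (both_in S).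
Proof.
move=> mS; rewrite (_ : both_in S = [set z | S z.1] `&` [set z | S (z.1 + z.2)] `&`
    [set z | z.2 <> 0]); last by apply/seteqP; split => z [] // [].
apply: measurableI; last exact: measurable_snd_neq0.
by apply: measurableI; [exact: measurable_fst_preimage|exact: measurable_add_preimage].
Qed.

(** For x in S the admissible marks lie in S - x, which has the small measure of S and so Q-measure
    at most e. Integrate over x in S. *)
Lemma both_in_small (e : R) : 0 < e -> exists2 r : R, 0 < r &
  forall S : set V, measurable S -> (mu S <= r%:E)%E ->
    (M (both_in S) <= e%:E * mu S)%E.
Proof.
move=> e0; have [r r0 Hr] := ac_epsilon e0; exists r => // S mS muS.
have mB := measurable_both_in mS.
rewrite (_ : (e%:E * mu S)%E = \int[mu]_x (e%:E * (\1_S x)%:E))%E; last first.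
  rewrite ge0_integralZl//; last 2 first.
  - by apply/measurable_EFinP; exact: measurable_indic.
  - by rewrite lee_fin ltW.
  by rewrite integral_indic// setIT.
apply: le_integral_ge0 => x _ //=.
have mx := measurable_xsection x mB.
have xE : xsection (both_in S) x = [set y | [/\ S x, S (x + y) & y <> 0]].
  by rewrite xsectionE.
rewrite indicE; have [Sx|Sx] := boolP (x \in S); last first.
  rewrite (_ : xsection _ _ = set0) ?measure0 ?mule0//.
  rewrite xE; apply/seteqP; split => // y [Sx' _ _].
  by move: Sx; rewrite notin_setE.
rewrite mule1; apply: Hr => //; first by rewrite xE => -[].
apply: le_trans muS; rewrite -(mu_translate muE x mS); apply: le_measure; rewrite ?inE//.
  exact: measurable_translate.
by rewrite xE => y [_ Sxy _] /=; rewrite addrC.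
Qed.

(** The set T_h of the overview when S is the shell and K the body t B. With K empty it consists of
    the pairs touching S. *)
Definition uncovered (S K : set V) : set (V * V) :=
  [set z | [/\ ~ K z.1, ~ K (z.1 + z.2) & S z.1 \/ S (z.1 + z.2)]].

Definition second_covered (S K : set V) : set (V * V) :=
  [set z | [/\ S z.1, K (z.1 + z.2) & z.2 <> 0]].

Definition first_covered (S K : set V) : set (V * V) :=
  [set z | [/\ S (z.1 + z.2), K z.1 & z.2 <> 0]].

(** Inclusion-exclusion. The right side counts the points of pairs in S, a pair with mark 0 having a
    single point; by the shear the secondary points contribute like the parents. Removed are the
    points of S whose partner is in K, and one point of each pair inside S. The additive form avoids
    subtraction in the extended reals. *)
Lemma hit_decomposition (S K : set V) : measurable S -> measurable K ->
  S `&` K = set0 ->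
  (M (uncovered S K) +
   (M (second_covered S K) + M (first_covered S K) + M (both_in S)) =
   mu S * (1 + Q [set~ (0%R : V)]))%E.
Proof.
move=> mS mK SK.
have m0C := @measurable_setC10 R q.
have mS1 := measurable_fst_preimage mS; have mS2 := measurable_add_preimage mS.
have mK1 := measurable_fst_preimage mK; have mK2 := measurable_add_preimage mK.
have m0 := measurable_snd_neq0.
(* [A1], [A2]: the first or second point is in S; [D1], [D2]: its partner is in K. As S and K are
   disjoint, both points in S means being in both differences. *)
pose A1 := [set z : V * V | S z.1].
pose A2 := [set z : V * V | S (z.1 + z.2)] `&` [set z | z.2 <> 0].
pose D1 := [set z : V * V | K (z.1 + z.2)] `&` [set z | z.2 <> 0].
pose D2 := [set z : V * V | K z.1] `&` [set z | z.2 <> 0].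
have mA2 : measurable A2 by exact: measurableI.
have mD1 : measurable D1 by exact: measurableI.
have mD2 : measurable D2 by exact: measurableI.
have noSK x : S x -> K x -> False.
  by move=> Sx Kx; have : (S `&` K) x by []; rewrite SK.
have MA1 : M A1 = mu S.
  rewrite (_ : A1 = S `*` setT); last by apply/seteqP; split => z // [].
  have -> : M (S `*` setT) = (mu S * Q setT)%E by rewrite /= product_measure1E.
  rewrite [X in (_ * X)%E](_ : _ = 1%E) ?mule1//; exact: probability_setT.
have MA2 : M A2 = (mu S * Q [set~ (0%R : V)])%E.
  have <- : M (S `*` [set~ (0%R : V)]) = (mu S * Q [set~ (0%R : V)])%E by rewrite /= product_measure1E.
  by rewrite -(product_shear muE Q (E := S `*` [set~ (0%R : V)])) //; exact: measurableX.
have e1 : M (second_covered S K) = M (A1 `&` D1).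
  by congr (M _); apply/seteqP; split => z [] // ? [].
have e2 : M (first_covered S K) = M (A2 `&` D2).
  by congr (M _); apply/seteqP; split => z /= [] // [? ?] [].
have e3 : M (both_in S) = M ((A2 `\` D2) `&` (A1 `\` D1)).
  congr (M _); apply/seteqP; split => z.
    move=> [h1 h2 h3]; split; first by split => // -[/= k _]; exact: noSK k.
    by split => // -[/= k _]; exact: noSK k.
  by move=> [[[h1 h2] _] [h3 _]].
have e4 : M (uncovered S K) = M ((A1 `\` D1) `|` ((A2 `\` D2) `\` (A1 `\` D1))).
  congr (M _); apply/seteqP; split => z.
    move=> [k1 k2 h].
    have [h1|h1] := pselect (S z.1); first by left; split => // -[].
    right; split; last by move=> [].
    have h2 : S (z.1 + z.2) by case: h.
    split; last by move=> [].
    by split => //= z0; apply: h1; rewrite z0 addr0 in h2.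
  move=> [[h1 h2]|[[[h1 h3] h2] _]].
    have k1 : ~ K z.1 by exact: noSK.
    split => //; last by left.
    have [->|/eqP z0] := eqVneq z.2 0; first by rewrite addr0.
    by move=> k2; apply: h2.
  split; last by right.
    by move=> k; apply: h2.
  exact: noSK.
rewrite ge0_muleDr// mule1 -{1}MA1 -MA2 e1 e2 e3 e4.
have mX : measurable (A1 `\` D1) by exact: measurableD.
have mY : measurable (A2 `\` D2) by exact: measurableD.
have -> : M ((A1 `\` D1) `|` ((A2 `\` D2) `\` (A1 `\` D1))) =
    (M (A1 `\` D1) + M ((A2 `\` D2) `\` (A1 `\` D1)))%E.
  by apply: measureU => //; [exact: measurableD|rewrite setDIK].
have -> : M A1 = (M (A1 `\` D1) + M (A1 `&` D1))%E by exact: measureDI.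
have -> : M A2 = (M (A2 `\` D2) + M (A2 `&` D2))%E by exact: measureDI.
have -> : M (A2 `\` D2) = (M ((A2 `\` D2) `\` (A1 `\` D1)) +
    M ((A2 `\` D2) `&` (A1 `\` D1)))%E by exact: measureDI.
move: (M (A1 `\` D1)) (M ((A2 `\` D2) `\` (A1 `\` D1))) (M (A1 `&` D1)) => a b c.
move: (M (A2 `&` D2)) (M ((A2 `\` D2) `&` (A1 `\` D1))) => d e.
by rewrite -!addeA; congr (a + _)%E; rewrite addeCA; congr (c + (b + _))%E; rewrite addeC.
Qed.

End two_in_set.

(** * Rates of the shell and of the pairs that meet it *)

Section shell_rates.
Context {R : realType} {q : nat}.
Variable mu : {sigma_finite_measure set 'rV[R]_q -> \bar R}.
Hypothesis muE : forall A, measurable A -> mu A = lebesgue_rV A.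
Variable Q : probability 'rV[R]_q R.
Variable B : set 'rV[R]_q.
Hypotheses (cB : compact B)
  (xB : convex_set (B : set (convex_lmodType 'rV[R]_q)))
  (nB : nbhs (0 : 'rV[R]_q) B).
Hypothesis q0 : (0 < q)%N.
Local Notation V := 'rV[R]_q.
Local Notation M := (mu \x Q)%E.
Local Notation g := (gauge B).
Variables (t : R) (C : set V).
Hypotheses (t0 : 0 <= t) (mC : measurable C).

Let mg := measurable_gauge cB xB nB.

(** The minus sign comes from u_B(Z, 0) = (0 - y) / d_B(0, Z) at a contact point y. *)
Definition shell (h : R) : set V :=
  [set x | t < g x <= t + h /\ C (- direction B x)].

Definition dilated : set V := [set x | g x <= t].

Lemma measurable_dilated : measurable dilated.
Proof. exact: (measurable_fun_ler_set mg (measurable_cst t)). Qed.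

Let E : set (V * V) := [set z | C (- direction B z.1)].

Let mdir1 : measurable_fun setT (fun z : V * V => - direction B z.1).
Proof.
apply: measurable_fun_rVN.
exact: (measurableT_comp (measurable_direction cB xB nB) measurable_fst).
Qed.

Let mE : measurable E.
Proof. exact: (measurable_preimage mdir1). Qed.

Let cE : is_cone E.
Proof. by move=> c z c0 Ez; rewrite /E/= (direction_scale cB xB nB). Qed.

Lemma measurable_shell h : measurable (shell h).
Proof.
rewrite (_ : shell h = [set x | t < g x] `&` [set x | g x <= t + h] `&`
    [set x | C (- direction B x)]).
  apply: measurableI; last first.
    apply: (measurable_preimage _ mC); apply: measurable_fun_rVN.
    exact: measurable_direction.
  apply: measurableI; first exact: (measurable_fun_ltr_set (measurable_cst t) mg).
  exact: (measurable_fun_ler_set mg (measurable_cst _)).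
by apply/seteqP; split => x [] // => [/andP[h1 h2] h3|[h1 h2] h3]; split => //; apply/andP.
Qed.

Lemma shell_dilated h : shell h `&` dilated = set0.
Proof.
by apply/seteqP; split => // x [[/andP[h1 _] _] h2]; move: h2; rewrite /dilated/= leNgt h1.
Qed.

Lemma mu_dilated : (mu dilated < +oo)%E.
Proof. exact: (mu_gauge_le muE cB xB nB). Qed.

Let kappa := cone_measure mu Q B E.

Lemma mu_shell h : 0 <= h -> mu (shell h) = (((t + h) ^+ q - t ^+ q) * kappa)%:E.
Proof.
move=> h0; have th : t <= t + h by rewrite lerDl.
rewrite -(product_cone_shell muE Q cB xB nB q0 mE cE t0 th).
rewrite (_ : [set z | _] = shell h `*` setT).
  have -> : M (shell h `*` setT) = (mu (shell h) * Q setT)%E.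
    by rewrite /= product_measure1E//; exact: measurable_shell.
  rewrite [X in (_ * X)%E](_ : _ = 1%E) ?mule1//; exact: probability_setT.
by apply/seteqP; split => z [] // [].
Qed.

Let dq h : R := h^-1 * ((t + h) ^+ q - t ^+ q).

Lemma cvg_shell_rate :
  h^-1 * fine (mu (shell h)) @[h --> 0^'+] --> q%:R * t ^+ q.-1 * kappa.
Proof.
have : dq h * kappa @[h --> 0^'+] --> q%:R * t ^+ q.-1 * kappa.
  by apply: cvgM; [exact: cvg_difference_quotient_exp|exact: cvg_cst].
apply: cvg_trans; apply: near_eq_cvg; near=> h.
by rewrite mu_shell// /dq mulrA.
Unshelve. all: by end_near.
Qed.

Lemma cvg_shell0 : fine (mu (shell h)) @[h --> 0^'+] --> 0.
Proof. exact: cvg_at_right0_of_rate cvg_shell_rate. Qed.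

Lemma cvg_shell_sqr : h^-1 * fine (mu (shell h)) ^+ 2 @[h --> 0^'+] --> 0.
Proof.
have H : (h^-1 * fine (mu (shell h))) * fine (mu (shell h)) @[h --> 0^'+] -->
    (q%:R * t ^+ q.-1 * kappa) * 0.
  by apply: cvgM; [exact: cvg_shell_rate|exact: cvg_shell0].
rewrite mulr0 in H; apply: cvg_trans H; apply: near_eq_cvg; near=> h.
by rewrite /= expr2 mulrA.
Unshelve. all: by end_near.
Qed.

Hypothesis acQ : forall A : set V, measurable A -> ~ A 0 -> mu A = 0%E -> Q A = 0%E.

Lemma cvg_both_in_shell : h^-1 * fine (M (both_in (shell h))) @[h --> 0^'+] --> 0.
Proof.
have mB h := measurable_both_in (measurable_shell h).
apply/cvgrPdist_le => e e0.
pose l := q%:R * t ^+ q.-1 * kappa.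
have l0 : 0 <= l by rewrite !mulr_ge0 ?exprn_ge0// cone_measure_ge0.
have l1 : 0 < l + 1 by lra.
(* mu(shell) / h tends to l and is eventually at most l + 1. *)
pose e' := e / (l + 1).
have e'0 : 0 < e' by rewrite divr_gt0.
have [r r0 Hr] := both_in_small muE acQ e'0.
near=> h.
have h0 : 0 < h by [].
have hl : h^-1 * fine (mu (shell h)) <= l + 1.
  by near: h; apply: cvgr_le cvg_shell_rate _ _; rewrite /l; lra.
have hr : fine (mu (shell h)) <= r by near: h; exact: cvgr_le cvg_shell0 _ _.
have muf : mu (shell h) = (fine (mu (shell h)))%:E by rewrite mu_shell// ltW.
have := Hr _ (measurable_shell h); rewrite muf lee_fin => /(_ hr) Mle.
have Mf : M (both_in (shell h)) \is a fin_num.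
  by rewrite ge0_fin_numE//; apply: le_lt_trans Mle _; rewrite -EFinM ltry.
rewrite -(fineK Mf) -EFinM lee_fin in Mle.
rewrite sub0r normrN ger0_norm; last by rewrite mulr_ge0 ?fine_ge0// invr_ge0 ltW.
apply: (@le_trans _ _ (e' * (h^-1 * fine (mu (shell h))))).
  by rewrite mulrCA ler_pM2l ?invr_gt0.
by apply: (@le_trans _ _ (e' * (l + 1))); [rewrite ler_pM2l|rewrite /e' divfK ?gt_eqF].
Unshelve. all: by end_near.
Qed.

Lemma second_coveredE h : second_covered (shell h) dilated =
  overlap B id (E `&` [set z | z.2 <> 0]) t h.
Proof.
by apply/seteqP; split => z; [move=> [[h1 h2] h3 h4]|move=> [[[h1 h2] h3] h4]].
Qed.

(** The shear makes the secondary point x + y the base point; the parent is recovered by subtracting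
    the mark. *)
Lemma first_coveredE h : M (first_covered (shell h) dilated) =
  M (overlap B (fun y => - y) (E `&` [set z | z.2 <> 0]) t h).
Proof.
rewrite -[RHS](product_shear muE); last first.
  apply: (measurable_overlap cB xB nB).
  - exact: (@measurable_fun_rVN _ _ _ _ id (@measurable_id _ _ _)).
  - by apply: measurableI => //; exact: measurable_snd_neq0.
congr (M _); apply/seteqP; split => z.
  by move=> [[h1 h2] h3 h4]; rewrite /overlap/= addrK.
by rewrite /overlap/= addrK => -[[[h1 h2] h3] h4].
Qed.

Lemma hit_decomposition_shell h : 0 <= h ->
  fine (M (uncovered (shell h) dilated)) =
  fine (mu (shell h)) * (1 + fine (Q [set~ (0 : V)])) -
  (fine (M (second_covered (shell h) dilated)) +
   fine (M (first_covered (shell h) dilated)) + fine (M (both_in (shell h)))).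
Proof.
move=> h0.
have := hit_decomposition muE Q (measurable_shell h) measurable_dilated (shell_dilated h).
have Qf : Q [set~ (0 : V)] \is a fin_num.
  by apply: fin_num_measure; exact: measurable_setC10.
have muf : mu (shell h) = (fine (mu (shell h)))%:E by rewrite mu_shell.
rewrite {1}muf -{1}(fineK Qf) -EFinD -EFinM => e.
have le (x y : \bar R) r : (0 <= x)%E -> (0 <= y)%E -> (x + y = r%:E)%E ->
    x \is a fin_num /\ y \is a fin_num.
  by case: x y => [x| |] [y| |].
have [f1 f2] := le _ _ _ (measure_ge0 _ _)
  (adde_ge0 (adde_ge0 (measure_ge0 _ _) (measure_ge0 _ _)) (measure_ge0 _ _)) e.
have := f2; rewrite fin_numD => /andP[]; rewrite fin_numD => /andP[f3 f4] f5.
move: e; rewrite -(fineK f1) -(fineK f3) -(fineK f4) -(fineK f5) -!EFinD => -[<-].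
by rewrite /= addrK.
Qed.

(** Existence of this limit makes [hazard] meaningful. In the decomposition of hits the shell term
    and both overlap terms converge, and the pairs inside the shell are negligible. *)
Lemma cvg_uncovered_rate :
  cvg (h^-1 * fine (M (uncovered (shell h) dilated)) @[h --> 0^'+]).
Proof.
have mE0 : measurable (E `&` [set z | z.2 <> 0]).
  by apply: measurableI => //; exact: measurable_snd_neq0.
have cE0 : is_cone (E `&` [set z | z.2 <> 0]).
  by move=> c z c0 [Ez z2]; split => //; exact: cE.
have /cvg_ex[l1 H1] : cvg (h^-1 *
    fine (M (overlap B id (E `&` [set z | z.2 <> 0]) t h)) @[h --> 0^'+]).
  exact: (overlap_cvg muE cB xB nB q0 (@measurable_id _ _ setT) mE0 cE0 t0).
have /cvg_ex[l2 H2] : cvg (h^-1 *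
    fine (M (overlap B (fun y => - y) (E `&` [set z | z.2 <> 0]) t h)) @[h --> 0^'+]).
  apply: (overlap_cvg muE cB xB nB q0 _ mE0 cE0 t0).
  exact: (@measurable_fun_rVN _ _ _ _ id (@measurable_id _ _ _)).
have H3 := cvg_both_in_shell.
pose k := 1 + fine (Q [set~ (0 : V)]); pose l0 := q%:R * t ^+ q.-1 * kappa.
have H0 : (h^-1 * fine (mu (shell h))) * k @[h --> 0^'+] --> l0 * k.
  by apply: cvgM; [exact: cvg_shell_rate|exact: cvg_cst].
have H : (h^-1 * fine (mu (shell h))) * k -
    (h^-1 * fine (M (overlap B id (E `&` [set z | z.2 <> 0]) t h)) +
     h^-1 * fine (M (overlap B (fun y => - y) (E `&` [set z | z.2 <> 0]) t h)) +
     h^-1 * fine (M (both_in (shell h)))) @[h --> 0^'+] --> l0 * k - (l1 + l2 + 0).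
  by apply: cvgB => //; apply: cvgD => //; apply: cvgD.
apply/cvg_ex; exists (l0 * k - (l1 + l2 + 0)); apply: cvg_trans H; apply: near_eq_cvg; near=> h.
rewrite hit_decomposition_shell// second_coveredE first_coveredE /k.
by ring.
Unshelve. all: by end_near.
Qed.

End shell_rates.

(** * Existence of the hazard *)

Section isolated_nearest_point.
Context {R : realType} {q : nat}.
Variable B : set 'rV[R]_q.
Hypotheses (cB : compact B)
  (xB : convex_set (B : set (convex_lmodType 'rV[R]_q)))
  (nB : nbhs (0 : 'rV[R]_q) B).
Local Notation V := 'rV[R]_q.
Local Notation g := (gauge B).
Variables (u0 : V) (K : set V) (t r : R).
Hypotheses (t0 : 0 <= t)
  (K1 : forall x y, K x -> K y -> t < g x <= r -> t < g y <= r -> x = y).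

(* Uniqueness in the shell also rules out that the infimum defining the
   distance is not attained. *)
Lemma nearest_point y : (forall x, K x -> t < g x) -> K y -> g y <= r ->
  dist_rel B 0 K = (g y)%:E /\ dir_rel B u0 K 0 = - direction B y.
Proof.
move=> Kt Ky yr; have ty := Kt _ Ky.
have ymin x : K x -> g x <= g y -> x = y.
  move=> Kx xy; apply: K1 => //; apply/andP; split => //; first exact: Kt.
  exact: le_trans yr.
have dE : dist_rel B 0 K = (g y)%:E.
  apply/eqP; rewrite eq_le; apply/andP; split; last first.
    apply/(dist_rel_geP cB xB nB) => x Kx.
    by have [xy|/ltW//] := leP (g x) (g y); rewrite (ymin x).
  apply/lee_addgt0Pr => e e0; rewrite -EFinD.
  by apply/ltW/(dist_rel_ltP cB xB nB); exists y => //; rewrite ltrDl.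
have gy0 : 0 < g y by exact: le_lt_trans ty.
have cE : contact B K 0 = [set y].
  rewrite (contactE cB xB nB) dE/=; apply/seteqP; split => [x [Kx xy]|x ->//].
  exact: ymin.
split => //; rewrite /dir_rel asboolT.
  rewrite cE dE/= (_ : xget 0 [set y] = y); last exact: xget_unique.
  by rewrite /direction sub0r scalerN.
by rewrite dE lte_fin gy0 ltry; split => //; exists y.
Qed.

Lemma dist_rel_le_isolated (s : R) : s < r -> t <= s ->
  (dist_rel B 0 K <= s%:E)%E <-> exists2 y, K y & g y <= s.
Proof.
move=> sr ts; split => [ds|[y Ky ys]]; last first.
  apply/lee_addgt0Pr => e e0; rewrite -EFinD; apply/ltW/(dist_rel_ltP cB xB nB).
  by exists y => //; rewrite (le_lt_trans ys)// ltrDl.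
have [y Ky yr] : exists2 y, K y & g y < r.
  by apply/(dist_rel_ltP cB xB nB); apply: le_lt_trans ds _; rewrite lte_fin.
have [Kt|] := pselect (forall x, K x -> t < g x).
  by exists y => //; have [dE _] := nearest_point Kt Ky (ltW yr); rewrite dE in ds.
move=> /existsNP[x /not_implyP[Kx /negP]]; rewrite -leNgt => xt.
by exists x => //; exact: le_trans ts.
Qed.

(** Points just beyond t + h could produce the distance t + h as an infimum that is not attained;
    the margin up to [r], with at most one point in it, excludes this. *)
Lemma new_contact_isolated (C : set V) (h : R) : 0 < h -> t + h < r ->
  ((t%:E < dist_rel B 0 K)%E /\ (dist_rel B 0 K <= (t + h)%:E)%E /\
    C (dir_rel B u0 K 0)) <->
  ((forall x, K x -> ~ dilated B t x) /\ exists2 y, K y & shell B t C h y).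
Proof.
move=> h0 thr; have th : t <= t + h by rewrite lerDl ltW.
split => [[td [dt Cd]]|[Kt [y Ky [/andP[ty yt] Cy]]]].
  have Kt x : K x -> t < g x.
    move=> Kx; rewrite ltNge; apply/negP => xt.
    have : (dist_rel B 0 K <= t%:E)%E.
      by apply/(dist_rel_le_isolated (le_lt_trans th thr) (lexx t)); exists x.
    by rewrite leNgt td.
  split; first by move=> x /Kt; rewrite /dilated/= leNgt => ->.
  have [y Ky yt] : exists2 y, K y & g y <= t + h by apply/dist_rel_le_isolated.
  have [dE uE] := nearest_point Kt Ky (le_trans yt (ltW thr)).
  exists y => //; split; first by rewrite Kt.
  by rewrite -uE.
have {}Kt x : K x -> t < g x by move=> /Kt; rewrite /dilated/= ltNge => /negP.
have [dE uE] := nearest_point Kt Ky (le_trans yt (ltW thr)).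
by rewrite dE uE lte_fin lee_fin.
Qed.

End isolated_nearest_point.

Lemma le_measure_except d (T : measurableType d) (R : realType) (P : probability T R)
    (U W D Z : set T) : measurable U -> measurable W -> measurable D -> measurable Z ->
  P Z = 0%E -> (forall w, U w -> ~ D w -> ~ Z w -> W w) -> (P U <= P W + P D)%E.
Proof.
move=> mU mW mD mZ PZ UW.
apply: (@le_trans _ _ (P (W `|` (D `|` Z)))).
  apply: le_measure; rewrite ?inE//; first by apply: measurableU => //; exact: measurableU.
  move=> w Uw; have [Dw|Dw] := pselect (D w); first by right; left.
  have [Zw|Zw] := pselect (Z w); first by right; right.
  by left; exact: UW.
apply: le_trans (measureU2 _ _ _) _ => //; first exact: measurableU.
rewrite leeD2l//; apply: le_trans (measureU2 _ mD mZ) _.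
by rewrite [X in (_ + X)%E]PZ adde0.
Qed.

(** * Events of the marked process *)

Section marked_hits.
Context {R : realType} {q : nat} d (Omega : measurableType d).
Variables (P : probability Omega R) (mu : {sigma_finite_measure set 'rV[R]_q -> \bar R}).
Hypothesis muE : forall A, measurable A -> mu A = lebesgue_rV A.
Variables (lam : R) (Q : probability 'rV[R]_q R) (X Y : nat -> Omega -> 'rV[R]_q).
Hypothesis mp : marked_poisson P mu lam Q X Y.
Local Notation V := 'rV[R]_q.
Local Notation M := (mu \x Q)%E.

Definition hits (T : set (V * V)) : set Omega := [set w | exists n, T (X n w, Y n w)].

Lemma measurable_hits T : measurable T -> measurable (hits T).
Proof.
move=> mT; rewrite (_ : hits T = \bigcup_n (fun w => (X n w, Y n w)) @^-1` T).
  apply: bigcupT_measurable => n; apply: (measurable_preimage _ mT).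
  exact: measurable_fun_pair (mp_mX mp n) (mp_mY mp n).
by apply/seteqP; split => w [n]; [exists n|move=> _ H; exists n].
Qed.

Lemma prob_not_hits T : measurable T -> (M T < +oo)%E ->
  P (~` hits T) = (expR (- (lam * fine (M T))))%:E.
Proof.
move=> mT Tf; rewrite -(marked_void mp mT Tf); congr (P _).
apply/seteqP; split => w H; first by move=> n Tn; apply: H; exists n.
by move=> [n]; exact: H.
Qed.

Lemma prob_hits T : measurable T -> (M T < +oo)%E ->
  P (hits T) = (1 - expR (- (lam * fine (M T))))%:E.
Proof.
move=> mT Tf; rewrite -[hits T]setCK.
have -> : P (~` ~` hits T) = (1 - P (~` hits T))%E.
  by apply: probability_setC; apply: measurableC; exact: measurable_hits.
by rewrite prob_not_hits// EFinB.
Qed.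

Lemma prob_hits_le T : measurable T -> (M T < +oo)%E ->
  (P (hits T) <= (lam * fine (M T))%:E)%E.
Proof.
move=> mT Tf; rewrite prob_hits// lee_fin.
by have := expR_ge1Dx (- (lam * fine (M T))); lra.
Qed.

(** Independence over disjoint sets of pairs, obtained from void probabilities alone: the event is
    the difference of the void events of [T1] and of the union. *)
Lemma prob_new_hits T1 T2 : measurable T1 -> measurable T2 -> T1 `&` T2 = set0 ->
  (M T1 < +oo)%E -> (M T2 < +oo)%E ->
  P (~` hits T1 `&` hits T2) = (expR (- (lam * fine (M T1))) *
    (1 - expR (- (lam * fine (M T2)))))%:E.
Proof.
move=> m1 m2 T12 f1 f2.
have m12 : measurable (T1 `|` T2) by exact: measurableU.
have MU : M (T1 `|` T2) = (M T1 + M T2)%E by exact: measureU.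
have fU : (M (T1 `|` T2) < +oo)%E by rewrite MU lte_add_pinfty.
have -> : ~` hits T1 `&` hits T2 = ~` hits T1 `\` ~` hits (T1 `|` T2).
  apply/seteqP; split => w [h1].
    by move=> [n H]; split => // -[]; exists n; right.
  by move=> /contrapT[n [H|H]]; split => //; [exfalso; apply: h1; exists n|exists n].
have mh T : measurable T -> measurable (~` hits T).
  by move=> mT; apply: measurableC; exact: measurable_hits.
have -> : P (~` hits T1 `\` ~` hits (T1 `|` T2)) =
    (P (~` hits T1) - P (~` hits T1 `&` ~` hits (T1 `|` T2)))%E.
  apply: measureD; do ?exact: mh.
  by rewrite (le_lt_trans (probability_le1 P (mh _ m1)))// ltry.
have -> : ~` hits T1 `&` ~` hits (T1 `|` T2) = ~` hits (T1 `|` T2).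
  by apply: setIidr => w h [n H]; apply: h; exists n; left.
have fE : fine (M (T1 `|` T2)) = fine (M T1) + fine (M T2).
  by rewrite MU fineD// ge0_fin_numE.
rewrite !prob_not_hits// -EFinB fE.
by rewrite mulrDr opprD expRD mulrBr mulr1.
Qed.

Lemma hits_exists w (K A D : set V) :
  K = range (X ^~ w) `|` range (fun n => X n w + Y n w) ->
  (forall x, K x -> ~ D x) ->
  hits (uncovered A D) w <-> exists2 y, K y & A y.
Proof.
move=> KE KD; split => [[n [_ _ [An|An]]]|[y]].
- by exists (X n w) => //; rewrite KE; left; exists n.
- by exists (X n w + Y n w) => //; rewrite KE; right; exists n.
have XK n : K (X n w) by rewrite KE; left; exists n.
have YK n : K (X n w + Y n w) by rewrite KE; right; exists n.
rewrite KE => -[[n _ <-]|[n _ <-]] An; exists n; split => /=.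
- exact: KD.
- exact: KD.
- by left.
- exact: KD.
- exact: KD.
- by right.
Qed.

(** The two ways in which S can contain two points: both from one pair, or from two pairs touching
    S. *)
Definition crowded (S : set V) : set Omega := hits (both_in S) `|`
  [set w | exists i j, [/\ i <> j, uncovered S set0 (X i w, Y i w) &
                           uncovered S set0 (X j w, Y j w)]].

Lemma measurable_uncovered (S K : set V) : measurable S -> measurable K ->
  measurable (uncovered S K).
Proof.
move=> mS mK; rewrite (_ : uncovered S K = ~` [set z | K z.1] `&`
    ~` [set z | K (z.1 + z.2)] `&` ([set z | S z.1] `|` [set z | S (z.1 + z.2)])).
  apply: measurableI; first by apply: measurableI; apply: measurableC;
    [exact: measurable_fst_preimage|exact: measurable_add_preimage].
  by apply: measurableU; [exact: measurable_fst_preimage|exact: measurable_add_preimage].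
by apply/seteqP; split => z; [move=> [h1 h2 h3]|move=> [[h1 h2] h3]].
Qed.

Let measurable_crowded_pair S : measurable S -> measurable
  [set w | exists i j, [/\ i <> j, uncovered S set0 (X i w, Y i w) &
                           uncovered S set0 (X j w, Y j w)]].
Proof.
move=> mS; pose U n := (fun w => (X n w, Y n w)) @^-1` uncovered S set0.
have mU n : measurable (U n).
  apply: (measurable_preimage _ (measurable_uncovered mS measurable0)).
  exact: measurable_fun_pair (mp_mX mp n) (mp_mY mp n).
rewrite (_ : [set w | _] = \bigcup_i \bigcup_j if i == j then set0 else U i `&` U j).
  apply: bigcupT_measurable => i; apply: bigcupT_measurable => j.
  by case: ifP => // _; exact: measurableI.
apply/seteqP; split => w.
  by move=> [i [j [/eqP/negbTE ij Ui Uj]]]; exists i => //; exists j => //; rewrite ij.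
by move=> [i _ [j _]]; case: eqP => // ij [Ui Uj]; exists i, j.
Qed.

Lemma measurable_crowded S : measurable S -> measurable (crowded S).
Proof.
move=> mS; apply: measurableU; last exact: measurable_crowded_pair.
by apply: measurable_hits; exact: measurable_both_in.
Qed.

Lemma uncovered_le (S K : set V) : measurable S -> measurable K -> S `&` K = set0 ->
  (mu S < +oo)%E -> (M (uncovered S K) < +oo)%E /\
  fine (M (uncovered S K)) <= 2 * fine (mu S).
Proof.
move=> mS mK SK Sf.
have h : (M (uncovered S K) <= mu S * 2%:E)%E.
  apply: (@le_trans _ _ (mu S * (1 + Q [set~ (0%R : V)]))%E).
    rewrite -(hit_decomposition muE Q mS mK SK); apply: leeDl.
    by apply: adde_ge0 => //; apply: adde_ge0.
  apply: lee_wpmul2l => //; rewrite (_ : 2%:E = (1 + 1)%E)//.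
  apply: leeD2l; apply: probability_le1; exact: measurable_setC10.
have Sfin : mu S \is a fin_num by rewrite ge0_fin_numE.
rewrite -(fineK Sfin) -EFinM mulrC in h.
have Uf : (M (uncovered S K) < +oo)%E by rewrite (le_lt_trans h)// ltry.
by split => //; rewrite -lee_fin fineK// ge0_fin_numE.
Qed.

Lemma both_in_lty (S : set V) : measurable S -> (mu S < +oo)%E ->
  (M (both_in S) < +oo)%E.
Proof.
move=> mS Sf; have [h _] := uncovered_le mS measurable0 (setI0 S) Sf.
apply: le_lt_trans h; apply: le_measure; rewrite ?inE.
- exact: measurable_both_in.
- exact: measurable_uncovered.
- by move=> z [h1 h2 h3]; split => //; left.
Qed.

(** The quadratic term is nu^2 / 2 for the pairs touching S, where nu <= 2 lam mu(S) because each
    pair has at most two points. *)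
Lemma prob_crowded (S : set V) : measurable S -> (mu S < +oo)%E ->
  (P (crowded S) <= (lam * fine (M (both_in S)) + 2 * (lam * fine (mu S)) ^+ 2)%:E)%E.
Proof.
move=> mS Sf; have [h1 h2] := uncovered_le mS measurable0 (setI0 S) Sf.
have mh := measurable_hits (measurable_both_in mS).
have mc := measurable_crowded mS.
pose D2 := [set w | exists i j, [/\ i <> j, uncovered S set0 (X i w, Y i w) &
                           uncovered S set0 (X j w, Y j w)]].
have m2 : measurable D2 by exact: measurable_crowded_pair.
apply: le_trans (measureU2 _ mh m2) _.
rewrite EFinD; apply: leeD.
  apply: prob_hits_le; [exact: measurable_both_in|exact: both_in_lty].
apply: le_trans (marked_two mp (measurable_uncovered mS measurable0) h1) _.
rewrite lee_fin; have l0 := mp_gt0 mp.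
have m0 : 0 <= fine (M (uncovered S set0)) by rewrite fine_ge0.
have a0 : lam * fine (M (uncovered S set0)) <= lam * (2 * fine (mu S)) by rewrite ler_pM2l.
have b0 : 0 <= lam * fine (M (uncovered S set0)) by rewrite mulr_ge0// ltW.
have := ler_pM b0 b0 a0 a0; rewrite !expr2; nra.
Qed.

Lemma not_crowded_unique (S : set V) w x y : ~ crowded S w ->
  (range (X ^~ w) `|` range (fun n => X n w + Y n w)) x ->
  (range (X ^~ w) `|` range (fun n => X n w + Y n w)) y -> S x -> S y -> x = y.
Proof.
move=> nc.
have H i x' : (x' = X i w \/ x' = X i w + Y i w) -> S x' -> uncovered S set0 (X i w, Y i w).
  by case=> -> Sx; split => //=; [left|right].
have find x' : (range (X ^~ w) `|` range (fun n => X n w + Y n w)) x' ->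
    exists i, x' = X i w \/ x' = X i w + Y i w.
  by move=> [[i _ <-]|[i _ <-]]; exists i; [left|right].
move=> /find[i xi] /find[j yj] Sx Sy.
have ij : i = j.
  apply: contrapT => ij; apply: nc; right; exists i, j; split => //.
    exact: H xi Sx.
  exact: H yj Sy.
rewrite -{j}ij in yj.
have nb : S (X i w) -> S (X i w + Y i w) -> X i w = X i w + Y i w.
  move=> S1 S2; apply: contrapT => ne; apply: nc; left; exists i; split => //= Y0.
  by apply: ne; rewrite Y0 addr0.
case: xi => ex; case: yj => ey; rewrite ex ey in Sx Sy *.
- by [].
- exact: nb.
- by apply/esym/nb.
- by [].
Qed.

End marked_hits.

Lemma cvg_at_right0_double (R : realType) (f : R -> R) (l : R) :
  f h @[h --> 0^'+] --> l -> f (2 * h) @[h --> 0^'+] --> l.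
Proof.
move=> fl; have h2 : (2 * h : R) @[h --> 0^'+] --> (0 : R)^'+.
  move=> A [e /= e0 eA]; exists (e / 2); first by rewrite /= divr_gt0.
  move=> y /=; rewrite sub0r normrN => ye y0; apply: eA; last by rewrite mulr_gt0.
  by rewrite /= sub0r normrN normrM ger0_norm// mulrC -ltr_pdivlMr.
exact: (cvg_comp _ _ h2 fl).
Qed.

(** Squeeze between x (1 - x) and x, valid for x >= 0. *)
Lemma cvg_one_minus_expR (R : realType) (x : R -> R) (l : R) :
  (forall h, 0 <= x h) -> h^-1 * x h @[h --> 0^'+] --> l ->
  h^-1 * (1 - expR (- x h)) @[h --> 0^'+] --> l.
Proof.
move=> x0 xl.
have xc0 := cvg_at_right0_of_rate xl.
have lo : h^-1 * x h * (1 - x h) @[h --> 0^'+] --> l.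
  rewrite -[X in _ --> X]mulr1; apply: cvgM => //.
  by rewrite -[X in _ --> X]subr0; apply: cvgB => //; exact: cvg_cst.
apply: (squeeze_cvgr _ lo xl); near=> h.
have h0 : 0 < h by [].
rewrite -mulrA !ler_pM2l ?invr_gt0//.
have y0 := x0 h; move: (x h) y0 => y y0.
have e1 := expR_ge1Dx (- y).
apply/andP; split; last lra.
have e2 := expR_ge1Dx y; have e3 : expR y * expR (- y) = 1 by rewrite -expRD subrr expR0.
have e4 : 0 < expR (- y) by exact: expR_gt0.
by nra.
Unshelve. all: by end_near.
Qed.

(** * The hazard as a limit of hit rates *)

Section hazard_limit.
Context {R : realType} {q : nat} d (Omega : measurableType d).
Variables (P : probability Omega R) (mu : {sigma_finite_measure set 'rV[R]_q -> \bar R}).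
Hypothesis muE : forall A, measurable A -> mu A = lebesgue_rV A.
Variables (lam : R) (Q : probability 'rV[R]_q R) (X Y : nat -> Omega -> 'rV[R]_q).
Hypothesis mp : marked_poisson P mu lam Q X Y.
Local Notation V := 'rV[R]_q.
Local Notation M := (mu \x Q)%E.
Hypothesis acQ : forall A : set V, measurable A -> ~ A 0 -> mu A = 0%E -> Q A = 0%E.
Variables (N : Omega -> set V) (L : nat -> Omega -> set V).
Hypotheses (rL : forall n, random_point_set (L n)) (finL : forall n w, finite_set (L n w))
  (NE : forall w, N w = \bigcup_n [set l + X n w | l in L n w])
  (Nae : {ae P, forall w, N w = range (X ^~ w) `|` range (fun n => X n w + Y n w)}).
Variable B : set V.
Hypotheses (cB : compact B)
  (xB : convex_set (B : set (convex_lmodType V)))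
  (nB : nbhs (0 : V) B).
Hypothesis q0 : (0 < q)%N.
Variables (u0 : V) (t : R) (C : set V).
Hypotheses (t0 : 0 <= t) (mC : measurable C).
Local Notation g := (gauge B).

Let K := dilated B t.
Let covering := uncovered K set0.
Let S h := shell B t setT h.
Let new_point h := uncovered (shell B t C h) K.

Let mK : measurable K. Proof. exact: measurable_dilated. Qed.

Let mS h : measurable (S h). Proof. exact: measurable_shell. Qed.

Let mSC h : measurable (shell B t C h). Proof. exact: measurable_shell. Qed.

Let mcov : measurable covering. Proof. exact: measurable_uncovered. Qed.

Let mnew h : measurable (new_point h). Proof. exact: measurable_uncovered. Qed.

Let cov_lty : (M covering < +oo)%E.
Proof.
by have [] := uncovered_le muE Q mK measurable0 (setI0 K) (mu_dilated muE cB xB nB t).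
Qed.

Let S_lty h : 0 <= h -> (mu (S h) < +oo)%E.
Proof. by move=> h0; rewrite (mu_shell muE Q)// ltry. Qed.

Let new_lty h : 0 <= h -> (M (new_point h) < +oo)%E.
Proof.
move=> h0; have [] // := uncovered_le muE Q (mSC h) mK (shell_dilated _ _ _ _).
by rewrite (mu_shell muE Q)// ltry.
Qed.

(** Bound on the probability of a crowded shell. The shell uses all directions, since a competing
    point with direction outside C also spoils the comparison. *)
Let excess h : R := lam * fine (M (both_in (S h))) + 2 * (lam * fine (mu (S h))) ^+ 2.

Let cvg_excess : h^-1 * excess (2 * h) @[h --> 0^'+] --> 0.
Proof.
have H1 := cvg_both_in_shell muE cB xB nB q0 t0 measurableT acQ.
have H2 := cvg_shell_sqr muE Q cB xB nB q0 t0 measurableT.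
have H : lam * (h^-1 * fine (M (both_in (S h)))) +
    2 * lam ^+ 2 * (h^-1 * fine (mu (S h)) ^+ 2) @[h --> 0^'+] --> lam * 0 + 2 * lam ^+ 2 * 0.
  apply: cvgD; first by apply: cvgM; [exact: cvg_cst|exact: H1].
  by apply: cvgM; [exact: cvg_cst|exact: H2].
rewrite !mulr0 addr0 in H.
have H' : 2 * (lam * (h^-1 * fine (M (both_in (S h)))) +
    2 * lam ^+ 2 * (h^-1 * fine (mu (S h)) ^+ 2)) @[h --> 0^'+] --> (2 * 0 : R).
  by apply: cvgM; [exact: cvg_cst|exact: H].
rewrite mulr0 in H'.
have := cvg_at_right0_double H'.
apply: cvg_trans; apply: near_eq_cvg; near=> h.
have h0 : h != 0 by rewrite gt_eqF.
rewrite /excess; move: (fine _) (fine _) => x y; field.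
by rewrite h0.
Unshelve. all: by end_near.
Qed.

(** Events that agree off a null set and off the crowded shell differ in probability by at most
    [excess (2 * h)]. *)
Let almost_surely U W h : measurable U -> measurable W -> 0 < h ->
  (forall w, N w = range (X ^~ w) `|` range (fun n => X n w + Y n w) ->
    ~ crowded X Y (S (2 * h)) w -> U w <-> W w) ->
  `|fine (P U) - fine (P W)| <= excess (2 * h).
Proof.
move=> mU mW h0 UW; have [Z [mZ PZ GZ]] := Nae.
have h2 : 0 <= 2 * h by rewrite mulr_ge0// ltW.
have mD := measurable_crowded mp (mS (2 * h)).
have PD := prob_crowded muE mp (mS (2 * h)) (S_lty h2).
have G w : ~ Z w -> N w = range (X ^~ w) `|` range (fun n => X n w + Y n w).
  by move=> nZ; apply: contrapT => nG; apply: nZ; exact: GZ.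
have f1 : (P U <= P W + P (crowded X Y (S (2 * h))))%E.
  by apply: (le_measure_except mU mW mD mZ PZ) => w Uw nD /G /UW[] // + _; exact.
have f2 : (P W <= P U + P (crowded X Y (S (2 * h))))%E.
  by apply: (le_measure_except mW mU mD mZ PZ) => w Ww nD /G /UW[] // _; exact.
have fin A : measurable A -> P A = (fine (P A))%:E.
  by move=> mA; rewrite fineK// fin_num_measure.
rewrite (fin _ mU) (fin _ mW) (fin _ mD) -EFinD lee_fin in f1.
rewrite (fin _ mU) (fin _ mW) (fin _ mD) -EFinD lee_fin in f2.
rewrite (fin _ mD) lee_fin in PD.
by rewrite ler_norml -/(excess _) in PD *; apply/andP; split; lra.
Qed.

Let unique_in_shell w h : 0 < h ->
  N w = range (X ^~ w) `|` range (fun n => X n w + Y n w) ->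
  ~ crowded X Y (S (2 * h)) w -> forall x y, N w x -> N w y ->
  t < g x <= t + 2 * h -> t < g y <= t + 2 * h -> x = y.
Proof.
move=> h0 Nw nc x y; rewrite Nw => Nx Ny xr yr.
by apply: (not_crowded_unique nc Nx Ny).
Qed.

Let mev s C' : measurable C' ->
  measurable [set w | (dist_rel B 0 (N w) <= s%:E)%E /\ C' (dir_rel B u0 (N w) 0)].
Proof. exact: (measurable_empty_space_event cB xB nB (mp_mX mp) rL finL NE). Qed.

Let a := lam * fine (M covering).

(** Distance at most t and a point in the body could differ when the infimum is not attained, which
    a shell that is not crowded rules out. Neither probability depends on h, so the error, tending
    to 0 with h, must vanish. *)
Lemma empty_space_setT : 1 - empty_space P B u0 N t setT = expR (- a).
Proof.
have near_eq h : 0 < h ->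
    `|empty_space P B u0 N t setT - (1 - expR (- a))| <= excess (2 * h).
  move=> h0; rewrite (_ : 1 - expR (- a) = fine (P (hits X Y covering))); last first.
    by rewrite (prob_hits mp mcov cov_lty).
  apply: almost_surely => //; first exact: mev.
    exact: (measurable_hits mp).
  move=> w Nw nc.
  have th : t < t + 2 * h by rewrite ltrDl mulr_gt0.
  have D := dist_rel_le_isolated cB xB nB u0 t0 (unique_in_shell h0 Nw nc) th (lexx t).
  have H : hits X Y covering w <-> exists2 y, N w y & K y :=
    hits_exists K Nw (fun x _ => @id False).
  rewrite /= D; apply: (iff_trans _ (iff_sym H)).
  by split => [[]|].
have excess0 := cvg_at_right0_of_rate cvg_excess.
apply/eqP; rewrite -subr_eq0 -normr_le0; apply/ler_addgt0Pr => e e0; rewrite add0r.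
have [h [h0 he]] : exists h : R, 0 < h /\ excess (2 * h) <= e.
  near (0 : R)^'+ => h; exists h; split => //.
  by near: h; exact: cvgr_le excess0 _ e0.
apply: le_trans he; rewrite (_ : _ - expR _ =
  - (empty_space P B u0 N t setT - (1 - expR (- a)))); last by ring.
by rewrite normrN; exact: near_eq.
Unshelve. all: by end_near.
Qed.

Let x h := lam * fine (M (new_point h)).

Let increment h : 0 < h ->
  `|(empty_space P B u0 N (t + h) C - empty_space P B u0 N t C) -
    expR (- a) * (1 - expR (- x h))| <= excess (2 * h).
Proof.
move=> h0.
pose ev s := [set w | (dist_rel B 0 (N w) <= s%:E)%E /\ C (dir_rel B u0 (N w) 0)].
have mevC s : measurable (ev s) by exact: mev.
have -> : empty_space P B u0 N (t + h) C - empty_space P B u0 N t C =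
    fine (P (ev (t + h) `\` ev t)).
  have -> : P (ev (t + h) `\` ev t) = (P (ev (t + h)%R) - P (ev (t + h)%R `&` ev t))%E.
    by apply: measureD => //; rewrite (le_lt_trans (probability_le1 P _))// ltry.
  rewrite (_ : ev (t + h) `&` ev t = ev t); last first.
    apply: setIidr => w [dt Cw]; split => //; apply: le_trans dt _.
    by rewrite lee_fin lerDl ltW.
  by rewrite fineB ?fin_num_measure.
have -> : expR (- a) * (1 - expR (- x h)) =
    fine (P (~` hits X Y covering `&` hits X Y (new_point h))).
  rewrite (prob_new_hits mp)//; last exact: new_lty (ltW h0).
  by apply/seteqP; split => // z [[_ _ [h1|h1]] [h2 h3 _]].
have mh := measurable_hits mp.
apply: almost_surely => //.
- exact: measurableD.
- by apply: measurableI; [apply: measurableC|]; exact: mh.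
move=> w Nw nc.
have thh : t + h < t + 2 * h by lra.
have H := new_contact_isolated cB xB nB u0 t0 (unique_in_shell h0 Nw nc) C h0 thh.
have Hc : hits X Y covering w <-> exists2 y, N w y & K y :=
  hits_exists K Nw (fun x _ => @id False).
split.
  move=> [[dt Cw] nt].
  have [|HK Hy] := H.1 _.
    by split; [rewrite ltNge; apply/negP => dt'; apply: nt|].
  split; last by apply/(hits_exists _ Nw HK).
  by move/Hc => [y Ny Ky]; exact: (HK y).
move=> [nc' nh].
have HK x' : N w x' -> ~ dilated B t x'.
  by move=> Nx Kx; apply: nc'; apply/Hc; exists x'.
have [|dt [dth Cw]] := H.2 _.
  by split => //; apply/(hits_exists _ Nw HK).
by split => // -[]; rewrite leNgt dt.
Qed.

(** The density is exp(- a) times the rate of new hits, and the factor exp(- a) is also 1 - F_B(t),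
    so it cancels. *)
Lemma hazard_limit :
  h^-1 * (lam * fine (M (uncovered (shell B t C h) (dilated B t)))) @[h --> 0^'+] -->
  hazard P B u0 N t C.
Proof.
have /cvg_ex[l Hl] : cvg (h^-1 * fine (M (new_point h)) @[h --> 0^'+]).
  exact: (cvg_uncovered_rate muE cB xB nB q0 t0 mC acQ).
have Hx : h^-1 * x h @[h --> 0^'+] --> lam * l.
  have H : lam * (h^-1 * fine (M (new_point h))) @[h --> 0^'+] --> lam * l.
    by apply: cvgM; [exact: cvg_cst|exact: Hl].
  by apply: cvg_trans H; apply: near_eq_cvg; apply: nearW => h; rewrite mulrCA.
have l0 := mp_gt0 mp.
have x0 h : 0 <= x h by rewrite mulr_ge0 ?fine_ge0// ltW.
have He := cvg_one_minus_expR x0 Hx.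
have H1 : h^-1 * (expR (- a) * (1 - expR (- x h))) @[h --> 0^'+] --> expR (- a) * (lam * l).
  have H : expR (- a) * (h^-1 * (1 - expR (- x h))) @[h --> 0^'+] --> expR (- a) * (lam * l).
    by apply: cvgM; [exact: cvg_cst|exact: He].
  by apply: cvg_trans H; apply: near_eq_cvg; apply: nearW => h; rewrite mulrCA.
have density : h^-1 * (empty_space P B u0 N (t + h) C - empty_space P B u0 N t C)
    @[h --> 0^'+] --> expR (- a) * (lam * l).
  have lo : h^-1 * (expR (- a) * (1 - expR (- x h))) - h^-1 * excess (2 * h)
      @[h --> 0^'+] --> expR (- a) * (lam * l).
    by rewrite -[X in _ --> X]subr0; apply: cvgB; [exact: H1|exact: cvg_excess].
  have hi : h^-1 * (expR (- a) * (1 - expR (- x h))) + h^-1 * excess (2 * h)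
      @[h --> 0^'+] --> expR (- a) * (lam * l).
    by rewrite -[X in _ --> X]addr0; apply: cvgD; [exact: H1|exact: cvg_excess].
  apply: (squeeze_cvgr _ lo hi); near=> h.
  have h0 : 0 < h by [].
  have := increment h0; rewrite ler_norml => /andP[i1 i2].
  by rewrite -mulrBr -mulrDr !ler_pM2l ?invr_gt0//; apply/andP; split; lra.
suff -> : hazard P B u0 N t C = lam * l by exact: Hx.
rewrite /hazard empty_space_setT /empty_space_density (cvg_lim _ density)//.
by rewrite mulrAC divff ?mul1r// gt_eqF// expR_gt0.
Unshelve. all: by end_near.
Qed.

End hazard_limit.

(** * Intensity *)

(** Raising the measurable side to infinity on the null set keeps its integral and makes the
    inequality hold everywhere. The companion lemma lowers the left side to 0 instead. *)
Lemma le_ae_integral_l d (T : measurableType d) (R : realType)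
    (m : {measure set T -> \bar R}) (u v : T -> \bar R) :
  (forall x, 0 <= u x)%E -> (forall x, 0 <= v x)%E -> measurable_fun setT v ->
  {ae m, forall x, (u x <= v x)%E} -> (\int[m]_x u x <= \int[m]_x v x)%E.
Proof.
move=> u0 v0 mv [Z [mZ mZ0 uvZ]].
pose v' x := if x \in Z then +oo%E else v x.
have mv' : measurable_fun setT v'.
  apply: measurable_fun_ifT => //.
  apply: (measurable_fun_bool true); rewrite setTI (_ : _ @^-1` _ = Z)//.
  by apply/seteqP; split => x; rewrite /preimage/=; [exact: set_mem|exact: mem_set].
rewrite (@ge0_ae_eq_integral _ _ _ m setT v v')//; last 2 first.
- by move=> x _; rewrite /v'; case: ifP => // _; exact: leey.
- exists Z; split => // x /not_implyP[_ /= h].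
  by apply: contrapT => xZ; apply: h; rewrite /v' memNset.
apply: le_integral_ge0 => x _ //; rewrite /v'.
case: ifPn => [_|]; first exact: leey.
rewrite notin_setE => xZ; apply: contrapT => h; apply: xZ; exact: uvZ.
Qed.

Lemma le_ae_integral_r d (T : measurableType d) (R : realType)
    (m : {measure set T -> \bar R}) (u v : T -> \bar R) :
  (forall x, 0 <= u x)%E -> (forall x, 0 <= v x)%E -> measurable_fun setT u ->
  {ae m, forall x, (u x <= v x)%E} -> (\int[m]_x u x <= \int[m]_x v x)%E.
Proof.
move=> u0 v0 mu [Z [mZ mZ0 uvZ]].
pose u' x := if x \in Z then 0%E else u x.
have mu' : measurable_fun setT u'.
  apply: measurable_fun_ifT => //.
  apply: (measurable_fun_bool true); rewrite setTI (_ : _ @^-1` _ = Z)//.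
  by apply/seteqP; split => x; rewrite /preimage/=; [exact: set_mem|exact: mem_set].
rewrite (@ge0_ae_eq_integral _ _ _ m setT u u')//; last 2 first.
- by move=> x _; rewrite /u'; case: ifP.
- exists Z; split => // x /not_implyP[_ /= h].
  by apply: contrapT => xZ; apply: h; rewrite /u' memNset.
apply: le_integral_ge0 => x _; rewrite /u'; case: ifPn => //.
rewrite notin_setE => xZ; apply: contrapT => h; apply: xZ; exact: uvZ.
Qed.

Section counting_cells.
Context {R : realType} {T : choiceType} {I : finType}.
Variable c : I -> set T.

Definition occupied (S : set T) : {set I} := [set i | `[< S `&` c i !=set0 >]]%SET.

(** A point chosen in each occupied cell gives an injection, the cells being disjoint. *)
Lemma occupied_le_counting (S : set T) : (forall i j x, c i x -> c j x -> i = j) ->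
  (#|occupied S|%:R%:E <= counting S :> \bar R)%E.
Proof.
move=> cI; rewrite /counting; case: asboolP => fS; last exact: leey.
rewrite lee_fin ler_nat.
have [f Hf] : exists f : I -> option T, forall i, i \in occupied S ->
    exists x, [/\ f i = Some x, S x & c i x].
  have /choice[f Hf] : forall i, exists o : option T, i \in occupied S ->
      exists x, [/\ o = Some x, S x & c i x].
    move=> i; have [|_] := boolP (i \in occupied S); last by exists None.
    by rewrite inE => /asboolP[x [Sx cx]]; exists (Some x) => _; exists x.
  by exists f.
suff : (size (map f (enum (occupied S))) <= size (map Some (enum_fset (fset_set S))))%N.
  by rewrite !size_map -cardE.
apply: uniq_leq_size.
  rewrite map_inj_in_uniq ?enum_uniq// => i j; rewrite !mem_enum => /Hf[x [fi _ cx]].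
  move=> /Hf[y [fj _ cy]]; rewrite fi fj => -[xy].
  by apply: (cI i j x) => //; rewrite xy.
move=> o /mapP[i]; rewrite mem_enum => /Hf[x [fi Sx _]] ->; rewrite fi.
by apply/mapP; exists x => //; rewrite in_fset_set// inE.
Qed.

Lemma card_le_occupied (S : set T) (F : {fset T}) (j : T -> I) : [set` F] `<=` S ->
  (forall x, x \in F -> c (j x) x) -> {in F &, injective j} ->
  (#|` F| <= #|occupied S|)%N.
Proof.
move=> FS Fc jI.
have u : uniq (map j F) by rewrite map_inj_in_uniq// fset_uniq.
rewrite cardE -(size_map j F); apply: uniq_leq_size => // i /mapP[x xF ->].
by rewrite mem_enum inE; apply/asboolP; exists x; split; [exact: FS|exact: Fc].
Qed.

End counting_cells.

(** * The grid of cells of side 1/(k+1) *)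

Section cells.
Context {R : realType} {q : nat}.
Variable mu : {sigma_finite_measure set 'rV[R]_q -> \bar R}.
Hypothesis muE : forall A, measurable A -> mu A = lebesgue_rV A.
Local Notation V := 'rV[R]_q.
Variable k : nat.
Let side : R := k.+1%:R^-1.

(** [m] is the number of cells per axis: k+1 cells stay inside the unit cube, k+2 are needed to
    cover its closed upper faces. *)
Definition cell m (j : {ffun 'I_q -> 'I_m}) : set V :=
  [set x | forall i, (j i)%:R <= x ord0 i * k.+1%:R < (j i).+1%:R].

Lemma cell_inj m (i j : {ffun 'I_q -> 'I_m}) x : cell i x -> cell j x -> i = j.
Proof.
move=> ix jx; apply/ffunP => l; apply/val_inj => /=.
have /andP[a1 a2] := ix l; have /andP[b1 b2] := jx l.
have := le_lt_trans a1 b2; have := le_lt_trans b1 a2; rewrite !ltr_nat !ltnS => h1 h2.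
by apply/eqP; rewrite eqn_leq h1 h2.
Qed.

Let cell_translate m (j : {ffun 'I_q -> 'I_m}) : cell j =
  [set x | [set y : V | forall i, `[0, side[%classic (y ord0 i)]
    (x + \row_i - ((j i)%:R * side))].
Proof.
have k0 : 0 < k.+1%:R :> R by [].
have s0 : 0 < side by rewrite invr_gt0.
apply/seteqP; split => x H i; have := H i; rewrite /= ?mxE in_itv/= ?mxE.
  move=> /andP[h1 h2]; rewrite subr_ge0 /side ler_pdivrMr// h1/= ltrBlDr.
  by rewrite -[X in X + _]mul1r -mulrDl ltr_pdivlMr// nat1r.
move=> /andP[]; rewrite subr_ge0 /side ler_pdivrMr// => ->/=; rewrite ltrBlDr.
by rewrite -[X in _ < X + _]mul1r -mulrDl ltr_pdivlMr// nat1r.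
Qed.

Lemma measurable_cell m (j : {ffun 'I_q -> 'I_m}) : measurable (cell j).
Proof.
rewrite cell_translate; apply: measurable_translate; apply: measurable_box.
exact: measurable_itv.
Qed.

Lemma mu_cell m (j : {ffun 'I_q -> 'I_m}) : mu (cell j) = (side ^+ q)%:E.
Proof.
have mI : measurable `[0, side[%classic by exact: measurable_itv.
rewrite cell_translate mu_translate//; last exact: measurable_box.
rewrite muE; last exact: measurable_box.
rewrite lebesgue_rV_box// lebesgue_measure_itv/= lte_fin invr_gt0 ltr0n/=.
by rewrite -EFinB subr0 -EFin_expe.
Qed.

Lemma cell_unit_cube (j : {ffun 'I_q -> 'I_k.+1}) : cell j `<=` @unit_cube R q.
Proof.
move=> x jx i; have /andP[h1 h2] := jx i.
have k0 : 0 < k.+1%:R :> R by [].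
apply/andP; split; first by rewrite -(pmulr_lge0 _ k0); apply: le_trans h1.
rewrite -(ler_pM2r k0) mul1r ltW// (lt_le_trans h2)// ler_nat.
exact: ltn_ord.
Qed.

Definition cell_index (x : V) : {ffun 'I_q -> 'I_k.+2} :=
  [ffun i => inord (Num.truncn (x ord0 i * k.+1%:R))].

Lemma cell_indexP x : @unit_cube R q x -> cell (cell_index x) x.
Proof.
move=> x01 i; have /andP[h0 h1] := x01 i.
have xk0 : 0 <= x ord0 i * k.+1%:R by rewrite mulr_ge0.
have := truncn_itv xk0 => /andP[h2 h3].
rewrite ffunE inordK ?h2//.
rewrite ltnS -(ler_nat R); apply: le_trans h2 _.
by rewrite ler_piMl.
Qed.

Lemma cell_index_close x y : @unit_cube R q x -> @unit_cube R q y ->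
  cell_index x = cell_index y -> forall i, `|x ord0 i - y ord0 i| < side.
Proof.
move=> x01 y01 xy i.
have /andP[a1 a2] := cell_indexP x01 i; have := cell_indexP y01 i; rewrite -xy => /andP[b1 b2].
have k0 : 0 < k.+1%:R :> R by [].
rewrite -(ltr_pM2r k0) mulVf ?gt_eqF// -[X in _ * X](gtr0_norm k0) -normrM mulrBl.
rewrite ltr_norml; rewrite -natr1 in a2 b2.
by apply/andP; split; lra.
Qed.

End cells.

Lemma le_limn_einf (R : realType) (u : (\bar R)^nat) (a : \bar R) :
  (\forall k \near \oo, (a <= u k)%E) -> (a <= limn_einf u)%E.
Proof.
move=> [n _ H]; rewrite limn_einf_lim.
apply: lime_ge; first exact: is_cvg_einfs.
near=> m; have nm : (n <= m)%N by near: m; exists n.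
rewrite leNgt; apply/negP => /ereal_inf_lt[_ [k /= mk <-]]; rewrite ltNge => /negP; apply.
by apply: H => /=; exact: leq_trans mk.
Unshelve. all: by end_near.
Qed.

Lemma limn_einf_le (R : realType) (u b : (\bar R)^nat) (l : \bar R) :
  (forall k, (u k <= b k)%E) -> b @ \oo --> l -> (limn_einf u <= l)%E.
Proof.
move=> ub bl; rewrite limn_einf_lim.
apply: lime_le; first exact: is_cvg_einfs.
apply: nearW => n; rewrite -(cvg_lim _ bl)//.
apply: lime_ge; first by apply/cvg_ex; exists l.
near=> k; apply: le_trans (ub k); apply: ereal_inf_lbound; exists k => //=.
by near: k; exists n.
Unshelve. all: by end_near.
Qed.

Lemma measurable_limn_einf d (T : measurableType d) (R : realType)
    (f : nat -> T -> \bar R) : (forall n, measurable_fun setT (f n)) ->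
  measurable_fun setT (fun x => limn_einf (f^~ x)).
Proof.
move=> mf; apply: (emeasurable_fun_cvg (fun n x => einfs (f^~ x) n)).
  by move=> n; exact: measurable_fun_einfs.
by move=> x _; rewrite limn_einf_lim; exact: is_cvg_einfs.
Qed.

Section intensity.
Context {R : realType} {q : nat} d (Omega : measurableType d).
Variables (P : probability Omega R) (mu : {sigma_finite_measure set 'rV[R]_q -> \bar R}).
Hypothesis muE : forall A, measurable A -> mu A = lebesgue_rV A.
Variables (lam : R) (Q : probability 'rV[R]_q R) (X Y : nat -> Omega -> 'rV[R]_q).
Hypothesis mp : marked_poisson P mu lam Q X Y.
Local Notation V := 'rV[R]_q.
Local Notation M := (mu \x Q)%E.
Hypothesis acQ : forall A : set V, measurable A -> ~ A 0 -> mu A = 0%E -> Q A = 0%E.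
Variable N : Omega -> set V.
Hypothesis Nae : {ae P, forall w, N w = range (X ^~ w) `|` range (fun n => X n w + Y n w)}.
Hypothesis q0 : (0 < q)%N.

Let v := fine (Q [set~ (0 : V)]).
Let c := lam * (1 + v).
Let side (k : nat) : R := k.+1%:R^-1.

Let l0 : 0 < lam. Proof. exact: (mp_gt0 mp). Qed.

Let v0 : 0 <= v. Proof. exact: fine_ge0. Qed.

Let c0 : 0 < c. Proof. by rewrite mulr_gt0// ltr_pwDl. Qed.

Let side0 k : 0 < side k. Proof. by rewrite invr_gt0. Qed.

Let side_le k : side k ^+ q <= side k.
Proof.
rewrite -[X in _ <= X]expr1 ler_wiXn2l//; first exact: ltW.
by rewrite invf_le1// ler1n.
Qed.

Let meets k m (j : {ffun 'I_q -> 'I_m}) := hits X Y (uncovered (cell k j) set0).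

Let mU k m (j : {ffun 'I_q -> 'I_m}) :
  measurable (uncovered (cell k j : set V) set0).
Proof. by apply: measurable_uncovered => //; exact: measurable_cell. Qed.

Let mmeets k m (j : {ffun 'I_q -> 'I_m}) : measurable (meets k j).
Proof. exact: (measurable_hits mp). Qed.

Let cell_decomposition k m (j : {ffun 'I_q -> 'I_m}) :
  (M (uncovered (cell k j) set0) + M (both_in (cell k j)) = (side k ^+ q * (1 + v))%:E)%E.
Proof.
have Qf : Q [set~ (0 : V)] \is a fin_num.
  by apply: fin_num_measure; exact: measurable_setC10.
have := hit_decomposition muE Q (@measurable_cell R q k m j) measurable0 (setI0 _).
rewrite (mu_cell muE) -[in RHS](fineK Qf) -EFinD -EFinM => <-.
rewrite (_ : second_covered _ set0 = set0); last by apply/seteqP; split => // z [].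
rewrite (_ : first_covered _ set0 = set0); last by apply/seteqP; split => // z [].
have -> : M set0 = 0%E by exact: measure0.
by rewrite !add0e.
Qed.

Let Ufin k m (j : {ffun 'I_q -> 'I_m}) : (M (uncovered (cell k j) set0) < +oo)%E.
Proof.
apply: (@le_lt_trans _ _ (side k ^+ q * (1 + v))%:E); last exact: ltry.
by rewrite -(cell_decomposition k j); exact: leeDl.
Qed.

Let prob_meets_le k m (j : {ffun 'I_q -> 'I_m}) : (P (meets k j) <= (c * side k ^+ q)%:E)%E.
Proof.
apply: le_trans (prob_hits_le mp (mU k j) (Ufin k j)) _.
rewrite lee_fin /c -mulrA ler_pM2l// mulrC.
rewrite -lee_fin -(cell_decomposition k j) fineK ?ge0_fin_numE//.
exact: leeDl.
Qed.

(** Pairs inside one small cell cost at most e times its volume, so the mean number of pairs meeting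
    the cell is at least x = lam (1 + v - e) times the volume; 1 - exp(- x) >= x (1 - x) with x <= c
    side concludes. *)
Let prob_meets_ge (e : R) : 0 < e -> e <= 1 -> \forall k \near \oo,
  forall m (j : {ffun 'I_q -> 'I_m}),
  ((lam * (1 + v - e) * (1 - c * side k) * side k ^+ q)%:E <= P (meets k j))%E.
Proof.
move=> e0 e1; have [r r0 Hr] := both_in_small muE acQ e0.
have s0 : side k @[k --> \oo] --> (0 : R) by exact: cvg_harmonic.
have sl : \forall k \near \oo, side k <= r by exact: cvgr_le s0 _ r0.
near=> k => m j.
have sr : side k <= r by near: k.
have mc := @measurable_cell R q k m j.
have := Hr _ mc; rewrite (mu_cell muE) lee_fin => /(_ (le_trans (side_le k) sr)) both.
have x1 : lam * (1 + v - e) * side k ^+ q <= lam * fine (M (uncovered (cell k j) set0)).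
  rewrite -mulrA ler_pM2l// -lee_fin fineK ?ge0_fin_numE//.
  rewrite -(@leeD2rE _ (e * side k ^+ q)%:E)//.
  apply: (@le_trans _ _ (side k ^+ q * (1 + v))%:E).
    by rewrite -EFinD lee_fin le_eqVlt; apply/orP; left; apply/eqP; ring.
  by rewrite -(cell_decomposition k j); apply: leeD2l.
rewrite (prob_hits mp (mU k j) (Ufin k j)) lee_fin.
have x2 : lam * (1 + v - e) * side k ^+ q <= c * side k.
  apply: ler_pM => //.
  - by apply: mulr_ge0; [exact: ltW|have := v0; lra].
  - by rewrite exprn_ge0// ltW.
  - by rewrite ler_pM2l//; have := v0; lra.
have x0 : 0 <= lam * (1 + v - e) * side k ^+ q.
  apply: mulr_ge0; last by rewrite exprn_ge0// ltW.
  by apply: mulr_ge0; [exact: ltW|have := v0; lra].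
rewrite mulrAC.
move: (fine _) (lam * (1 + v - e) * side k ^+ q) (c * side k) x0 x1 x2 => m' x y x0 x1 xy.
have e2 := expR_ge1Dx x; have e3 : expR x * expR (- x) = 1 by rewrite -expRD subrr expR0.
have e4 : 0 < expR (- x) by exact: expR_gt0.
have e5 : expR (- (lam * m')) <= expR (- x) by rewrite ler_expR lerN2.
by nra.
Unshelve. all: by end_near.
Qed.

(** A measurable substitute for the number of points in the cube, almost surely equal to the number
    of occupied cells. *)
Let cells_met k m w : \bar R :=
  \sum_(j : {ffun 'I_q -> 'I_m}) (\1_(meets k j) w)%:E.

Let cells_met_ge0 k m w : (0 <= cells_met k m w)%E.
Proof. by apply: sume_ge0 => j _; rewrite lee_fin. Qed.

Let measurable_cells_met k m : measurable_fun setT (cells_met k m).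
Proof.
apply: emeasurable_sum => j; apply/measurable_EFinP.
by apply: measurable_indic.
Qed.

Let integral_cells_met k m :
  (\int[P]_w cells_met k m w = \sum_(j : {ffun 'I_q -> 'I_m}) P (meets k j))%E.
Proof.
rewrite ge0_integral_sum//.
- by apply: eq_bigr => j _; rewrite integral_indic ?setIT.
- by move=> j; apply/measurable_EFinP; apply: measurable_indic.
Qed.

Let cells_metE k m w : N w = range (X ^~ w) `|` range (fun n => X n w + Y n w) ->
  cells_met k m w = (#|occupied (@cell R q k m) (N w)|%:R)%:E.
Proof.
move=> Nw; rewrite /cells_met sumEFin -sum1_card natr_sum [in RHS]big_mkcond.
congr (_%:E); apply: eq_bigr => j _.
rewrite indicE inE; have H := hits_exists (cell k j) Nw (fun x _ => @id False).
case: asboolP => [[x [Nx jx]]|h].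
  by rewrite mem_set//; apply/H; exists x.
by rewrite memNset// => /H[x Nx jx]; apply: h; exists x.
Qed.

(** The (k+1)^q cells inside the cube have total volume 1, and each occupied one contributes a
    point. *)
Let intensity_ge (e : R) : 0 < e -> e <= 1 -> ((lam * (1 + v - e))%:E <= intensity P N)%E.
Proof.
move=> e0 e1; have := prob_meets_ge e0 e1 => Hk.
have lo : \forall k \near \oo,
    ((lam * (1 + v - e) * (1 - c * side k))%:E <= intensity P N)%E.
  near=> k.
  have Pk : forall j : {ffun 'I_q -> 'I_k.+1},
    ((lam * (1 + v - e) * (1 - c * side k) * side k ^+ q)%:E <= P (meets k j))%E.
    by move=> j; move: j; near: k; apply: filterS Hk => k Hk j; exact: Hk.
  apply: (@le_trans _ _ (\int[P]_w cells_met k k.+1 w)%E); last first.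
    apply: le_ae_integral_r; [by move=> w; exact: cells_met_ge0|
      by move=> w; exact: measure_ge0|exact: measurable_cells_met|].
    apply: filterS Nae => w Nw; rewrite cells_metE//.
    apply: le_trans (occupied_le_counting (c := @cell R q k k.+1) _ _).
      suff sub : (occupied (@cell R q k k.+1) (N w) \subset
          occupied (@cell R q k k.+1) (N w `&` @unit_cube R q))%SET.
        by rewrite lee_fin ler_nat subset_leq_card.
      apply/fintype.subsetP => j; rewrite inE => /asboolP[x [Nx jx]].
      rewrite inE; apply/asboolP; exists x; split => //; split => //.
      exact: cell_unit_cube jx.
    by move=> i j x; exact: cell_inj.
  rewrite integral_cells_met.
  apply: (@le_trans _ _ (\sum_(j : {ffun 'I_q -> 'I_k.+1})
      (lam * (1 + v - e) * (1 - c * side k) * side k ^+ q)%:E)); last exact: lee_sum.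
  rewrite sumEFin lee_fin sumr_const card_ffun !card_ord -mulr_natr natrX -[leRHS]mulrA.
  by rewrite -exprMn mulVf ?expr1n ?mulr1// pnatr_eq0.
have lim : lam * (1 + v - e) * (1 - c * side k) @[k --> \oo] --> lam * (1 + v - e).
  rewrite -[X in _ --> X]mulr1; apply: cvgM; first exact: cvg_cst.
  rewrite -[X in _ --> X]subr0; apply: cvgB; first exact: cvg_cst.
  by rewrite -(mulr0 c); apply: cvgM; [exact: cvg_cst|exact: cvg_harmonic].
have limE : (lam * (1 + v - e) * (1 - c * side k))%:E @[k --> \oo] --> (lam * (1 + v - e))%:E.
  by apply: cvg_EFin; [exact: nearW|exact: lim].
rewrite -(cvg_lim _ limE)//; apply: lime_le => //.
by apply/cvg_ex; eexists; exact: limE.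
Unshelve. all: by end_near.
Qed.

(** A fine enough grid separates the points of any finite subset, so every finite subset has at most
    liminf many points. *)
Let counting_le_cells w : N w = range (X ^~ w) `|` range (fun n => X n w + Y n w) ->
  (counting (N w `&` @unit_cube R q) <= limn_einf (fun k => cells_met k k.+2 w))%E.
Proof.
move=> Nw; set A := N w `&` _.
have key (F : {fset V}) : [set` F] `<=` A ->
    ((#|` F|%:R)%:E <= limn_einf (fun k => cells_met k k.+2 w))%E.
  move=> FA.
  have near_inj : \forall k \near \oo, {in F &, injective (@cell_index R q k)}.
    have H (z : F * F) : \forall k \near \oo,
        cell_index k (val z.1) = cell_index k (val z.2) -> val z.1 = val z.2.
      have [zz|zz] := eqVneq (val z.1) (val z.2); first exact: nearW.
      have [i zi] : exists i, (val z.1) ord0 i <> (val z.2) ord0 i.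
        apply: contrapT => h; move/eqP: zz; apply; apply/rowP => i.
        by apply: contrapT => zi; apply: h; exists i.
      have zi0 : 0 < `|(val z.1) ord0 i - (val z.2) ord0 i|.
        by rewrite normr_gt0 subr_eq0; exact/eqP.
      have s0 : side k @[k --> \oo] --> (0 : R) by exact: cvg_harmonic.
      near=> k => zk; exfalso.
      have sk : side k <= `|(val z.1) ord0 i - (val z.2) ord0 i|.
        by near: k; exact: cvgr_le s0 _ zi0.
      have [_ z1] := FA _ (valP z.1); have [_ z2] := FA _ (valP z.2).
      by have := cell_index_close z1 z2 zk i; rewrite ltNge sk.
    have H' := @filter_forall nat _ (fun z : F * F => [set k |
      cell_index k (val z.1) = cell_index k (val z.2) -> val z.1 = val z.2]) \oo _ H.
    near=> k => x y xF yF xy.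
    have Hk : forall z : F * F,
      cell_index k (val z.1) = cell_index k (val z.2) -> val z.1 = val z.2.
      by near: k; exact: H'.
    exact: (Hk ([` xF]%fset, [` yF]%fset) xy).
  apply: le_limn_einf; near=> k.
  rewrite cells_metE// lee_fin ler_nat.
  apply: (card_le_occupied (j := @cell_index R q k)).
  - by move=> x /FA[].
  - by move=> x /FA[_ x01]; exact: cell_indexP.
  - by near: k; exact: near_inj.
(* If the count is infinite, finite subsets of every size force the liminf to be infinite too. *)
rewrite {1}/counting; case: asboolP => fA.
  by apply: key; rewrite fset_setK.
rewrite leye_eq; apply/eqP/eqyP => r r0.
have [n rn] : exists n : nat, r <= n%:R by exists (Num.truncn r).+1; rewrite ltW// truncnS_gt.
have [F FA nF] := infinite_set_fset n fA.
apply: le_trans (key F FA); rewrite lee_fin (le_trans rn)// ler_nat//.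
Unshelve. all: by end_near.
Qed.

(** Fatou. The expected number of cells met is at most c times their total volume, which is (1 +
    side)^q for k+2 cells per axis and tends to 1. *)
Let intensity_le : (intensity P N <= c%:E)%E.
Proof.
apply: (@le_trans _ _ (\int[P]_w limn_einf (fun k => cells_met k k.+2 w))%E).
  apply: le_ae_integral_l.
  - by move=> w; exact: measure_ge0.
  - by move=> w; apply: le_limn_einf; apply: nearW => k; exact: cells_met_ge0.
  - by apply: measurable_limn_einf => k; exact: measurable_cells_met.
  - by apply: filterS Nae => w; exact: counting_le_cells.
apply: le_trans (fatou P measurableT _ _) _.
- by move=> k; exact: measurable_cells_met.
- by move=> k w _; exact: cells_met_ge0.
have up k : (\int[P]_w cells_met k k.+2 w <= ((1 + side k) ^+ q * c)%:E)%E.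
  rewrite integral_cells_met.
  apply: (@le_trans _ _ (\sum_(j : {ffun 'I_q -> 'I_k.+2}) (c * side k ^+ q)%:E)).
    by apply: lee_sum => j _; exact: prob_meets_le.
  rewrite sumEFin lee_fin sumr_const card_ffun !card_ord -mulr_natr natrX -mulrA mulrC.
  rewrite -exprMn ler_pM2r// (_ : side k * k.+2%:R = 1 + side k)//.
  by rewrite -natr1 mulrDr mulr1 mulVf ?pnatr_eq0// addrC.
apply: (limn_einf_le up); apply: cvg_EFin; first exact: nearW.
have s0 : side k @[k --> \oo] --> (0 : R) by exact: cvg_harmonic.
rewrite /= -[X in _ --> X]mul1r; apply: cvgM; last exact: cvg_cst.
have e1 : (1 : R) = (1 + 0) ^+ q by rewrite addr0 expr1n.
rewrite [X in _ --> X]e1.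
apply: (cvg_comp (fun k => 1 + side k) (fun x : R => x ^+ q)); last exact: exprn_continuous.
by apply: cvgD; [exact: cvg_cst|exact: s0].
Qed.

Lemma intensityE : intensity P N = c%:E.
Proof.
apply/eqP; rewrite eq_le intensity_le/=.
have If : intensity P N \is a fin_num.
  rewrite ge0_fin_numE; first exact: le_lt_trans intensity_le (ltry _).
  by apply: integral_ge0 => w _; exact: measure_ge0.
rewrite -(fineK If) lee_fin; apply/ler_addgt0Pr => e e0.
(* Capped at 1 as [intensity_ge] demands, and small enough that the loss lam e' is at most e. *)
pose e' := Num.min 1 (e / lam).
have e'0 : 0 < e' by rewrite lt_min ltr01 divr_gt0.
have e'1 : e' <= 1 by rewrite ge_min lexx.
have e'e : lam * e' <= e.
  by rewrite mulrC -ler_pdivlMr// ge_min lexx orbT.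
have := intensity_ge e'0 e'1; rewrite -(fineK If) lee_fin /c.
by lra.
Qed.

End intensity.

(** * Comparison of the hazards *)

Lemma product_thinned (R : realType) (q : nat)
    (mu : {sigma_finite_measure set 'rV[R]_q -> \bar R})
    (Q V : probability 'rV[R]_q R) (p : R) (E : set ('rV[R]_q * 'rV[R]_q)) :
  0 <= p -> (forall A : set 'rV[R]_q, measurable A -> ~ A 0 -> Q A = (p%:E * V A)%E) ->
  measurable E -> (forall z, E z -> z.2 <> 0) ->
  fine ((mu \x Q)%E E) = p * fine ((mu \x V)%E E).
Proof.
move=> p0 QV mE E0.
suff -> : (mu \x Q)%E E = (p%:E * (mu \x V) E)%E.
  move: p0; rewrite le_eqVlt => /predU1P[<-|p0]; first by rewrite mul0e mul0r.
  have [fE|] := boolP ((mu \x V)%E E \is a fin_num); first by rewrite fineM.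
  rewrite ge0_fin_numE// -leNgt leye_eq => /eqP ->.
  by rewrite gt0_muley ?lte_fin//= mulr0.
transitivity (\int[mu]_x (p%:E * V (xsection E x)))%E.
  apply: eq_integral => x _; rewrite /= QV//; first exact: measurable_xsection.
  by rewrite xsectionE => /E0.
by rewrite ge0_integralZl//; exact: measurable_fun_xsection.
Qed.

Section thinned_rate.
Context {R : realType} {q : nat}.
Variable mu : {sigma_finite_measure set 'rV[R]_q -> \bar R}.
Hypothesis muE : forall A, measurable A -> mu A = lebesgue_rV A.
Variable V : probability 'rV[R]_q R.
Variable B : set 'rV[R]_q.
Hypotheses (cB : compact B)
  (xB : convex_set (B : set (convex_lmodType 'rV[R]_q)))
  (nB : nbhs (0 : 'rV[R]_q) B).
Hypothesis q0 : (0 < q)%N.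
Variables (t h : R) (C : set 'rV[R]_q).
Hypotheses (t0 : 0 <= t) (h0 : 0 <= h) (mC : measurable C).

Let S := shell B t C h.
Let K := dilated B t.

(* What a secondary point costs: the pair {x, x + Y} with Y <> 0 has two chances
   to enter the shell, but not when the other point is in the dilated body, and
   only once when both points enter. *)
Definition overlap_rate : R := fine ((mu \x V)%E (second_covered S K)) +
  fine ((mu \x V)%E (first_covered S K)) + fine ((mu \x V)%E (both_in S)).

Lemma overlap_rate_ge0 : 0 <= overlap_rate.
Proof. by rewrite !addr_ge0// fine_ge0. Qed.

(** All terms of the decomposition that involve marks live off 0, where Q = p V. The rate is thus
    affine in p, with coefficients common to both processes. *)
Lemma thinned_rate (Q : probability 'rV[R]_q R) (p : R) : 0 <= p ->
  (forall A : set 'rV[R]_q, measurable A -> ~ A 0 -> Q A = (p%:E * V A)%E) ->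
  fine ((mu \x Q)%E (uncovered S K)) =
  fine (mu S) * (1 + p * fine (V [set~ (0 : 'rV[R]_q)])) - p * overlap_rate.
Proof.
move=> p0 QV.
rewrite (hit_decomposition_shell muE Q cB xB nB q0 t0 mC h0).
have mS := measurable_shell cB xB nB t mC h.
have mK := measurable_dilated cB xB nB t.
have m1 : measurable (second_covered S K).
  rewrite (_ : second_covered S K = [set z | S z.1] `&` [set z | K (z.1 + z.2)] `&`
      [set z | z.2 <> 0]); last by apply/seteqP; split => z [] // [].
  apply: measurableI; last exact: measurable_snd_neq0.
  by apply: measurableI; [exact: measurable_fst_preimage|exact: measurable_add_preimage].
have m2 : measurable (first_covered S K).
  rewrite (_ : first_covered S K = [set z | S (z.1 + z.2)] `&` [set z | K z.1] `&`
      [set z | z.2 <> 0]); last by apply/seteqP; split => z [] // [].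
  apply: measurableI; last exact: measurable_snd_neq0.
  by apply: measurableI; [exact: measurable_add_preimage|exact: measurable_fst_preimage].
have m0C := @measurable_setC10 R q.
rewrite /overlap_rate (product_thinned mu p0 QV m1); last by move=> z [].
rewrite (product_thinned mu p0 QV m2); last by move=> z [].
rewrite (product_thinned mu p0 QV (measurable_both_in mS)); last by move=> z [].
rewrite QV//; last by apply.
by rewrite fineM ?fin_num_measure// !mulrDr !opprD.
Qed.

End thinned_rate.

(* Used with [x = V {y | y <> 0}], so that [lam * (1 + p * x)] is the intensity. *)
Lemma secondary_intensity_le (R : realFieldType) (lam lam' p p' x : R) :
  0 < lam -> 0 < lam' -> 0 <= p -> p <= p' -> 0 <= x ->
  lam * (1 + p * x) = lam' * (1 + p' * x) -> lam * p <= lam' * p'.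
Proof.
move=> l0 l0' p0 pp x0 e; rewrite leNgt; apply/negP => lt.
have : lam <= lam' by nra.
by nra.
Qed.

Theorem proposition3p12 (R : realType) (d : nat) (hd : (0 < d)%N)
    (B : set 'rV[R]_d) (B_compact : compact B)
    (B_convex : convex_set (B : set (convex_lmodType 'rV[R]_d)))
    (B_nbhs0 : nbhs (0 : 'rV[R]_d) B)
    (u0 : 'rV[R]_d) (hu0 : frontier (reflection B) u0)
    (V : probability 'rV[R]_d R)
    (disp : measure_display) (Omega : measurableType disp)
    (P : probability Omega R) (p : R) (N : Omega -> set 'rV[R]_d)
    (hN : gauss_poisson_process P V p N)
    (disp' : measure_display) (Omega' : measurableType disp')
    (P' : probability Omega' R) (p' : R) (N' : Omega' -> set 'rV[R]_d)
    (hN' : gauss_poisson_process P' V p' N')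
    (same_intensity : intensity P N = intensity P' N')
    (hp : p <= p') :
  hazard_smaller P P' B u0 N N'.
Proof.
have [mu muE] := @lebesgue_rV_measure R d.
have [lam [Q [X [Y [L [mp Nae [/andP[p0 p1] QV] acQ [rfL NE]]]]]]] :=
  gauss_poisson_marked muE hN.
have [lam' [Q' [X' [Y' [L' [mp' Nae' [/andP[p0' p1'] QV'] acQ' [rfL' NE']]]]]]] :=
  gauss_poisson_marked muE hN'.
move=> t C t0 mC.
have H := hazard_limit muE mp acQ (fun n => (rfL n).1) (fun n => (rfL n).2) NE Nae
  B_compact B_convex B_nbhs0 hd (u0 := u0) t0 mC.
have H' := hazard_limit muE mp' acQ' (fun n => (rfL' n).1) (fun n => (rfL' n).2) NE' Nae'
  B_compact B_convex B_nbhs0 hd (u0 := u0) t0 mC.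
(* Both limits exist, so an inequality valid for every small h > 0 passes to the hazards. *)
apply: (ler_cvg_to H' H); near=> h.
have h0 : 0 < h by [].
rewrite ler_pM2l ?invr_gt0//.
rewrite (thinned_rate muE B_compact B_convex B_nbhs0 hd t0 (ltW h0) mC p0 QV).
rewrite (thinned_rate muE B_compact B_convex B_nbhs0 hd t0 (ltW h0) mC p0' QV').
have J0 := overlap_rate_ge0 mu V B t h C.
have m0C := @measurable_setC10 R d.
pose v := fine (V [set~ (0 : 'rV[R]_d)]).
have Vf : V [set~ (0 : 'rV[R]_d)] = v%:E by rewrite fineK// fin_num_measure.
have v0 : 0 <= v by exact: fine_ge0.
have vQ : fine (Q [set~ (0 : 'rV[R]_d)]) = p * v by rewrite QV ?Vf//; apply.
have vQ' : fine (Q' [set~ (0 : 'rV[R]_d)]) = p' * v by rewrite QV' ?Vf//; apply.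
have ce : lam * (1 + p * v) = lam' * (1 + p' * v).
  have := same_intensity; rewrite (intensityE muE mp acQ Nae hd) vQ.
  by rewrite (intensityE muE mp' acQ' Nae' hd) vQ' => -[].
have lp := secondary_intensity_le (mp_gt0 mp) (mp_gt0 mp') p0 hp v0 ce.
(* The main terms are the common intensity times mu of the shell and cancel; what remains compares
   lam p and lam' p'. *)
rewrite -/v !mulrBr !mulrA ![_ * fine (mu _) * _]mulrAC ce.
by rewrite lerD2l lerN2 ler_wpM2r.
Unshelve. all: by end_near.
Qed.
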